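(* Let $z_0\in\mathbb{C}\setminus\{0\}$ and let $\varphi\in\mathcal{O}^2(\mathbb{C}\setminus\{z_0\})$ be of the form $\varphi(z)=\sum_{n=1}^{\infty}\frac{a_n}{(z-z_0)^n}+\phi(z)$, where $a_1,a_2,\ldots\in\mathbb{C}$, $\lim_{n\to\infty}\sqrt[n]{|a_n|}<1$ and $\phi\in\mathcal{O}^2(\mathbb{C})$. Let $\theta=\arg z_0$, $\delta=2\theta$, and let $\hat u$ be the formal power series solution in $t$ of the Cauchy problem $\partial_t u=\partial_z^2u$, $u(0,z)=\varphi(z)$. Then for every sufficiently small $\varepsilon>0$ there exists $r>0$ such that for every $z\in D_r$, with $\theta_z=\arg(z_0-z)$, the following hold. First, the hyperfunction $F_z(s)=[\varphi(z+s)+\varphi(z-s)]_{\theta_z}$ satisfies $$F_z(s)=\Bigl[\sum_{n=1}^{\infty}\frac{a_n}{(z+s-z_0)^n}\Bigr]_{\theta_z}=-2\pi i\sum_{n=1}^{\infty}\frac{a_n(-1)^{n-1}}{(n-1)!}\,\boldsymbol{\delta}^{(n-1)}(z+s-z_0),$$ where $\boldsymbol{\delta}$ is the Dirac function and $\boldsymbol{\delta}^{(n-1)}$ denotes its $(n-1)$-th derivative. Moreover, for every $t\in S_\delta(\pi-\varepsilon,r)$ the jump of $\hat u$ across the Stokes line $\mathcal{L}_\delta$ is given by the convergent series $$u^{\delta^+}(t,z)-u^{\delta^-}(t,z)=-i\sqrt{\frac{\pi}{t}}\sum_{n=1}^{\infty}\frac{a_n(-1)^{n-1}}{(n-1)!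}\,\frac{\mathrm{d}^{n-1}}{\mathrm{d}s^{n-1}}e^{-\frac{s^2}{4t}}\Bigg|_{s=z_0-z}.$$
   Context: Sectors and discs. $D_r=\{z\in\mathbb{C}:|z|<r\}$; $D$ denotes a disc centred at $0$ whose radius is inessential. $S_d(\alpha,R)=\{re^{i\phi}: 0<r<R,\ \phi\in(d-\alpha/2,d+\alpha/2)\}$ in the universal covering of $\mathbb{C}\setminus\{0\}$; $S_d(\alpha)=S_d(\alpha,+\infty)$; $S_d$ means $S_d(\alpha)$ with inessential $\alpha>0$; $\widehat S_d=S_d\cup D$, $\widehat S_d(\alpha)=S_d(\alpha)\cup D$. $\mathcal{L}_d=\{t:\arg t=d\}$. Powers $\sqrt t$ are taken with the branch determined by $\arg t$. The branch of $\arg(z_0-z)$ is chosen continuous for small $z$ and equal to $\theta$ at $z=0$. Growth. A function holomorphic on an unbounded sector $S$ is of exponential growth of order at most $k$ ($f\in\mathcal{O}^k(S)$) if on every proper subsector $S^*$ (i.e. $\overline{S^*}\setminus\{0\}\subseteq S$) one has $|f(x)|\le C_1e^{C_2|x|^k}$ for some $C_1,C_2>0$. The notation $\mathcal{O}^k(G)$ is used analogously for other unbounded domains $G$; $\phi\in\mathcal{O}^2(\mathbb{C})$ means $\phi$ is entire with $|\phi(z)|\le C_1e^{C_2|z|^2}$, and $\varphi\in\mathcal{O}^2(\mathbb{C}\setminus\{z_0\})$ means $\varphi$ is holomorphic on $\mathbb{C}\setminus\{z_0\}$ with such a bound outside every neighbourhood of $z_0$. Summability. $\hat u(t,z)=\sum_{n\ge0}\frac{\varphi^{(2n)}(z)}{n!}t^n$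 is the unique formal solution. A series $\hat f=\sum a_nt^n$ (with coefficients in $\mathbb{C}$, or holomorphic in $z\in D$) is $1$-summable in direction $d$ if $g(t)=\sum a_n\frac{\Gamma(1+n)}{\Gamma(1+2n)}t^n\in\mathcal{O}^1(\widehat S_d(\varepsilon))$ for some $\varepsilon>0$; its $1$-sum in direction $d$ is $f^d(t)=t^{-1/2}\int_{e^{i\psi}\mathbb{R}_+}g(s)\,C_2((s/t)^{1/2})\,ds^{1/2}$ with $\psi\in(d-\varepsilon/2,d+\varepsilon/2)$, where $C_2(\tau)=\sum_{n\ge0}\frac{(-\tau)^n}{n!\,\Gamma(1-\frac{n+1}{2})}=\frac1{\sqrt\pi}e^{-\tau^2/4}$. For the heat equation the $1$-sum in a nonsingular direction $\psi$ is $u^\psi(t,z)=\frac1{\sqrt{4\pi t}}\int_0^{e^{i\psi/2}\infty}(\varphi(z+s)+\varphi(z-s))e^{-s^2/(4t)}ds$. A Stokes line is a line $\mathcal{L}_d$ with $d$ a singular (non-summable) direction. The jump across $\mathcal{L}_\delta$ is $u^{\delta^+}-u^{\delta^-}$, where $u^{\delta^\pm}$ is the $1$-sum of $\hat u$ in a direction $\delta^\pm$ close to $\delta$, with $\delta^+>\delta$ and $\delta^-<\delta$ (for given small $z$ the directions are such that $\delta^-/2<\theta_z<\delta^+/2$). Hyperfunctions. $\mathcal{H}^k(\mathcal{L}_d)=\mathcal{O}^k(D\cup(S_d\setminus\mathcal{L}_d))/\mathcal{O}^k(\widehat S_d)$; the class of $g$ is written $[g(s)]_d$. It acts as an analytic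 functional by $[g(s)]_d[\psi(s)]=\int_{\gamma_d}g(s)\psi(s)\,ds$ for sufficiently small (rapidly decaying) holomorphic $\psi$ on $\widehat S_d$, where $\gamma_d$ consists of the half-line from $e^{id^-}\infty$ to $0$ followed by the half-line from $0$ to $e^{id^+}\infty$ (with $d^-<d<d^+$ close to $d$). Here $F_z$ is an element of $\mathcal{O}^2(D\cup(S_\theta(\alpha)\setminus\mathcal{L}_{\theta_z}))/\mathcal{O}^2(D\cup S_\theta(\alpha))$ for a small opening $\alpha>0$. The Dirac function at $a\in\mathcal{L}_d$ is the hyperfunction $\boldsymbol{\delta}(s-a)=\bigl[-\frac{1}{2\pi i(s-a)}\bigr]_d$, and its derivatives are obtained by differentiating the defining function: $\boldsymbol{\delta}^{(n)}(s-a)=\bigl[-\frac{(-1)^nn!}{2\pi i(s-a)^{n+1}}\bigr]_d$; $\boldsymbol{\delta}^{(n)}(z+s-z_0)$ is the case $a=z_0-z$, $d=\theta_z$. (Boldface $\boldsymbol\delta$ is the Dirac function; plain $\delta$ is the direction $2\arg z_0$.)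
   Formalization: The printed jump formula has the wrong sign for even n (e.g. a_2=1, others 0); the formal version multiplies the n-th term by a further (-1)^{n-1}, so the jump is -i√(π/t) Σ a_n/(n-1)! · d^{n-1}/ds^{n-1} e^{-s²/(4t)} at s=z_0-z. *)

(* Defs.v *)
(* Stdlib reals with Coquelicot's complex numbers. *)
From Stdlib Require Export Reals Factorial.
From Coquelicot Require Export Coquelicot.
Open Scope R_scope.

(** ** Complex plane, polar coordinates

    A point of the universal covering of C \ {0} is a pair (r, x) with r > 0
    and x : R; its projection to C is [polar r x]. *)

Definition cis (x : R) : C := (cos x, sin x).

Definition polar (r x : R) : C := (RtoC r * cis x)%C.

(* The square root of the point (r, x) of the covering. *)
Definition sqrt_polar (r x : R) : C := polar (sqrt r) (x / 2).

Definition Cexp (z : C) : C := (RtoC (exp (Re z)) * cis (Im z))%C.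

Definition C_diff (f : C -> C) (z l : C) : Prop :=
  is_derive (K := C_AbsRing) (V := C_NormedModule) f z l.

Definition holomorphic_on (G : C -> Prop) (f : C -> C) : Prop :=
  forall z, G z -> exists l, C_diff f z l.

Fixpoint C_derive_n (f : C -> C) (n : nat) : C -> C :=
  match n with
  | O => f
  | S m => C_derive (C_derive_n f m)
  end.

(* [z] ranges over a disc about 0; [thz z] is the branch of arg (z0 - z) that
   is continuous near 0 and takes the value [th] at 0. *)
Definition arg_branch (z0 : C) (th : R) (thz : C -> R) : Prop :=
  thz (RtoC 0) = th /\
  exists rho, 0 < rho /\
    forall z, Cmod z < rho ->
      (z0 - z)%C = polar (Cmod (z0 - z)%C) (thz z) /\
      continuous (T := C_UniformSpace) (U := R_UniformSpace) thz z.

(* [Rpower 0 y] is 1 in the library, hence the case distinction. *)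
Definition nth_root (n : nat) (x : R) : R :=
  if Req_EM_T x 0 then 0 else Rpower x (/ INR n).

(** ** Exponential growth *)

Definition exp_bounded (k : nat) (E : C -> Prop) (f : C -> C) : Prop :=
  exists C1 C2, 0 < C1 /\ 0 < C2 /\
    forall z, E z -> Cmod (f z) <= C1 * exp (C2 * Cmod z ^ k).

Definition O_entire (k : nat) (f : C -> C) : Prop :=
  holomorphic_on (fun _ => True) f /\ exp_bounded k (fun _ => True) f.

Definition O_punctured (k : nat) (z0 : C) (f : C -> C) : Prop :=
  holomorphic_on (fun z => z <> z0) f /\
  forall rho, 0 < rho -> exp_bounded k (fun z => rho <= Cmod (z - z0)%C) f.

(* The disc of radius [rho] together with the rays whose argument lies in [I];
   only used for sets [I] contained in an interval of length less than 2 PI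
   when the rays have to be identified with those of the covering. *)
Definition disc_rays (I : R -> Prop) (rho : R) (z : C) : Prop :=
  Cmod z < rho \/ exists r x, 0 < r /\ I x /\ z = polar r x.

Definition closed_itv (a b : R) : R -> Prop := fun x => a <= x <= b.

Definition opening (d alpha : R) : R -> Prop :=
  fun x => Rabs (x - d) < alpha / 2.

Definition slit_opening (d alpha l : R) : R -> Prop :=
  fun x => opening d alpha x /\ x <> l.

(* The class O^k on [disc_rays I rho]: the growth bound is required on the
   union of each proper closed subsector and each smaller disc. *)
Definition O_rays (k : nat) (I : R -> Prop) (rho : R) (f : C -> C) : Prop :=
  holomorphic_on (disc_rays I rho) f /\
  forall a b rho', 0 < rho' < rho -> (forall x, closed_itv a b x -> I x) ->
    exp_bounded k (disc_rays (closed_itv a b) rho') f.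

(** ** Hyperfunctions

    A hyperfunction on the ray of argument [l] is the class of a defining
    function in O^k(D u (S_d(alpha) \ L_l)) modulo O^k(D u S_d(alpha)).  It is
    handled through its defining functions; [hyper_eq] is equality of classes,
    and includes that both sides are defining functions.  The radius of the
    disc D is inessential. *)
Definition hyper_eq (k : nat) (d alpha l : R) (f g : C -> C) : Prop :=
  exists rho, 0 < rho /\
    O_rays k (slit_opening d alpha l) rho f /\
    O_rays k (slit_opening d alpha l) rho g /\
    exists h, O_rays k (opening d alpha) rho h /\
      forall s, disc_rays (slit_opening d alpha l) rho s ->
        (f s - g s)%C = h s.

(* The sum of the series of hyperfunctions [h 0] + [h 1] + ... is the class of
   [H], where the given defining functions are summed in O^k: the partial sums
   converge to [H] uniformly on proper closed subsectors and smaller discs,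
   with respect to a weight exp(-c|s|^k).  The defining functions must not be
   replaced by other representatives term by term: by Runge's theorem series of
   representatives of 0 can converge to functions whose class is not 0. *)
Definition hyper_series (k : nat) (d alpha l : R)
    (h : nat -> C -> C) (H : C -> C) : Prop :=
  exists rho, 0 < rho /\
    (forall n, O_rays k (slit_opening d alpha l) rho (h n)) /\
    O_rays k (slit_opening d alpha l) rho H /\
    forall a b rho', 0 < rho' < rho ->
      (forall x, closed_itv a b x -> slit_opening d alpha l x) ->
      exists c, 0 < c /\
        forall eps, 0 < eps -> exists N : nat, forall n, (N <= n)%nat ->
          forall s, disc_rays (closed_itv a b) rho' s ->
            Cmod (sum_n (fun m => h m s) n - H s)%C
              <= eps * exp (c * Cmod s ^ k).

(* Defining function of the [n]-th derivative of the Dirac function at [a]. *)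
Definition dirac (n : nat) (a : C) : C -> C :=
  C_derive_n (fun s => (- (1 / (2 * PI * Ci * (s - a))))%C) n.

(** ** Formal solution of the heat equation and 1-summability *)

(* u = sum_n u_n(z) t^n with u_n holomorphic near 0, d_t u = d_z^2 u and
   u(0, z) = phi(z). *)
Definition formal_heat_solution (phi : C -> C) (u : nat -> C -> C) : Prop :=
  exists rho, 0 < rho /\
    (forall z, Cmod z < rho -> u O z = phi z) /\
    forall n, exists u', forall z, Cmod z < rho ->
      C_diff (u n) z (u' z) /\
      C_diff u' z (RtoC (INR (S n)) * u (S n) z)%C.

(* [g] is the continuation to D u S_d(eps), of exponential growth of order 1, of
   sum_n c_n Gamma(1+n)/Gamma(1+2n) s^n. *)
Definition borel_continuation (d eps : R) (c : nat -> C) (g : C -> C) : Prop :=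
  exists rho, 0 < rho /\
    O_rays 1 (opening d eps) rho g /\
    forall s, Cmod s < rho ->
      is_series (K := C_AbsRing) (V := C_NormedModule)
        (fun n => (c n * RtoC (INR (fact n) / INR (fact (2 * n))) * s ^ n)%C)
        (g s).

(* C_2(x) = sum_n (-x)^n / (n! Gamma(1 - (n+1)/2)), in closed form. *)
Definition kernel2 (x : C) : C :=
  (RtoC (/ sqrt PI) * Cexp (- (x ^ 2) / 4))%C.

(* The Laplace-type integral
     t^(-1/2) int_{e^(i psi) R+} g(s) C_2((s/t)^(1/2)) d(s^(1/2))
   at the point t = (r, tau) of the covering, with s = x^2 e^(i psi), x > 0,
   so that s^(1/2) = x e^(i psi/2). *)
Definition is_laplace (g : C -> C) (psi r tau : R) (v : C) : Prop :=
  exists w : C,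
    is_RInt_gen (V := C_R_NormedModule)
      (fun x : R =>
         (g (polar (x ^ 2) psi)
          * kernel2 (polar x (psi / 2) / sqrt_polar r tau)
          * cis (psi / 2))%C)
      (at_point 0) (Rbar_locally p_infty) w /\
    v = (w / sqrt_polar r tau)%C.

(* The series sum_n c_n t^n is 1-summable in the direction [d] and [u] is its
   1-sum on the set [T] of points of the covering.  The ray of integration may
   be rotated within the sector of [g]; the kernel has to decay along it. *)
Definition is_one_sum (d : R) (c : nat -> C) (T : R -> R -> Prop)
    (u : R -> R -> C) : Prop :=
  exists eps g, 0 < eps /\ borel_continuation d eps c g /\
    forall r tau, T r tau ->
      exists psi, opening d eps psi /\ Rabs (tau - psi) < PI / 2 /\
        is_laplace g psi r tau (u r tau).

(* The bounded sector S_d(alpha, R) of the covering. *)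
Definition sector (d alpha R0 : R) : R -> R -> Prop :=
  fun r x => 0 < r < R0 /\ opening d alpha x.

(** ** Data of the jump formula *)

(* a_(n+1) (-1)^n / n! *)
Definition jump_coef (a : nat -> C) (n : nat) : C :=
  (a (S n) * (- (1)) ^ n / RtoC (INR (fact n)))%C.

Definition heat_gauss (r tau : R) (s : C) : C :=
  Cexp (- (s ^ 2) / (4 * polar r tau))%C.

(* The value of the n-th derivative of the Dirac function at [b] on the test
   function [psi]: (-1)^n times the n-th derivative of [psi] at [b]. *)
Definition dirac_value (n : nat) (b : C) (psi : C -> C) : C :=
  ((- (1)) ^ n * C_derive_n psi n b)%C.

(* Main.v *)
(** Write b = z0 - z, F(s) = phi(z+s) + phi(z-s) and G(s) = exp(-s^2/(4t)).
    Then F = P + H with P(s) = sum a_n/(s-b)^n and H(s) = phi0(z+s) + phi(z-s),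
    where H is holomorphic on the half-plane Re(s/b) >= 0.  This already gives
    the hyperfunction identities, since the series P converges uniformly away
    from b.

    The Borel transform of the formal solution is F(sqrt s)/2, which continues to
    every direction d with d/2 <> arg b; after the substitution s -> s^2 the sum
    in the direction d is the integral of F G / sqrt(4 pi t) along the ray of
    argument d/2.  Two such rays on either side of b, cut at radius T, bound a
    triangle (0, A, B) containing b.  Over its boundary H G integrates to 0 by
    Goursat's theorem, and a_n G/(s-b)^n integrates to
    2 pi i a_n G^(n-1)(b)/(n-1)!.  The integral over the side AB tends to 0 as
    T grows, so only the series of residues is left. *)

Require Import Defs.
From Stdlib Require Import Reals Lra Lia IndefiniteDescription FunctionalExtensionality.
From Coquelicot Require Import Coquelicot.
Open Scope R_scope.

(** The radius [r] must be fixed before [z] and the two directions. If |d - delta| <= eps/4 and t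
    lies in the sector, then |d - arg t| <= PI/2 - eps/4, so on the ray of argument d/2 the Gaussian
    decays like exp(-k T^2/(4|t|)) with k = sin(eps/4). It has to absorb the growth exp(2 A2 T^2) of
    F, whose rate is doubled by |z+s|^2 <= 2|z|^2 + 2|s|^2. This asks for 4|t|(2 A2 + 1) <= k, and
    it works only because A2 depends neither on z nor on the distance kept from the singularity. The
    same inequality controls the side AB: the square of a point on it is a combination, with
    nonnegative weights, of the directions p, (p+q)/2 and q, all close to delta. The formal solution
    enters through n! u_n = phi^(2n). Its Borel coefficients are then phi^(2n)(z)/(2n)!, the even
    part of the Taylor series of phi at z, whence F(sqrt s)/2. The singularity sits at s = b^2, of
    argument 2 arg b, and moves around delta with z; so it is arg b, and not theta, that must
    separate the two half-directions. *)

Local Notation Cseries := (is_series (K := C_AbsRing) (V := C_NormedModule)).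
Local Notation Csum := (sum_n (G := C_NormedModule)).
Local Notation R_diff := (is_derive (K := R_AbsRing) (V := C_R_NormedModule)).
Local Notation is_edge a b c x y :=
  (x = a /\ y = b \/ x = b /\ y = c \/ x = c /\ y = a).

(** ** Complex and real differentiability *)

(** Integrals of complex functions live in the real normed module on C, complex derivatives in the
    module over C itself. This equality lets both be estimated with [Cmod]. *)
Lemma norm_C_R (z : C) : norm (V := C_R_NormedModule) z = Cmod z.
Proof.
  unfold Cmod, norm; simpl. unfold prod_norm, norm; simpl. unfold abs; simpl.
  f_equal. destruct z as [x y]; simpl.
  assert (H : forall t, Rabs t * (Rabs t * 1) = t * (t * 1)).
  { intro t. replace (Rabs t * (Rabs t * 1)) with (Rabs t * Rabs t) by ring.
    rewrite <- Rabs_mult, Rabs_pos_eq; nra. }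
  now rewrite !H.
Qed.

Lemma C_diff_eps (f : C -> C) (z l : C) :
  C_diff f z l <->
  forall eps, 0 < eps -> exists d, 0 < d /\ forall y, Cmod (y - z) < d ->
    Cmod (f y - f z - l * (y - z)) <= eps * Cmod (y - z).
Proof.
  unfold C_diff, is_derive. split.
  - intros [_ H] eps He.
    specialize (H z (fun P HP => HP)).
    destruct (H (mkposreal _ He)) as [d Hd].
    exists d; split; [apply cond_pos|]. intros y Hy.
    specialize (Hd y Hy).
    simpl in Hd. rewrite (Cmult_comm l). exact Hd.
  - intros H. split. { apply is_linear_scal_l. }
    intros x Hx.
    assert (E : z = x).
    { apply (is_filter_lim_locally_unique (V := AbsRing_NormedModule C_AbsRing)). exact Hx. }
    rewrite <- E. clear x Hx E.
    intros eps. destruct (H eps (cond_pos eps)) as [d [Hd H1]].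
    exists (mkposreal _ Hd). intros y Hy.
    specialize (H1 y Hy). rewrite (Cmult_comm l) in H1. exact H1.
Qed.

Lemma R_diff_eps (f : R -> C) (x : R) (l : C) :
  R_diff f x l <->
  forall eps, 0 < eps -> exists d, 0 < d /\ forall y, Rabs (y - x) < d ->
    Cmod (f y - f x - l * RtoC (y - x)) <= eps * Rabs (y - x).
Proof.
  assert (E : forall k : R, scal (V := C_R_NormedModule) k l = (l * RtoC k)%C).
  { intro k. unfold scal; simpl. unfold prod_scal, scal; simpl. unfold mult; simpl.
    destruct l as [u v]. unfold Cmult, RtoC; simpl. f_equal; ring. }
  unfold is_derive. split.
  - intros [_ H] eps He.
    specialize (H x (fun P HP => HP)).
    destruct (H (mkposreal _ He)) as [d Hd].
    exists d; split; [apply cond_pos|]. intros y Hy.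
    specialize (Hd y Hy). simpl in Hd.
    change (norm (V := C_R_NormedModule) (minus (minus (f y) (f x)) (scal (y - x) l)) <= eps * Rabs (y - x)) in Hd.
    rewrite norm_C_R, E in Hd. exact Hd.
  - intros H. split. { apply is_linear_scal_l. }
    intros x0 Hx.
    assert (E1 : x = x0).
    { apply (is_filter_lim_locally_unique (V := AbsRing_NormedModule R_AbsRing)). exact Hx. }
    rewrite <- E1. clear x0 Hx E1.
    intros eps. destruct (H eps (cond_pos eps)) as [d [Hd H1]].
    exists (mkposreal _ Hd). intros y Hy.
    specialize (H1 y Hy).
    change (norm (V := C_R_NormedModule) (minus (minus (f y) (f x)) (scal (y - x) l)) <= eps * Rabs (y - x)).
    rewrite norm_C_R, E. exact H1.
Qed.

Lemma R_cont_eps (f : R -> C) (x : R) :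
  continuous (U := C_R_NormedModule) f x <->
  forall eps, 0 < eps -> exists d, 0 < d /\ forall y, Rabs (y - x) < d ->
    Cmod (f y - f x) < eps.
Proof.
  split.
  - intros H eps He.
    destruct (proj1 (filterlim_locally_ball_norm (U := C_R_NormedModule) f (f x)) H
      (mkposreal _ He)) as [d Hd].
    exists d; split; [apply cond_pos|]. intros y Hy.
    specialize (Hd y Hy). unfold ball_norm in Hd. rewrite norm_C_R in Hd. exact Hd.
  - intros H.
    apply (filterlim_locally_ball_norm (U := C_R_NormedModule) f (f x)).
    intros eps. destruct (H eps (cond_pos eps)) as [d [Hd H1]].
    exists (mkposreal _ Hd). intros y Hy. unfold ball_norm. rewrite norm_C_R.
    exact (H1 y Hy).
Qed.

Lemma C_diff_const (c z : C) : C_diff (fun _ => c) z 0%C.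
Proof. apply (is_derive_const (K := C_AbsRing) (V := C_NormedModule)). Qed.

Lemma C_diff_id (z : C) : C_diff (fun s => s) z 1%C.
Proof.
  apply C_diff_eps. intros eps He. exists 1; split; [lra|]. intros y _.
  replace (y - z - 1 * (y - z))%C with (RtoC 0) by ring.
  rewrite Cmod_0. apply Rmult_le_pos; [lra|apply Cmod_ge_0].
Qed.

Lemma C_diff_plus (f g : C -> C) (z l m : C) :
  C_diff f z l -> C_diff g z m -> C_diff (fun s => (f s + g s)%C) z (l + m)%C.
Proof. apply (is_derive_plus (K := C_AbsRing) (V := C_NormedModule)). Qed.

Lemma C_diff_minus (f g : C -> C) (z l m : C) :
  C_diff f z l -> C_diff g z m -> C_diff (fun s => (f s - g s)%C) z (l - m)%C.
Proof. apply (is_derive_minus (K := C_AbsRing) (V := C_NormedModule)). Qed.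

Lemma C_diff_ext_loc (f g : C -> C) (z l : C) (d : R) : 0 < d ->
  (forall y, Cmod (y - z) < d -> f y = g y) -> C_diff f z l -> C_diff g z l.
Proof.
  intros Hd E H. apply C_diff_eps. intros eps He.
  destruct (proj1 (C_diff_eps f z l) H eps He) as [d1 [Hd1 H1]].
  exists (Rmin d d1). split. { now apply Rmin_pos. }
  intros y Hy.
  assert (Cmod (y - z) < d) by (eapply Rlt_le_trans; [exact Hy|apply Rmin_l]).
  assert (Cmod (y - z) < d1) by (eapply Rlt_le_trans; [exact Hy|apply Rmin_r]).
  assert (E0 : Cmod (z - z) < d).
  { replace (z - z)%C with (RtoC 0) by ring. now rewrite Cmod_0. }
  rewrite <- (E y), <- (E z) by assumption. auto.
Qed.

Lemma C_diff_locally_lipschitz (f : C -> C) (z l : C) : C_diff f z l ->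
  exists d, 0 < d /\ forall y, Cmod (y - z) < d ->
    Cmod (f y - f z) <= (Cmod l + 1) * Cmod (y - z).
Proof.
  intros H. destruct (proj1 (C_diff_eps f z l) H 1 Rlt_0_1) as [d [Hd H1]].
  exists d; split; [exact Hd|]. intros y Hy. specialize (H1 y Hy).
  replace (f y - f z)%C with ((f y - f z - l * (y - z)) + l * (y - z))%C by ring.
  eapply Rle_trans; [apply Cmod_triangle|]. rewrite (Cmod_mult l). lra.
Qed.

Lemma C_diff_comp (f g : C -> C) (z l m : C) :
  C_diff f (g z) l -> C_diff g z m -> C_diff (fun s => f (g s)) z (l * m)%C.
Proof.
  intros Hf Hg. apply C_diff_eps. intros eps He.
  destruct (C_diff_locally_lipschitz g z m Hg) as [d1 [Hd1 H1]].
  set (K := Cmod m + 1) in *. assert (HK : 0 < K).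
  { unfold K. generalize (Cmod_ge_0 m). lra. }
  assert (He1 : 0 < eps / (2 * K)) by (apply Rdiv_lt_0_compat; lra).
  destruct (proj1 (C_diff_eps _ _ _) Hf _ He1) as [d2 [Hd2 H2]].
  assert (HL : 0 < Cmod l + 1) by (generalize (Cmod_ge_0 l); lra).
  assert (He2 : 0 < eps / (2 * (Cmod l + 1))) by (apply Rdiv_lt_0_compat; lra).
  destruct (proj1 (C_diff_eps _ _ _) Hg _ He2) as [d3 [Hd3 H3]].
  exists (Rmin d1 (Rmin (d2 / K) d3)). split.
  { repeat apply Rmin_pos; trivial. now apply Rdiv_lt_0_compat. }
  intros y Hy.
  assert (Y1 : Cmod (y - z) < d1) by (eapply Rlt_le_trans; [exact Hy|apply Rmin_l]).
  assert (Y2 : Cmod (y - z) < d2 / K).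
  { eapply Rlt_le_trans; [exact Hy|]. eapply Rle_trans; [apply Rmin_r|apply Rmin_l]. }
  assert (Y3 : Cmod (y - z) < d3).
  { eapply Rlt_le_trans; [exact Hy|]. eapply Rle_trans; [apply Rmin_r|apply Rmin_r]. }
  specialize (H1 _ Y1). specialize (H3 _ Y3).
  assert (Y4 : Cmod (g y - g z) < d2).
  { eapply Rle_lt_trans; [exact H1|].
    replace d2 with (K * (d2 / K)) by (field; lra). now apply Rmult_lt_compat_l. }
  specialize (H2 _ Y4).
  replace (f (g y) - f (g z) - l * m * (y - z))%C with
    ((f (g y) - f (g z) - l * (g y - g z)) + l * (g y - g z - m * (y - z)))%C by ring.
  eapply Rle_trans; [apply Cmod_triangle|]. rewrite (Cmod_mult l).
  set (N := Cmod (y - z)) in *. assert (0 <= N) by apply Cmod_ge_0.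
  assert (A1 : eps / (2 * K) * Cmod (g y - g z) <= eps / 2 * N).
  { replace (eps / 2 * N) with (eps / (2 * K) * (K * N)) by (field; lra).
    apply Rmult_le_compat_l; lra. }
  assert (A2 : Cmod l * Cmod (g y - g z - m * (y - z)) <= eps / 2 * N).
  { replace (eps / 2 * N) with ((Cmod l + 1) * (eps / (2 * (Cmod l + 1)) * N)) by (field; lra).
    apply Rmult_le_compat; try apply Cmod_ge_0; lra. }
  lra.
Qed.

Lemma C_diff_mult (f g : C -> C) (z l m : C) :
  C_diff f z l -> C_diff g z m ->
  C_diff (fun s => (f s * g s)%C) z (l * g z + f z * m)%C.
Proof.
  intros Hf Hg. apply C_diff_eps. intros eps He.
  destruct (C_diff_locally_lipschitz f z l Hf) as [d1 [Hd1 H1]].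
  destruct (C_diff_locally_lipschitz g z m Hg) as [d2 [Hd2 H2]].
  assert (P1 := Cmod_ge_0 l). assert (P2 := Cmod_ge_0 m).
  assert (P3 := Cmod_ge_0 (f z)). assert (P4 := Cmod_ge_0 (g z)).
  assert (He3 : 0 < eps / (3 * (Cmod (g z) + 1))) by (apply Rdiv_lt_0_compat; lra).
  assert (He4 : 0 < eps / (3 * (Cmod (f z) + 1))) by (apply Rdiv_lt_0_compat; lra).
  destruct (proj1 (C_diff_eps _ _ _) Hf _ He3) as [d3 [Hd3 H3]].
  destruct (proj1 (C_diff_eps _ _ _) Hg _ He4) as [d4 [Hd4 H4]].
  (* The product of the two increments is at most (|l|+1)(|m|+1)|y-z|^2; the radius eps/q brings it
     below eps/3 |y-z|. *)
  set (q := 3 * ((Cmod l + 1) * (Cmod m + 1))).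
  assert (Hq : 0 < q). { unfold q. repeat apply Rmult_lt_0_compat; lra. }
  assert (Hd5 : 0 < eps / q) by now apply Rdiv_lt_0_compat.
  exists (Rmin (Rmin d1 d2) (Rmin (Rmin d3 d4) (eps / q))). split.
  { repeat apply Rmin_pos; trivial. }
  intros y Hy.
  apply Rmin_Rgt in Hy. destruct Hy as [Ha Hb].
  apply Rmin_Rgt in Ha. destruct Ha as [Y1 Y2].
  apply Rmin_Rgt in Hb. destruct Hb as [Hc Y5].
  apply Rmin_Rgt in Hc. destruct Hc as [Y3 Y4].
  specialize (H1 _ Y1). specialize (H2 _ Y2). specialize (H3 _ Y3). specialize (H4 _ Y4).
  replace (f y * g y - f z * g z - (l * g z + f z * m) * (y - z))%C with
    ((f y - f z - l * (y - z)) * g z + f z * (g y - g z - m * (y - z))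
      + (f y - f z) * (g y - g z))%C by ring.
  eapply Rle_trans; [apply Cmod_triangle|].
  eapply Rle_trans; [apply Rplus_le_compat_r, Cmod_triangle|].
  rewrite !(Cmod_mult (_ - _)), (Cmod_mult (f z)).
  set (N := Cmod (y - z)) in *. assert (0 <= N) by apply Cmod_ge_0.
  assert (A1 : Cmod (f y - f z - l * (y - z)) * Cmod (g z) <= eps / 3 * N).
  { replace (eps / 3 * N) with (eps / (3 * (Cmod (g z) + 1)) * N * (Cmod (g z) + 1)) by (field; lra).
    apply Rmult_le_compat; try apply Cmod_ge_0; lra. }
  assert (A2 : Cmod (f z) * Cmod (g y - g z - m * (y - z)) <= eps / 3 * N).
  { replace (eps / 3 * N) with ((Cmod (f z) + 1) * (eps / (3 * (Cmod (f z) + 1)) * N)) by (field; lra).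
    apply Rmult_le_compat; try apply Cmod_ge_0; lra. }
  assert (A3 : Cmod (f y - f z) * Cmod (g y - g z) <= eps / 3 * N).
  { apply Rle_trans with ((Cmod l + 1) * N * ((Cmod m + 1) * N)).
    - apply Rmult_le_compat; try apply Cmod_ge_0; lra.
    - replace (eps / 3 * N) with ((Cmod l + 1) * N * ((Cmod m + 1) * (eps / q)))
        by (unfold q; field; lra).
      apply Rmult_le_compat_l. { apply Rmult_le_pos; lra. }
      apply Rmult_le_compat_l; lra. }
  lra.
Qed.

Lemma C_diff_scal (f : C -> C) (c z l : C) :
  C_diff f z l -> C_diff (fun s => (c * f s)%C) z (c * l)%C.
Proof.
  intros Hf. replace (c * l)%C with (0 * f z + c * l)%C by ring.
  apply (C_diff_mult (fun _ => c) f). { apply C_diff_const. } exact Hf.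
Qed.

Lemma Cmod_sub_ge (x y : C) : Cmod x - Cmod y <= Cmod (x - y).
Proof.
  generalize (Cmod_triangle (x - y) y). replace (x - y + y)%C with x by ring. lra.
Qed.

Lemma Cmod_sub_sym (x y : C) : Cmod (x - y) = Cmod (y - x).
Proof. rewrite <- Cmod_opp. f_equal. ring. Qed.

Lemma C_diff_inv (z : C) : z <> RtoC 0 -> C_diff Cinv z (- / (z * z))%C.
Proof.
  intros Hz. apply C_diff_eps. intros eps He.
  assert (Hz' : 0 < Cmod z) by now apply Cmod_gt_0.
  set (r := Cmod z) in *.
  exists (Rmin (r / 2) (eps * r ^ 3 / 2)). split.
  { apply Rmin_pos; [lra|]. assert (0 < r ^ 3) by now apply pow_lt. nra. }
  intros y Hy.
  assert (Y1 : Cmod (y - z) < r / 2) by (eapply Rlt_le_trans; [exact Hy|apply Rmin_l]).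
  assert (Y2 : Cmod (y - z) < eps * r ^ 3 / 2) by (eapply Rlt_le_trans; [exact Hy|apply Rmin_r]).
  assert (Y3 : r / 2 < Cmod y).
  { generalize (Cmod_sub_ge z y). rewrite Cmod_sub_sym. fold r. lra. }
  assert (Hy0 : y <> RtoC 0).
  { apply Cmod_gt_0. lra. }
  replace (/ y - / z - - / (z * z) * (y - z))%C with
    ((y - z) * (y - z) / (y * (z * z)))%C by (field; auto).
  rewrite Cmod_div by (repeat apply Cmult_neq_0; auto).
  rewrite !Cmod_mult. fold r. set (N := Cmod (y - z)) in *. set (q := Cmod y) in *.
  assert (0 <= N) by apply Cmod_ge_0.
  apply Rle_div_l. { apply Rmult_lt_0_compat; nra. }
  assert (N <= eps * (q * (r * r))).
  { apply Rle_trans with (eps * r ^ 3 / 2); [lra|].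
    assert (0 < r * r) by nra. assert (r * r * r <= 2 * q * (r*r)) by nra. nra. }
  nra.
Qed.

Lemma C_diff_pow (f : C -> C) (z l : C) (n : nat) : C_diff f z l ->
  C_diff (fun s => (f s ^ n)%C) z (RtoC (INR n) * f z ^ (pred n) * l)%C.
Proof.
  intros Hf. induction n as [|n IH].
  - simpl. replace (0 * 1 * l)%C with (RtoC 0) by ring. apply C_diff_const.
  - change (C_diff (fun s => (f s * f s ^ n)%C) z (RtoC (INR (S n)) * f z ^ (pred (S n)) * l)%C).
    replace (RtoC (INR (S n)) * f z ^ (pred (S n)) * l)%C
      with (l * f z ^ n + f z * (RtoC (INR n) * f z ^ pred n * l))%C.
    + now apply C_diff_mult.
    + rewrite S_INR, RtoC_plus. simpl pred. destruct n as [|n]; simpl; ring.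
Qed.

Lemma R_diff_eq (f : R -> C) (x : R) (l m : C) : l = m ->
  R_diff f x l ->
  R_diff f x m.
Proof. now intros ->. Qed.

(** This is the bridge from complex derivatives to the real calculus used for integrals along
    segments. The bounds use [Cmod c + 1] because the direction [c] may be 0. *)
Lemma R_diff_comp_affine (f : C -> C) (a c : C) (x : R) (l : C) :
  C_diff f (a + x * c)%C l ->
  R_diff (fun t : R => f (a + t * c)%C) x (l * c)%C.
Proof.
  intros Hf. apply R_diff_eps. intros eps He.
  assert (Hc : 0 < Cmod c + 1) by (generalize (Cmod_ge_0 c); lra).
  assert (He1 : 0 < eps / (Cmod c + 1)) by (apply Rdiv_lt_0_compat; lra).
  destruct (proj1 (C_diff_eps _ _ _) Hf _ He1) as [d [Hd H]].
  exists (d / (Cmod c + 1)). split; [now apply Rdiv_lt_0_compat|].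
  intros y Hy.
  assert (E : (a + y * c - (a + x * c))%C = (RtoC (y - x) * c)%C) by (rewrite RtoC_minus; ring).
  specialize (H (a + y * c)%C). rewrite E in H. rewrite !Cmod_mult, Cmod_R in H.
  replace (f (a + y * c)%C - f (a + x * c)%C - l * c * (y - x)%R)%C
    with (f (a + y * c)%C - f (a + x * c)%C - l * ((y - x)%R * c))%C by ring.
  assert (0 <= Rabs (y - x)) by apply Rabs_pos.
  assert (L : Rabs (y - x) * Cmod c <= Rabs (y - x) * (Cmod c + 1)) by nra.
  eapply Rle_trans; [apply H|].
  - eapply Rle_lt_trans; [exact L|]. now apply Rlt_div_r.
  - replace (eps * Rabs (y - x)) with (eps / (Cmod c + 1) * (Rabs (y - x) * (Cmod c + 1))) by (field; lra).
    apply Rmult_le_compat_l; lra.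
Qed.

(** ** Integrals along segments *)

Lemma scal_C_R (k : R) (z : C) : scal (V := C_R_NormedModule) k z = (RtoC k * z)%C.
Proof.
  unfold scal; simpl. unfold prod_scal, scal; simpl. unfold mult; simpl.
  destruct z as [u v]. unfold Cmult, RtoC; simpl. f_equal; ring.
Qed.

Definition CInt (f : R -> C) (a b : R) : C := RInt (V := C_R_CompleteNormedModule) f a b.

Definition ex_CInt (f : R -> C) (a b : R) : Prop := ex_RInt (V := C_R_NormedModule) f a b.

(** The module has real scalars only, so a complex factor is pulled out componentwise: both
    components of the product are real combinations of the component integrals. *)
Lemma is_RInt_Cmult (f : R -> C) (c : C) (a b : R) (l : C) :
  is_RInt (V := C_R_NormedModule) f a b l ->
  is_RInt (V := C_R_NormedModule) (fun x => (c * f x)%C) a b (c * l)%C.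
Proof.
  intros H.
  assert (H1 := is_RInt_fct_extend_fst (U := R_NormedModule) (V := R_NormedModule) f a b l H).
  assert (H2 := is_RInt_fct_extend_snd (U := R_NormedModule) (V := R_NormedModule) f a b l H).
  apply (is_RInt_fct_extend_pair (U := R_NormedModule) (V := R_NormedModule)).
  - apply (is_RInt_minus (V := R_NormedModule));
      apply (is_RInt_scal (V := R_NormedModule)); assumption.
  - apply (is_RInt_plus (V := R_NormedModule));
      apply (is_RInt_scal (V := R_NormedModule)); assumption.
Qed.

Lemma CInt_norm_le (f : R -> C) (a b M : R) : a <= b -> ex_CInt f a b ->
  (forall x, a <= x <= b -> Cmod (f x) <= M) -> Cmod (CInt f a b) <= M * (b - a).
Proof.
  intros Hab Hf HM. rewrite <- norm_C_R, Rmult_comm.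
  apply (norm_RInt_le_const (V := C_R_NormedModule) f a b).
  - exact Hab.
  - intros x Hx. rewrite norm_C_R. auto.
  - apply (RInt_correct (V := C_R_CompleteNormedModule)). exact Hf.
Qed.

Lemma R_diff_cont (f : R -> C) (x : R) (l : C) :
  R_diff f x l ->
  continuous (U := C_R_NormedModule) f x.
Proof.
  intros H. apply (ex_derive_continuous (K := R_AbsRing) (V := C_R_NormedModule)).
  now exists l.
Qed.

Definition hol_at (f : C -> C) (z : C) : Prop := exists l, C_diff f z l.

Lemma ex_CInt_affine (f : C -> C) (p c : C) (a b : R) : a <= b ->
  (forall x, a <= x <= b -> hol_at f (p + x * c)%C) ->
  ex_CInt (fun x => f (p + x * c)%C) a b.
Proof.
  intros Hab H. apply (ex_RInt_continuous (V := C_R_CompleteNormedModule)).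
  intros x Hx. rewrite Rmin_left, Rmax_right in Hx by exact Hab.
  destruct (H x Hx) as [l Hl].
  apply R_diff_cont with (l * c)%C. now apply R_diff_comp_affine.
Qed.

Definition seg (f : C -> C) (a b : C) : C :=
  CInt (fun x => ((b - a) * f (a + x * (b - a)))%C) 0 1.

Definition hol_seg (f : C -> C) (a b : C) : Prop :=
  forall x : R, 0 <= x <= 1 -> hol_at f (a + x * (b - a))%C.

Lemma hol_at_mult f g z : hol_at f z -> hol_at g z -> hol_at (fun s => (f s * g s)%C) z.
Proof. intros [l H] [m H']. eexists. apply C_diff_mult; eassumption. Qed.

Lemma hol_at_plus f g z : hol_at f z -> hol_at g z -> hol_at (fun s => (f s + g s)%C) z.
Proof. intros [l H] [m H']. eexists. apply C_diff_plus; eassumption. Qed.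

Lemma hol_at_minus f g z : hol_at f z -> hol_at g z -> hol_at (fun s => (f s - g s)%C) z.
Proof. intros [l H] [m H']. eexists. apply C_diff_minus; eassumption. Qed.

Lemma hol_at_const c z : hol_at (fun _ => c) z.
Proof. eexists. apply C_diff_const. Qed.

Lemma hol_at_id z : hol_at (fun s => s) z.
Proof. eexists. apply C_diff_id. Qed.

Lemma hol_at_comp f g z : hol_at f (g z) -> hol_at g z -> hol_at (fun s => f (g s)) z.
Proof. intros [l H] [m H']. eexists. apply (C_diff_comp f g); eassumption. Qed.

Lemma hol_at_pow f n z : hol_at f z -> hol_at (fun s => (f s ^ n)%C) z.
Proof. intros [l H]. eexists. apply C_diff_pow; eassumption. Qed.

Lemma hol_at_inv f z : hol_at f z -> f z <> RtoC 0 -> hol_at (fun s => (/ f s)%C) z.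
Proof.
  intros [l H] Hz. eexists. apply (C_diff_comp Cinv f). { now apply C_diff_inv. } exact H.
Qed.

Lemma seg_is_RInt (f : C -> C) (a b : C) : hol_seg f a b ->
  is_RInt (V := C_R_NormedModule) (fun x => ((b - a) * f (a + x * (b - a)))%C) 0 1 (seg f a b).
Proof.
  intros H. apply (RInt_correct (V := C_R_CompleteNormedModule)).
  apply (ex_CInt_affine (fun s => ((b - a) * f s)%C)). { lra. }
  intros x Hx. apply hol_at_mult. { apply hol_at_const. } auto.
Qed.

Lemma seg_unique (f : C -> C) (a b l : C) :
  is_RInt (V := C_R_NormedModule) (fun x => ((b - a) * f (a + x * (b - a)))%C) 0 1 l ->
  seg f a b = l.
Proof. apply (is_RInt_unique (V := C_R_CompleteNormedModule)). Qed.

Lemma seg_plus (f g : C -> C) (a b : C) : hol_seg f a b -> hol_seg g a b ->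
  seg (fun s => (f s + g s)%C) a b = (seg f a b + seg g a b)%C.
Proof.
  intros Hf Hg. apply seg_unique.
  apply (is_RInt_ext (V := C_R_NormedModule)
    (fun x => plus ((b - a) * f (a + x * (b - a)))%C ((b - a) * g (a + x * (b - a)))%C)).
  { intros x _. assert (E : ((b - a) * f (a + x * (b - a)) + (b - a) * g (a + x * (b - a)))%C =
      ((b - a) * (f (a + x * (b - a)) + g (a + x * (b - a))))%C) by ring. exact E. }
  apply (is_RInt_plus (V := C_R_NormedModule)); now apply seg_is_RInt.
Qed.

Lemma seg_scal (f : C -> C) (c a b : C) : hol_seg f a b ->
  seg (fun s => (c * f s)%C) a b = (c * seg f a b)%C.
Proof.
  intros Hf. apply seg_unique.
  apply (is_RInt_ext (V := C_R_NormedModule)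
    (fun x => (c * ((b - a) * f (a + x * (b - a))))%C)).
  { intros x _. assert (E : (c * ((b - a) * f (a + x * (b - a))))%C =
      ((b - a) * (c * f (a + x * (b - a))))%C) by ring. exact E. }
  apply is_RInt_Cmult. now apply seg_is_RInt.
Qed.

Lemma seg_ext (f g : C -> C) (a b : C) :
  (forall x : R, 0 <= x <= 1 -> f (a + x * (b - a))%C = g (a + x * (b - a))%C) ->
  seg f a b = seg g a b.
Proof.
  intros E. apply (RInt_ext (V := C_R_CompleteNormedModule)). intros x Hx.
  rewrite Rmin_left, Rmax_right in Hx by lra. now rewrite E by lra.
Qed.

Lemma hol_seg_const_mult (f : C -> C) (c a b : C) : hol_seg f a b -> hol_seg (fun s => (c * f s)%C) a b.
Proof. intros H x Hx. apply hol_at_mult; [apply hol_at_const|auto]. Qed.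

Lemma seg_minus (f g : C -> C) (a b : C) : hol_seg f a b -> hol_seg g a b ->
  seg (fun s => (f s - g s)%C) a b = (seg f a b - seg g a b)%C.
Proof.
  intros Hf Hg.
  rewrite (seg_ext _ (fun s => (f s + (- (1)) * g s)%C)) by (intros; ring).
  rewrite seg_plus; trivial. 2: now apply hol_seg_const_mult.
  rewrite seg_scal by trivial. ring.
Qed.

Lemma seg_norm_le (f : C -> C) (a b : C) (M : R) : hol_seg f a b ->
  (forall x : R, 0 <= x <= 1 -> Cmod (f (a + x * (b - a))%C) <= M) ->
  Cmod (seg f a b) <= M * Cmod (b - a).
Proof.
  intros Hf HM. replace (M * Cmod (b - a)) with (Cmod (b - a) * M * (1 - 0)) by ring.
  apply CInt_norm_le.
  - lra.
  - eexists. now apply seg_is_RInt.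
  - intros x Hx. rewrite Cmod_mult. apply Rmult_le_compat_l; [apply Cmod_ge_0|auto].
Qed.

Lemma seg_FTC (F f : C -> C) (a b : C) :
  (forall x : R, 0 <= x <= 1 -> C_diff F (a + x * (b - a))%C (f (a + x * (b - a))%C)) ->
  hol_seg f a b -> seg f a b = (F b - F a)%C.
Proof.
  intros HF Hf. apply seg_unique.
  replace (F b - F a)%C with (minus (G := C_R_NormedModule)
    ((fun x : R => F (a + x * (b - a))%C) 1) ((fun x : R => F (a + x * (b - a))%C) 0)).
  2:{ change ((F (a + 1 * (b - a)) - F (a + 0 * (b - a)))%C = (F b - F a)%C).
      f_equal; [|f_equal]; f_equal; ring. }
  apply (is_RInt_derive (V := C_R_CompleteNormedModule) (fun x : R => F (a + x * (b - a))%C));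
    intros x Hx; rewrite Rmin_left, Rmax_right in Hx by lra.
  - apply R_diff_eq with (f (a + x * (b - a)) * (b - a))%C. { ring. }
    apply R_diff_comp_affine. auto.
  - destruct (hol_seg_const_mult f (b - a)%C a b Hf x Hx) as [l Hl].
    apply R_diff_cont with (l * (b - a))%C.
    now apply (R_diff_comp_affine (fun s => ((b - a) * f s)%C)).
Qed.

(** The parameters may come in either order: s = 1, t = 0 yields the reversal of a segment, and
    adjacent intervals yield its subdivision. *)
Lemma seg_sub (f : C -> C) (a b : C) (s t : R) : 0 <= s <= 1 -> 0 <= t <= 1 ->
  hol_seg f a b ->
  seg f (a + s * (b - a)) (a + t * (b - a)) =
  CInt (fun x => ((b - a) * f (a + x * (b - a)))%C) s t.
Proof.
  intros Hs Ht Hf. apply seg_unique.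
  apply (is_RInt_ext (V := C_R_NormedModule)
    (fun y => scal (t - s) ((b - a) * f (a + ((t - s) * y + s)%R * (b - a)))%C)).
  { intros x _. rewrite scal_C_R.
    replace (a + t * (b - a) - (a + s * (b - a)))%C with ((t - s)%R * (b - a))%C
      by (rewrite RtoC_minus; ring).
    replace (a + s * (b - a) + x * ((t - s)%R * (b - a)))%C
      with (a + ((t - s) * x + s)%R * (b - a))%C
      by (rewrite RtoC_plus, RtoC_mult, RtoC_minus; ring).
    assert (E : forall u v w : C, (u * (v * w) = u * v * w)%C) by (intros; ring). apply E. }
  apply (is_RInt_comp_lin (V := C_R_NormedModule)
    (fun x => ((b - a) * f (a + x * (b - a)))%C) (t - s) s 0 1).
  replace ((t - s) * 0 + s) with s by ring. replace ((t - s) * 1 + s) with t by ring.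
  apply (RInt_correct (V := C_R_CompleteNormedModule)).
  apply (ex_RInt_continuous (V := C_R_CompleteNormedModule)). intros x Hx.
  assert (H01 : 0 <= x <= 1).
  { destruct Hx as [H1 H2]. split.
    - eapply Rle_trans; [|exact H1]. apply Rmin_glb; lra.
    - eapply Rle_trans; [exact H2|]. apply Rmax_lub; lra. }
  destruct (hol_seg_const_mult f (b - a)%C a b Hf x H01) as [l Hl].
  apply R_diff_cont with (l * (b - a))%C.
  now apply (R_diff_comp_affine (fun s => ((b - a) * f s)%C)).
Qed.

Lemma seg_swap (f : C -> C) (a b : C) : hol_seg f a b -> seg f b a = (- seg f a b)%C.
Proof.
  intros Hf. generalize (seg_sub f a b 1 0 ltac:(lra) ltac:(lra) Hf).
  replace (a + 1 * (b - a))%C with b by ring. replace (a + 0 * (b - a))%C with a by ring.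
  intros ->. symmetry.
  apply (opp_RInt_swap (V := C_R_CompleteNormedModule)).
  eexists. now apply seg_is_RInt.
Qed.

Lemma seg_split (f : C -> C) (a b : C) (s : R) : 0 <= s <= 1 -> hol_seg f a b ->
  seg f a b = (seg f a (a + s * (b - a)) + seg f (a + s * (b - a)) b)%C.
Proof.
  intros Hs Hf. generalize (seg_sub f a b 0 s ltac:(lra) Hs Hf), (seg_sub f a b s 1 Hs ltac:(lra) Hf).
  replace (a + 1 * (b - a))%C with b by ring. replace (a + 0 * (b - a))%C with a by ring.
  intros -> ->. symmetry.
  assert (E : ex_RInt (V := C_R_NormedModule) (fun x => ((b - a) * f (a + x * (b - a)))%C) 0 1).
  { eexists. now apply seg_is_RInt. }
  apply (RInt_Chasles (V := C_R_CompleteNormedModule)).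
  - apply (ex_RInt_Chasles_1 (V := C_R_CompleteNormedModule)) with 1; auto.
  - apply (ex_RInt_Chasles_2 (V := C_R_CompleteNormedModule)) with 0; auto.
Qed.

(** ** The complex exponential *)

Lemma cis_plus (x y : R) : cis (x + y) = (cis x * cis y)%C.
Proof. unfold cis, Cmult; simpl. rewrite cos_plus, sin_plus. f_equal; ring. Qed.

Lemma Cmod_cis (x : R) : Cmod (cis x) = 1.
Proof.
  unfold Cmod, cis; simpl. replace (cos x * (cos x * 1) + sin x * (sin x * 1)) with 1.
  { apply sqrt_1. } generalize (sin2_cos2 x). unfold Rsqr. lra.
Qed.

Lemma cis_0 : cis 0 = RtoC 1.
Proof. unfold cis. now rewrite cos_0, sin_0. Qed.

Lemma Cexp_plus (z w : C) : Cexp (z + w) = (Cexp z * Cexp w)%C.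
Proof.
  unfold Cexp. destruct z as [a b], w as [c d]; unfold Re, Im; simpl.
  rewrite exp_plus, cis_plus, RtoC_mult. ring.
Qed.

Lemma Cexp_0 : Cexp 0 = RtoC 1.
Proof. unfold Cexp, Re, Im; simpl. rewrite exp_0, cis_0. ring. Qed.

Lemma Cmod_Cexp (z : C) : Cmod (Cexp z) = exp (Re z).
Proof.
  unfold Cexp. rewrite Cmod_mult, Cmod_cis, Cmod_R, Rabs_pos_eq. { ring. }
  left. apply exp_pos.
Qed.

Lemma derivable_pt_lim_eps (f : R -> R) (x l : R) : derivable_pt_lim f x l ->
  forall eps, 0 < eps -> exists d, 0 < d /\ forall h, Rabs h < d ->
    Rabs (f (x + h) - f x - l * h) <= eps * Rabs h.
Proof.
  intros H eps He. destruct (H eps He) as [d Hd]. exists d; split; [apply cond_pos|].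
  intros h Hh. destruct (Req_dec h 0) as [->|Hn].
  - rewrite Rplus_0_r. replace (f x - f x - l * 0) with 0 by ring. rewrite Rabs_R0. lra.
  - specialize (Hd h Hn Hh).
    replace (f (x + h) - f x - l * h) with (((f (x + h) - f x) / h - l) * h) by (field; auto).
    rewrite Rabs_mult. apply Rmult_le_compat_r; [apply Rabs_pos|lra].
Qed.

Lemma Cmod_le_components (z : C) : Cmod z <= Rabs (Re z) + Rabs (Im z).
Proof.
  replace z with (RtoC (Re z) + Ci * RtoC (Im z))%C at 1.
  - eapply Rle_trans; [apply Cmod_triangle|]. rewrite Cmod_mult, Cmod_Ci, !Cmod_R. lra.
  - destruct z; unfold Re, Im, RtoC, Ci, Cplus, Cmult; simpl. f_equal; ring.
Qed.

Lemma im_le_Cmod (z : C) : Rabs (Im z) <= Cmod z.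
Proof.
  eapply Rle_trans; [apply Rmax_r|apply (Rmax_Cmod z)].
Qed.

Lemma C_diff_Cexp_0 : C_diff Cexp 0%C 1%C.
Proof.
  apply C_diff_eps. intros eps He.
  assert (He1 : 0 < eps / 6) by lra.
  destruct (derivable_pt_lim_eps exp 0 1 derivable_pt_lim_exp_0 _ He1) as [d1 [Hd1 H1]].
  assert (Dc := derivable_pt_lim_cos 0). rewrite sin_0, Ropp_0 in Dc.
  assert (Ds := derivable_pt_lim_sin 0). rewrite cos_0 in Ds.
  destruct (derivable_pt_lim_eps _ _ _ Dc _ He1) as [d2 [Hd2 H2]].
  destruct (derivable_pt_lim_eps _ _ _ Ds _ He1) as [d3 [Hd3 H3]].
  exists (Rmin (Rmin d1 d2) (Rmin d3 (Rmin 1 (eps / 6)))). split.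
  { repeat apply Rmin_pos; lra. }
  intros y Hy. replace (y - 0)%C with y in * by ring.
  apply Rmin_Rgt in Hy. destruct Hy as [Ha Hb].
  apply Rmin_Rgt in Ha. destruct Ha as [Y1 Y2].
  apply Rmin_Rgt in Hb. destruct Hb as [Y3 Hc].
  apply Rmin_Rgt in Hc. destruct Hc as [Y4 Y5].
  assert (Lr := re_le_Cmod y). assert (Li := im_le_Cmod y).
  assert (N0 := Cmod_ge_0 y). set (N := Cmod y) in *.
  specialize (H1 (Re y) ltac:(lra)). specialize (H2 (Im y) ltac:(lra)). specialize (H3 (Im y) ltac:(lra)).
  rewrite Rplus_0_l in *. rewrite exp_0 in H1. rewrite cos_0 in H2. rewrite sin_0 in H3.
  rewrite Cexp_0.
  set (a := exp (Re y) - 1 - 1 * Re y) in *.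
  set (b := cos (Im y) - 1 - 0 * Im y) in *.
  set (c := sin (Im y) - 0 - 1 * Im y) in *.
  (* With y = u + iv, the pair (b, c + v) is cis v - 1 and (b, c) is cis v - 1 - iv. The first and
     last terms are small by the real derivatives; the middle one, u (cis v - 1), is of second
     order. *)
  assert (E : (Cexp y - 1 - 1 * y)%C = (RtoC a * cis (Im y) + RtoC (Re y) * (b, (c + Im y)%R) + (b, c))%C).
  { unfold Cexp, cis, a, b, c. destruct y as [u v]; unfold Re, Im, RtoC, Cminus, Copp, Cplus, Cmult; simpl.
    f_equal; ring. }
  rewrite E. clear E.
  eapply Rle_trans; [apply Cmod_triangle|].
  eapply Rle_trans; [apply Rplus_le_compat_r, Cmod_triangle|].
  rewrite !Cmod_mult, Cmod_cis, !Cmod_R.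
  assert (A1 := Cmod_le_components (b, c)). simpl in A1.
  assert (A2 := Cmod_le_components (b, (c + Im y)%R)). simpl in A2.
  assert (A3 : Rabs (c + Im y) <= Rabs c + Rabs (Im y)) by apply Rabs_triang.
  assert (B0 := Rabs_pos a). assert (B1 := Rabs_pos b). assert (B2 := Rabs_pos c).
  assert (B3 := Rabs_pos (Re y)). assert (B4 := Rabs_pos (Im y)).
  assert (C1 : Rabs a <= eps / 6 * N) by (eapply Rle_trans; [exact H1|apply Rmult_le_compat_l; lra]).
  assert (C2 : Rabs b <= eps / 6 * N) by (eapply Rle_trans; [exact H2|apply Rmult_le_compat_l; lra]).
  assert (C3 : Rabs c <= eps / 6 * N) by (eapply Rle_trans; [exact H3|apply Rmult_le_compat_l; lra]).
  assert (D1 : Rabs (Re y) * Cmod (b, (c + Im y)%R) <= Rabs (Re y) * (Rabs b + Rabs c + Rabs (Im y))).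
  { apply Rmult_le_compat_l; lra. }
  assert (D2 : Rabs (Re y) * (Rabs b + Rabs c + Rabs (Im y)) <= 1 * (Rabs b + Rabs c) + Rabs (Re y) * Rabs (Im y)).
  { assert (Rabs (Re y) * (Rabs b + Rabs c) <= 1 * (Rabs b + Rabs c)) by (apply Rmult_le_compat_r; lra). lra. }
  assert (D3 : Rabs (Re y) * Rabs (Im y) <= N * (eps / 6) - 0) by (rewrite Rminus_0_r; apply Rmult_le_compat; lra).
  unfold Re, Im in *.
  assert (0 <= eps / 6 * N) by (apply Rmult_le_pos; lra).
  nra.
Qed.

Lemma C_diff_Cexp (z : C) : C_diff Cexp z (Cexp z).
Proof.
  apply (C_diff_ext_loc (fun s => (Cexp z * Cexp (s - z))%C) _ _ _ 1 Rlt_0_1).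
  { intros y _. rewrite <- Cexp_plus. f_equal. ring. }
  replace (Cexp z) with (Cexp z * (1 * (1 - 0)))%C at 1 by ring.
  apply C_diff_scal. apply (C_diff_comp Cexp (fun s => (s - z)%C)).
  - replace (z - z)%C with (RtoC 0) by ring. apply C_diff_Cexp_0.
  - apply C_diff_minus; [apply C_diff_id|apply C_diff_const].
Qed.

(** ** Series with geometric bounds *)

Lemma is_series_eps (c : nat -> C) (S : C) :
  Cseries c S <->
  forall eps, 0 < eps -> exists N, forall n, (N <= n)%nat -> Cmod (Csum c n - S) < eps.
Proof.
  unfold is_series. split.
  - intros H eps He.
    destruct (proj1 (filterlim_locally_ball_norm (U := C_NormedModule) _ S) H (mkposreal _ He)) as [N HN].
    exists N. exact HN.
  - intros H. apply (filterlim_locally_ball_norm (U := C_NormedModule)).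
    intros eps. destruct (H eps (cond_pos eps)) as [N HN]. exists N. exact HN.
Qed.

Lemma Csum_S (c : nat -> C) (n : nat) :
  @eq C (Csum c (S n)) (Csum c n + c (S n))%C.
Proof. exact (sum_Sn c n). Qed.

Lemma Csum_O (c : nat -> C) : @eq C (Csum c 0) (c 0%nat).
Proof. exact (sum_O c). Qed.

(** Series are compared with M / 2^(n+1), whose tail after the term n is again M / 2^(n+1): terms
    and remainders carry the same bound. The factor [1 - / 2 ^ k] is what makes the induction
    close. *)
Lemma geom_partial (c : nat -> C) (M : R) (n k : nat) :
  (forall n, Cmod (c n) <= M / 2 ^ S n) ->
  Cmod (Csum c (n + k) - Csum c n) <= M / 2 ^ S n * (1 - / 2 ^ k).
Proof.
  intros H. induction k as [|k IH].
  - rewrite Nat.add_0_r. replace (_ - _)%C with (RtoC 0) by ring. rewrite Cmod_0. simpl. lra.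
  - rewrite Nat.add_succ_r, Csum_S.
    replace (_ + _ - _)%C with ((Csum c (n + k) - Csum c n) + c (S (n + k)))%C by ring.
    eapply Rle_trans; [apply Cmod_triangle|].
    assert (H1 := H (S (n + k))).
    assert (P : forall m, 2 ^ m <> 0) by (intro m; apply pow_nonzero; lra).
    replace (M / 2 ^ S (S (n + k))) with (M / 2 ^ S n * (/ 2 ^ S k)) in H1.
    + assert (E : / 2 ^ k = 2 * / 2 ^ S k) by (simpl; field; auto).
      rewrite E in IH. lra.
    + simpl. rewrite pow_add. field. auto.
Qed.

Lemma geom_eventually_small (M eps : R) : 0 < eps -> exists N, forall n, (N <= n)%nat -> M / 2 ^ n < eps.
Proof.
  intros He. destruct (Rle_lt_dec M 0) as [HM|HM].
  - exists 0%nat. intros n _. apply Rle_lt_trans with 0; [|exact He].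
    apply Rmult_le_0_r; [exact HM|]. left. apply Rinv_0_lt_compat, pow_lt. lra.
  - assert (Hq : 0 < eps / M) by now apply Rdiv_lt_0_compat.
    destruct (pow_lt_1_zero (/ 2) ltac:(rewrite Rabs_pos_eq; lra) _ Hq) as [N HN].
    exists N. intros n Hn. specialize (HN n Hn).
    rewrite Rabs_pos_eq in HN by (apply pow_le; lra).
    rewrite pow_inv in HN. apply Rmult_lt_compat_l with (r := M) in HN; trivial.
    replace (M * (eps / M)) with eps in HN by (field; lra). exact HN.
Qed.

Lemma geom_series (c : nat -> C) (M : R) :
  (forall n, Cmod (c n) <= M / 2 ^ S n) ->
  exists S, Cseries c S.
Proof.
  intros H.
  apply (ex_series_le (K := C_AbsRing) (V := C_CompleteNormedModule) c (fun n => M / 2 * (/ 2) ^ n)).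
  - intro n. change (Cmod (c n) <= M / 2 * (/ 2) ^ n). eapply Rle_trans; [apply H|].
    rewrite pow_inv. simpl. right. field. apply pow_nonzero. lra.
  - apply (ex_series_scal (K := R_AbsRing) (V := R_NormedModule) (M / 2) (fun n => (/ 2) ^ n)).
    apply ex_series_geom. rewrite Rabs_pos_eq; lra.
Qed.

Lemma geom_tail (c : nat -> C) (M : R) (S0 : C) :
  (forall n, Cmod (c n) <= M / 2 ^ S n) ->
  Cseries c S0 ->
  forall n, Cmod (Csum c n - S0) <= M / 2 ^ S n.
Proof.
  intros H HS n. apply le_epsilon. intros eps He.
  destruct (proj1 (is_series_eps c S0) HS eps He) as [N HN].
  specialize (HN (n + N)%nat ltac:(lia)).
  assert (G := geom_partial c M n N H).
  rewrite Cmod_sub_sym in G.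
  replace (Csum c n - S0)%C with
    ((Csum c n - Csum c (n + N)) + (Csum c (n + N) - S0))%C by ring.
  eapply Rle_trans; [apply Cmod_triangle|].
  assert (0 <= M / 2 ^ S n) by (eapply Rle_trans; [apply Cmod_ge_0|apply H]).
  assert (0 < / 2 ^ N) by (apply Rinv_0_lt_compat, pow_lt; lra).
  nra.
Qed.

(** ** Goursat's theorem *)

Definition tri (f : C -> C) (a b c : C) : C := (seg f a b + seg f b c + seg f c a)%C.

Definition convex (K : C -> Prop) : Prop :=
  forall a b (x : R), K a -> K b -> 0 <= x <= 1 -> K (a + x * (b - a))%C.

(** Closedness serves to keep the common point of the nested triangles in the set, where the
    function is known to be differentiable. *)
Definition closed_set (K : C -> Prop) : Prop :=
  forall z, (forall eps, 0 < eps -> exists w, K w /\ Cmod (w - z) < eps) -> K z.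

Lemma hol_seg_convex K f a b : convex K -> holomorphic_on K f -> K a -> K b -> hol_seg f a b.
Proof. intros HK Hf Ha Hb x Hx. apply Hf. now apply HK. Qed.

Definition mid (a b : C) : C := ((a + b) / 2)%C.

Lemma RtoC_neq_0 (x : R) : x <> 0 -> RtoC x <> RtoC 0.
Proof. intros H E. apply H. now apply RtoC_inj. Qed.

Lemma mid_eq a b : (a + (1 / 2)%R * (b - a))%C = mid a b.
Proof. unfold mid. rewrite RtoC_div by lra. field. Qed.

Lemma convex_mid K a b : convex K -> K a -> K b -> K (mid a b).
Proof. intros HK Ha Hb. rewrite <- mid_eq. apply HK; trivial. lra. Qed.

Lemma seg_mid K f a b : convex K -> holomorphic_on K f -> K a -> K b ->
  seg f a b = (seg f a (mid a b) + seg f (mid a b) b)%C.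
Proof.
  intros HK Hf Ha Hb. rewrite <- mid_eq. apply seg_split. { lra. }
  now apply hol_seg_convex with K.
Qed.

Lemma tri_subdivide K f a b c : convex K -> holomorphic_on K f -> K a -> K b -> K c ->
  tri f a b c = (tri f a (mid a b) (mid c a) + tri f (mid a b) b (mid b c)
    + tri f (mid c a) (mid b c) c + tri f (mid a b) (mid b c) (mid c a))%C.
Proof.
  intros HK Hf Ha Hb Hc. unfold tri.
  rewrite (seg_mid K f a b), (seg_mid K f b c), (seg_mid K f c a) by assumption.
  assert (SW : forall x y, K x -> K y -> seg f y x = (- seg f x y)%C).
  { intros x y Hx Hy. apply seg_swap. now apply hol_seg_convex with K. }
  assert (M1 : K (mid a b)) by now apply convex_mid.
  assert (M2 : K (mid b c)) by now apply convex_mid.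
  assert (M3 : K (mid c a)) by now apply convex_mid.
  rewrite (SW (mid a b) (mid b c)), (SW (mid c a) (mid a b)), (SW (mid b c) (mid c a)) by assumption.
  ring.
Qed.

Lemma holomorphic_affine K (u v : C) : holomorphic_on K (fun s => (u + v * s)%C).
Proof.
  intros z _. apply hol_at_plus; [apply hol_at_const|].
  apply hol_at_mult; [apply hol_at_const|apply hol_at_id].
Qed.

Lemma tri_primitive (F f : C -> C) (a b c : C) :
  (forall x y, is_edge a b c x y ->
     forall t : R, 0 <= t <= 1 ->
     C_diff F (x + t * (y - x))%C (f (x + t * (y - x))%C) /\ hol_at f (x + t * (y - x))%C) ->
  tri f a b c = RtoC 0.
Proof.
  intros H. unfold tri.
  rewrite (seg_FTC F f a b), (seg_FTC F f b c), (seg_FTC F f c a).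
  - ring.
  - intros t Ht. now apply (H c a); auto.
  - intros t Ht. now apply (H c a); auto.
  - intros t Ht. now apply (H b c); auto.
  - intros t Ht. now apply (H b c); auto.
  - intros t Ht. now apply (H a b); auto.
  - intros t Ht. now apply (H a b); auto.
Qed.

Lemma tri_affine (u v a b c : C) : tri (fun s => (u + v * s)%C) a b c = RtoC 0.
Proof.
  apply (tri_primitive (fun s => (u * s + (v / 2) * s ^ 2)%C)).
  intros x y _ t _. set (s := (x + t * (y - x))%C). split.
  - replace (u + v * s)%C with (u * 1 + v / 2 * (RtoC (INR 2) * s ^ (pred 2) * 1))%C.
    + apply C_diff_plus; apply C_diff_scal; [apply C_diff_id|].
      apply (C_diff_pow (fun s => s)). apply C_diff_id.
    + simpl. rewrite RtoC_plus. field.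
  - now apply (holomorphic_affine (fun _ => True)).
Qed.

Definition sides_le (a b c : C) (d : R) : Prop :=
  Cmod (b - a) <= d /\ Cmod (c - b) <= d /\ Cmod (a - c) <= d.

Definition in3 (K : C -> Prop) (T : C * C * C) : Prop :=
  let '(a, b, c) := T in K a /\ K b /\ K c.

Definition tri3 (f : C -> C) (T : C * C * C) : C := let '(a, b, c) := T in tri f a b c.

(** The first vertices of the nested triangles move by at most d / 2^(n+1) at step n, so their limit
    exists as the sum of a geometrically bounded series; it is the point at which the function gets
    linearised. *)
Definition vertex (T : C * C * C) : C := let '(a, _, _) := T in a.

Definition sides3 (T : C * C * C) (d : R) : Prop := let '(a, b, c) := T in sides_le a b c d.

Lemma Cmod_half_diff (d : R) (z w : C) : z = (w / 2)%C -> Cmod w <= d -> Cmod z <= d / 2.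
Proof.
  intros -> H. unfold Cdiv. rewrite Cmod_mult, Cmod_inv by (apply RtoC_neq_0; lra).
  rewrite Cmod_R, Rabs_pos_eq by lra. lra.
Qed.

(** The four integrals of the bisected triangle add up to the whole one, so one of them has at least
    a quarter of its modulus. The displacement of the first vertex is recorded for the later
    limit. *)
Lemma goursat_step K f : convex K -> holomorphic_on K f -> forall T, in3 K T ->
  exists T', in3 K T' /\ Cmod (tri3 f T) <= 4 * Cmod (tri3 f T') /\
    forall d, sides3 T d -> sides3 T' (d / 2) /\ Cmod (vertex T' - vertex T) <= d / 2.
Proof.
  intros HK Hf [[a b] c] (Ha & Hb & Hc).
  assert (M1 : K (mid a b)) by now apply convex_mid.
  assert (M2 : K (mid b c)) by now apply convex_mid.
  assert (M3 : K (mid c a)) by now apply convex_mid.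
  assert (E := tri_subdivide K f a b c HK Hf Ha Hb Hc).
  assert (L : forall T', (T' = (a, mid a b, mid c a) \/ T' = (mid a b, b, mid b c) \/
    T' = (mid c a, mid b c, c) \/ T' = (mid a b, mid b c, mid c a)) ->
    Cmod (tri3 f (a, b, c)) <= 4 * Cmod (tri3 f T') ->
    exists T', in3 K T' /\ Cmod (tri3 f (a, b, c)) <= 4 * Cmod (tri3 f T') /\
    forall d, sides3 (a, b, c) d -> sides3 T' (d / 2) /\ Cmod (vertex T' - vertex (a, b, c)) <= d / 2).
  { intros T' HT' HL. exists T'. split; [|split; [exact HL|]].
    - destruct HT' as [->|[->|[->| ->]]]; simpl; auto.
    - intros d (D1 & D2 & D3).
      assert (D1' : Cmod (a - b) <= d) by now rewrite Cmod_sub_sym.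
      assert (D2' : Cmod (b - c) <= d) by now rewrite Cmod_sub_sym.
      assert (D3' : Cmod (c - a) <= d) by now rewrite Cmod_sub_sym.
      assert (D0 : Cmod 0 <= d) by (rewrite Cmod_0; eapply Rle_trans; [apply Cmod_ge_0|exact D1]).
      (* Every new side and every displacement of the first vertex is half a difference of two old
         vertices, or 0 when that vertex stays. *)
      destruct HT' as [->|[->|[->| ->]]]; simpl; unfold sides_le, mid;
      repeat split;
      first [ apply (Cmod_half_diff d _ (b - a)%C); [field|assumption]
            | apply (Cmod_half_diff d _ (c - b)%C); [field|assumption]
            | apply (Cmod_half_diff d _ (a - c)%C); [field|assumption]
            | apply (Cmod_half_diff d _ (a - b)%C); [field|assumption]
            | apply (Cmod_half_diff d _ (b - c)%C); [field|assumption]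
            | apply (Cmod_half_diff d _ (c - a)%C); [field|assumption]
            | apply (Cmod_half_diff d _ 0%C); [field|assumption] ]. }
  set (t := Cmod (tri3 f (a, b, c))) in *.
  destruct (Rle_lt_dec t (4 * Cmod (tri3 f (a, mid a b, mid c a)))) as [G1|G1]; [now apply (L (a, mid a b, mid c a)); auto|].
  destruct (Rle_lt_dec t (4 * Cmod (tri3 f (mid a b, b, mid b c)))) as [G2|G2]; [now apply (L (mid a b, b, mid b c)); auto|].
  destruct (Rle_lt_dec t (4 * Cmod (tri3 f (mid c a, mid b c, c)))) as [G3|G3]; [now apply (L (mid c a, mid b c, c)); auto|].
  destruct (Rle_lt_dec t (4 * Cmod (tri3 f (mid a b, mid b c, mid c a)))) as [G4|G4]; [now apply (L (mid a b, mid b c, mid c a)); auto|].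
  exfalso.
  assert (t <= Cmod (tri f a (mid a b) (mid c a)) + Cmod (tri f (mid a b) b (mid b c))
    + Cmod (tri f (mid c a) (mid b c) c) + Cmod (tri f (mid a b) (mid b c) (mid c a))).
  { unfold t, tri3. rewrite E. eapply Rle_trans; [apply Cmod_triangle|].
    apply Rplus_le_compat_r. eapply Rle_trans; [apply Cmod_triangle|].
    apply Rplus_le_compat_r. apply Cmod_triangle. }
  unfold tri3 in *. lra.
Qed.

Lemma tri_norm_le f a b c M d : 0 <= M -> sides_le a b c d ->
  (forall x y, is_edge a b c x y ->
     hol_seg f x y /\ forall t : R, 0 <= t <= 1 -> Cmod (f (x + t * (y - x))%C) <= M) ->
  Cmod (tri f a b c) <= 3 * M * d.
Proof.
  intros HM (D1 & D2 & D3) H. unfold tri.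
  eapply Rle_trans; [apply Cmod_triangle|].
  eapply Rle_trans; [apply Rplus_le_compat_r, Cmod_triangle|].
  assert (L : forall x y, is_edge a b c x y ->
     Cmod (y - x) <= d -> Cmod (seg f x y) <= M * d).
  { intros x y Hxy Hd. destruct (H x y Hxy) as [H1 H2].
    eapply Rle_trans; [apply (seg_norm_le f x y M H1 H2)|]. now apply Rmult_le_compat_l. }
  assert (L1 := L a b ltac:(auto) D1). assert (L2 := L b c ltac:(auto) D2).
  assert (L3 := L c a ltac:(auto) D3). lra.
Qed.

Theorem goursat K f a b c : convex K -> closed_set K -> holomorphic_on K f ->
  K a -> K b -> K c -> tri f a b c = RtoC 0.
Proof.
  intros HK Hcl Hf Ha Hb Hc.
  (* The sequence of triangles is obtained by choice on triples bundled with their membership in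
     [K], so that a step can be iterated. *)
  set (step := fun T : {T | in3 K T} =>
    constructive_indefinite_description _ (goursat_step K f HK Hf (proj1_sig T) (proj2_sig T))).
  set (nxt := fun T : {T | in3 K T} =>
    exist (in3 K) (proj1_sig (step T)) (proj1 (proj2_sig (step T)))).
  set (T0 := exist (in3 K) (a, b, c) (conj Ha (conj Hb Hc))).
  set (Tn := fun n => Nat.iter n nxt T0).
  set (d := Cmod (b - a) + Cmod (c - b) + Cmod (a - c)).
  assert (P1 := Cmod_ge_0 (b - a)). assert (P2 := Cmod_ge_0 (c - b)). assert (P3 := Cmod_ge_0 (a - c)).
  assert (HS : forall n, sides3 (proj1_sig (Tn n)) (d / 2 ^ n)).
  { induction n as [|n IH].
    - simpl. unfold sides_le. unfold d. lra.
    - destruct (proj2 (proj2 (proj2_sig (step (Tn n)))) _ IH) as [H _].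
      replace (d / 2 ^ S n) with (d / 2 ^ n / 2). exact H.
      simpl. field. apply pow_nonzero. lra. }
  assert (HT : forall n, Cmod (tri f a b c) <= 4 ^ n * Cmod (tri3 f (proj1_sig (Tn n)))).
  { induction n as [|n IH].
    - simpl. lra.
    - assert (H := proj1 (proj2 (proj2_sig (step (Tn n))))).
      eapply Rle_trans; [exact IH|].
      replace (4 ^ S n) with (4 ^ n * 4) by (simpl; ring). rewrite Rmult_assoc.
      apply Rmult_le_compat_l; [apply pow_le; lra|]. exact H. }
  set (v := fun n => vertex (proj1_sig (Tn n))).
  set (w := fun n => (v (S n) - v n)%C).
  assert (HV : forall n, Cmod (w n) <= d / 2 ^ S n).
  { intro n. destruct (proj2 (proj2 (proj2_sig (step (Tn n)))) _ (HS n)) as [_ H].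
    replace (d / 2 ^ S n) with (d / 2 ^ n / 2). exact H.
    simpl. field. apply pow_nonzero. lra. }
  destruct (geom_series w d HV) as [S0 HS0].
  assert (HW := geom_tail w d S0 HV HS0).
  set (p := (v 0%nat + S0)%C).
  assert (SV : forall n, @eq C (Csum w n) (v (S n) - v 0%nat)%C).
  { induction n as [|n IH].
    - now rewrite Csum_O.
    - rewrite Csum_S, IH. unfold w. ring. }
  assert (Hp : forall n, Cmod (v (S n) - p) <= d / 2 ^ S n).
  { intro n. replace (v (S n) - p)%C with (Csum w n - S0)%C by (rewrite SV; unfold p; ring).
    apply HW. }
  assert (Kp : K p).
  { apply Hcl. intros eps He. destruct (geom_eventually_small d eps He) as [N HN].
    exists (v (S N)). split.
    - unfold v. destruct (Tn (S N)) as [[[x y] z] [Hx Hyz]]. exact Hx.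
    - eapply Rle_lt_trans; [apply Hp|]. apply HN. lia. }
  destruct (Hf p Kp) as [l Hl].
  apply Cmod_eq_0. apply Rle_antisym; [|apply Cmod_ge_0].
  apply le_epsilon. intros eps He. rewrite Rplus_0_l.
  (* The 9 is 3 sides times the distance 3 d/2^n from [p] within which the triangle lies; the +1
     keeps the denominator positive when the triangle is a point. *)
  set (e := eps / (9 * (d * d + 1))).
  assert (Hd : 0 <= d) by (unfold d; lra).
  assert (He' : 0 < e) by (apply Rdiv_lt_0_compat; [exact He|nra]).
  destruct (proj1 (C_diff_eps f p l) Hl e He') as [r [Hr Hlin]].
  destruct (geom_eventually_small (3 * d) r Hr) as [N HN].
  specialize (HN (S N) ltac:(lia)). generalize (Hp N), (HS (S N)), (HT (S N)).
  clear Hp HS HT. intros Hp HS HT. unfold v in Hp. destruct (Tn (S N)) as [[[x y] z] (Kx & Ky & Kz)]. simpl proj1_sig in *.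
  unfold vertex in Hp. unfold sides3 in HS. unfold tri3 in HT.
  set (dn := d / 2 ^ S N) in *.
  assert (Hdn : 0 <= dn) by (eapply Rle_trans; [apply Cmod_ge_0|exact Hp]).
  replace (3 * d / 2 ^ S N) with (3 * dn) in HN by (unfold dn; field; apply pow_nonzero; lra).
  (* The first-order expansion at [p] is affine, hence has integral 0 and may be subtracted. What is
     left is of size e times the distance to [p], and the factor 4^n cancels against the square of
     d/2^n. *)
  set (A := fun s => ((f p - l * p) + l * s)%C).
  assert (HA : holomorphic_on K A) by apply holomorphic_affine.
  assert (E : tri f x y z = tri (fun s => (f s - A s)%C) x y z).
  { unfold tri. rewrite !seg_minus by (apply (hol_seg_convex K); assumption).
    assert (E := tri_affine (f p - l * p) l x y z). fold A in E. unfold tri in E.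
    replace (seg f x y + seg f y z + seg f z x)%C with (seg f x y + seg f y z + seg f z x - 0)%C by ring.
    rewrite <- E. ring. }
  rewrite E in HT.
  assert (B : Cmod (tri (fun s => (f s - A s)%C) x y z) <= 3 * (e * (3 * dn)) * dn).
  { apply tri_norm_le; [apply Rmult_le_pos; lra|exact HS|].
    intros s t Hst.
    assert (Hs : K s /\ Cmod (s - x) <= dn /\ K t /\ Cmod (t - s) <= dn).
    { destruct HS as (S1 & S2 & S3).
      assert (Z : Cmod (x - x) <= dn) by (replace (x - x)%C with (RtoC 0) by ring; now rewrite Cmod_0).
      destruct Hst as [[-> ->]|[[-> ->]|[-> ->]]]; repeat split; trivial.
      now rewrite Cmod_sub_sym. }
    destruct Hs as (Ks & Hs & Kt & Hts). split.
    - apply (hol_seg_convex K _ s t HK); [|assumption|assumption].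
      intros y1 Hy1. apply hol_at_minus; [now apply Hf|now apply HA].
    - intros q1 Hq1. set (m := (s + q1 * (t - s))%C).
      assert (Hm : Cmod (m - p) <= 3 * dn).
      { replace (m - p)%C with (q1 * (t - s) + (s - x) + (x - p))%C by (unfold m; ring).
        eapply Rle_trans; [apply Cmod_triangle|].
        eapply Rle_trans; [apply Rplus_le_compat_r, Cmod_triangle|].
        rewrite Cmod_mult, Cmod_R, Rabs_pos_eq by lra.
        assert (q1 * Cmod (t - s) <= 1 * dn) by (apply Rmult_le_compat; try apply Cmod_ge_0; lra). lra. }
      unfold A. replace (f m - (f p - l * p + l * m))%C with (f m - f p - l * (m - p))%C by ring.
      eapply Rle_trans; [apply Hlin; lra|]. apply Rmult_le_compat_l; lra. }
  eapply Rle_trans; [exact HT|].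
  apply Rle_trans with (4 ^ S N * (3 * (e * (3 * dn)) * dn)).
  { apply Rmult_le_compat_l; [apply pow_le; lra|exact B]. }
  replace (4 ^ S N * (3 * (e * (3 * dn)) * dn)) with (9 * e * (d * d)).
  - unfold e. apply Rle_trans with (9 * (eps / (9 * (d * d + 1))) * (d * d + 1)).
    + apply Rmult_le_compat_l; [|lra]. fold e. lra.
    + right. field. nra.
  - unfold dn. replace 4 with (2 * 2) by ring. rewrite Rpow_mult_distr. field. apply pow_nonzero. lra.
Qed.

(** ** Winding number of a triangle *)

Lemma Im_neq_0 (z : C) : Im z <> 0 -> z <> RtoC 0.
Proof. intros H E. apply H. now rewrite E. Qed.

Lemma sqrt_Rsqr_div (x v : R) : 0 < v -> 0 <= x -> sqrt (x / v ^ 2) = sqrt x / v.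
Proof.
  intros Hv Hx. rewrite sqrt_div; [|exact Hx|apply pow_lt; exact Hv].
  now rewrite sqrt_pow2 by lra.
Qed.

(* With q = (u, v) the integrand q / (1 + x q) has imaginary part
   v / |1 + x q|^2, the derivative of atan ((x |q|^2 + u) / v); [al] is the
   increment of that primitive from x = 0 to x = 1. *)
Lemma polar_atan (u v : R) : 0 < v ->
  let n := u ^ 2 + v ^ 2 in
  let al := atan ((n + u) / v) - atan (u / v) in
  0 < al < PI /\ ((1 + u)%R, v) = (RtoC (Cmod ((1 + u)%R, v)) * cis al)%C.
Proof.
  intros Hv n al.
  assert (Hn : 0 < n) by (unfold n; generalize (pow2_ge_0 u), (pow2_gt_0 v ltac:(lra)); lra).
  assert (Hlt : u / v < (n + u) / v).
  { unfold Rdiv. apply Rmult_lt_compat_r; [now apply Rinv_0_lt_compat|lra]. }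
  split.
  - unfold al. generalize (atan_increasing _ _ Hlt) (atan_bound (u / v)) (atan_bound ((n + u) / v)). lra.
  - set (m := (1 + u) ^ 2 + v ^ 2). assert (Hm : 0 < m).
    { assert (0 < v ^ 2) by now apply pow_lt. assert (0 <= (1 + u) ^ 2) by apply pow2_ge_0. unfold m. lra. }
    assert (E1 : 1 + Rsqr (u / v) = n / v ^ 2) by (unfold Rsqr, n; field; lra).
    assert (E2 : 1 + Rsqr ((n + u) / v) = n * m / v ^ 2) by (unfold Rsqr, n, m; field; lra).
    assert (S1 : sqrt (1 + Rsqr (u / v)) = sqrt n / v) by (rewrite E1; apply sqrt_Rsqr_div; lra).
    assert (S2 : sqrt (1 + Rsqr ((n + u) / v)) = sqrt n * sqrt m / v).
    { rewrite E2, sqrt_Rsqr_div by nra. now rewrite sqrt_mult by lra. }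
    assert (Q1 := sqrt_lt_R0 n Hn). assert (Q2 := sqrt_lt_R0 m Hm).
    assert (Q3 := sqrt_sqrt n ltac:(lra)).
    assert (Cm : Cmod ((1 + u)%R, v) = sqrt m) by reflexivity.
    rewrite Cm. unfold cis, RtoC, Cmult, al; simpl.
    rewrite cos_minus, sin_minus, !cos_atan, !sin_atan, S1, S2.
    f_equal.
    + apply Rmult_eq_reg_l with (sqrt n * sqrt n); [|nra]. rewrite Q3 at 1.
      field_simplify; [|lra]. unfold n. field; lra.
    + apply Rmult_eq_reg_l with (sqrt n * sqrt n); [|nra]. rewrite Q3 at 1.
      field_simplify; [|lra]. unfold n. field; lra.
Qed.

(** With q = (b-a)/(a-p) the integrand becomes q/(1+xq), which no longer contains p. Its real part
    has the primitive ln|1+xq|, its imaginary part an arctangent. Since Im q > 0 the increment of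
    the angle stays in (0, PI), which fixes the branch of the logarithm. *)
Lemma seg_inv_log (p a b : C) : a <> p -> 0 < Im ((b - p) / (a - p)) ->
  exists al, 0 < al < PI /\
    seg (fun s => (/ (s - p))%C) a b = (ln (Cmod ((b - p) / (a - p))), al) /\
    ((b - p) / (a - p))%C = (RtoC (Cmod ((b - p) / (a - p))) * cis al)%C.
Proof.
  intros Hap Him. assert (Hap' : (a - p)%C <> RtoC 0).
  { intro E. apply Hap. replace a with (a - p + p)%C by ring. rewrite E. ring. }
  set (q := ((b - a) / (a - p))%C).
  assert (Hq : ((b - p) / (a - p))%C = (1 + q)%C) by (unfold q; field; exact Hap').
  rewrite Hq in *. destruct q as [u v] eqn:Eq. fold q in Hq.
  assert (Hv : 0 < v) by (simpl in Him; lra).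
  assert (E : (1 + (u, v))%C = ((1 + u)%R, v)) by (unfold Cplus, RtoC; simpl; f_equal; ring).
  rewrite E.
  destruct (polar_atan u v Hv) as [Hal Hw].
  set (n := u ^ 2 + v ^ 2) in *. set (al := atan ((n + u) / v) - atan (u / v)) in *.
  exists al. split; [exact Hal|]. split; [|exact Hw].
  apply seg_unique.
  set (D := fun x : R => (1 + x * u) ^ 2 + x ^ 2 * v ^ 2).
  assert (HD : forall x, 0 < D x).
  { intro x. unfold D. destruct (Req_dec x 0) as [->|Hx]. { lra. }
    assert (0 < x ^ 2 * v ^ 2) by (apply Rmult_lt_0_compat; apply pow2_gt_0; lra).
    generalize (pow2_ge_0 (1 + x * u)). lra. }
  apply (is_RInt_ext (V := C_R_NormedModule) (fun x : R => ((u + x * n) / D x, v / D x))).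
  { intros x _.
    assert (HN : (a + x * (b - a) - p)%C <> RtoC 0).
    { replace (a + x * (b - a) - p)%C with ((a - p) * (1 + x * q))%C by (unfold q; field; exact Hap').
      apply Cmult_neq_0; [exact Hap'|]. rewrite Eq. intro Z.
      assert (Z1 := f_equal fst Z). assert (Z2 := f_equal snd Z). simpl in Z1, Z2.
      specialize (HD x). unfold D in HD. nra. }
    assert (Z : ((b - a) * / (a + x * (b - a) - p))%C = (q / (1 + x * q))%C).
    { unfold q. field. split; [exact Hap'|].
      replace (a - p + x * (b - a))%C with (a + x * (b - a) - p)%C by ring. auto. }
    rewrite Z, Eq. specialize (HD x). unfold D, n in *.
    unfold Cdiv, Cinv, Cmult, Cplus, RtoC; simpl. f_equal; field; nra. }
  apply (is_RInt_fct_extend_pair (U := R_NormedModule) (V := R_NormedModule)); simpl.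
  - replace (ln (Cmod ((1 + u)%R, v))) with (minus (/ 2 * ln (D 1)) (/ 2 * ln (D 0))).
    + apply (is_RInt_derive (V := R_CompleteNormedModule) (fun x => / 2 * ln (D x))).
      * intros x _. unfold D. auto_derive. { apply HD. }
        unfold n. specialize (HD x). unfold D in HD. field. repeat split; nra.
      * intros x _. apply (ex_derive_continuous (K := R_AbsRing) (V := R_NormedModule)).
        unfold D. auto_derive. specialize (HD x). unfold D in HD. lra.
    + unfold minus, plus, opp; simpl. unfold D, Cmod; simpl.
      replace ((1 + 0 * u) * ((1 + 0 * u) * 1) + 0 * (0 * 1) * (v * (v * 1))) with 1 by ring.
      rewrite ln_1.
      set (m := (1 + u) * ((1 + u) * 1) + v * (v * 1)).
      replace ((1 + 1 * u) * ((1 + 1 * u) * 1) + 1 * (1 * 1) * (v * (v * 1))) with m by (unfold m; ring).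
      assert (Hm : 0 < m) by (unfold m; generalize (pow2_ge_0 (1 + u)), (pow2_gt_0 v ltac:(lra)); simpl; lra).
      rewrite <- (sqrt_sqrt m) at 1 by lra.
      rewrite ln_mult by (apply sqrt_lt_R0; lra). field.
  - replace al with (minus (atan ((1 * n + u) / v)) (atan ((0 * n + u) / v))).
    + apply (is_RInt_derive (V := R_CompleteNormedModule) (fun x => atan ((x * n + u) / v))).
      * intros x _. auto_derive. { trivial. }
        specialize (HD x). unfold D, n in *.
        assert (0 < u ^ 2 + v ^ 2) by nra.
        field. repeat split; nra.
      * intros x _. apply (ex_derive_continuous (K := R_AbsRing) (V := R_NormedModule)).
        unfold D. auto_derive. specialize (HD x). unfold D in HD. lra.
    + unfold minus, plus, opp; simpl. unfold al. rewrite Rmult_1_l, Rmult_0_l, Rplus_0_l. ring.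
Qed.

(** The range is that of a sum of three angles in (0, PI), one for each side of a triangle. *)
Lemma cis_eq_1 (x : R) : 0 < x < 3 * PI -> cis x = RtoC 1 -> x = 2 * PI.
Proof.
  intros Hx E. assert (E1 := f_equal fst E). assert (E2 := f_equal snd E). simpl in E1, E2.
  destruct (sin_eq_0_0 x E2) as [k Hk].
  assert (P := PI_RGT_0).
  assert (H1 : (0 < k)%Z) by (apply lt_IZR; nra).
  assert (H2 : (k < 3)%Z) by (apply lt_IZR; nra).
  assert (Hk2 : k = 1%Z \/ k = 2%Z) by lia.
  destruct Hk2 as [-> | ->]; rewrite Hk in *.
  - rewrite Rmult_1_l, cos_PI in E1. lra.
  - reflexivity.
Qed.

(** Each positive imaginary part says that [p] lies strictly to the left of a directed side.
    Together they express that [p] is interior and the triangle is positively oriented, in the form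
    that [seg_inv_log] takes. *)
Definition encloses (a b c p : C) : Prop :=
  a <> p /\ b <> p /\ c <> p /\ 0 < Im ((b - p) / (a - p)) /\ 0 < Im ((c - p) / (b - p))
  /\ 0 < Im ((a - p) / (c - p)).

Lemma minus_neq_0 (a p : C) : a <> p -> (a - p)%C <> RtoC 0.
Proof. intros H E. apply H. replace a with (a - p + p)%C by ring. rewrite E. ring. Qed.

(** The three quotients multiply to 1. Hence the logarithms of their moduli cancel, and the three
    angles sum to a multiple of 2 PI strictly between 0 and 3 PI. *)
Lemma winding (a b c p : C) : encloses a b c p ->
  tri (fun s => (/ (s - p))%C) a b c = (2 * PI * Ci)%C.
Proof.
  intros (Ha & Hb & Hc & H1 & H2 & H3).
  destruct (seg_inv_log p a b Ha H1) as [x [Hx [Lx Wx]]].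
  destruct (seg_inv_log p b c Hb H2) as [y [Hy [Ly Wy]]].
  destruct (seg_inv_log p c a Hc H3) as [z [Hz [Lz Wz]]].
  unfold tri. rewrite Lx, Ly, Lz.
  set (w1 := ((b - p) / (a - p))%C) in *. set (w2 := ((c - p) / (b - p))%C) in *.
  set (w3 := ((a - p) / (c - p))%C) in *.
  assert (W : (w1 * w2 * w3 = 1)%C) by (unfold w1, w2, w3; field; auto using minus_neq_0).
  assert (M : Cmod w1 * Cmod w2 * Cmod w3 = 1) by (now rewrite <- !Cmod_mult, W, Cmod_1).
  assert (N : forall w, 0 < Im w -> 0 < Cmod w).
  { intros w Hw. apply Cmod_gt_0. apply Im_neq_0. lra. }
  assert (N1 := N _ H1). assert (N2 := N _ H2). assert (N3 := N _ H3).
  assert (E : x + y + z = 2 * PI).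
  { apply cis_eq_1. { lra. } rewrite !cis_plus. rewrite <- W, Wx, Wy, Wz.
    replace (Cmod w1 * cis x * (Cmod w2 * cis y) * (Cmod w3 * cis z))%C
      with (RtoC (Cmod w1 * Cmod w2 * Cmod w3) * (cis x * cis y * cis z))%C
      by (rewrite !RtoC_mult; ring).
    rewrite M. ring. }
  unfold Cplus; simpl. rewrite E, <- !ln_mult, M, ln_1 by (try apply Rmult_lt_0_compat; assumption).
  unfold Cmult, Ci, RtoC; simpl. f_equal; ring.
Qed.

(** ** Cauchy's formula and Taylor series *)

Lemma edge_avoids (a b p : C) (x : R) : a <> p -> 0 < Im ((b - p) / (a - p)) ->
  0 <= x -> (a + x * (b - a))%C <> p.
Proof.
  intros Hap Him Hx E. assert (Hap' := minus_neq_0 a p Hap).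
  assert (Z : (1 + x * ((b - p) / (a - p) - 1))%C = RtoC 0).
  { replace (1 + x * ((b - p) / (a - p) - 1))%C with ((a + x * (b - a) - p) / (a - p))%C by (field; exact Hap').
    rewrite E. field. exact Hap'. }
  set (w := ((b - p) / (a - p))%C) in *. destruct w as [u v]. simpl in Him.
  assert (Z1 := f_equal fst Z). assert (Z2 := f_equal snd Z). simpl in Z1, Z2.
  assert (x * v = 0) by lra. assert (x = 0) by nra. subst x. lra.
Qed.

Lemma encloses_avoids (a b c p : C) : encloses a b c p ->
  forall x y, is_edge a b c x y ->
  forall t : R, 0 <= t <= 1 -> (x + t * (y - x))%C <> p.
Proof.
  intros (Ha & Hb & Hc & H1 & H2 & H3) x y [[-> ->]|[[-> ->]|[-> ->]]] t Ht;
    apply edge_avoids; tauto.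
Qed.

(** The value [l] fills in the point [p]; for l = f'(p) Goursat's theorem then applies on a convex
    set that contains [p]. *)
Definition quotient (f : C -> C) (l p : C) (s : C) : C :=
  if Ceq_dec s p then l else ((f s - f p) / (s - p))%C.

Lemma quotient_neq f l p s : s <> p -> quotient f l p s = ((f s - f p) * / (s - p))%C.
Proof. intros H. unfold quotient. destruct (Ceq_dec s p); [easy|reflexivity]. Qed.

Lemma ball_segment (p y : C) (r t : R) : Cmod (y - p) < r -> 0 <= t <= 1 ->
  Cmod (p + t * (y - p) - p) <= Cmod (y - p) /\ Cmod (p + t * (y - p) - p) < r.
Proof.
  intros Hy Ht. replace (p + t * (y - p) - p)%C with (t * (y - p))%C by ring.
  rewrite Cmod_mult, Cmod_R, Rabs_pos_eq by lra. generalize (Cmod_ge_0 (y - p)). intros.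
  split; nra.
Qed.

(* The singularity at [p] is removable: integrating the first-order expansion of
   [f1] along the segment [p, y] gives a second-order expansion of [f]. *)
Lemma quotient_diff (f f1 f2 : C -> C) (p : C) (r : R) : 0 < r ->
  (forall y, Cmod (y - p) < r -> C_diff f y (f1 y) /\ C_diff f1 y (f2 y)) ->
  C_diff (quotient f (f1 p) p) p (f2 p / 2)%C.
Proof.
  intros Hr H. apply C_diff_eps. intros eps He.
  assert (Z : Cmod (p - p) < r) by (replace (p - p)%C with (RtoC 0) by ring; now rewrite Cmod_0).
  destruct (proj1 (C_diff_eps _ _ _) (proj2 (H p Z)) eps He) as [d [Hd H1]].
  exists (Rmin r d). split; [now apply Rmin_pos|]. intros y Hy.
  apply Rmin_Rgt in Hy. destruct Hy as [Y1 Y2].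
  unfold quotient. destruct (Ceq_dec p p) as [_|]; [|easy].
  destruct (Ceq_dec y p) as [->|Hn].
  { replace (f1 p - f1 p - f2 p / 2 * (p - p))%C with (RtoC 0) by ring.
    rewrite Cmod_0. apply Rmult_le_pos; [lra|apply Cmod_ge_0]. }
  assert (Hn' := minus_neq_0 y p Hn).
  set (G := fun s => (f s - (f1 p * s + f2 p / 2 * (s - p) ^ 2))%C).
  set (g := fun s => (f1 s - f1 p - f2 p * (s - p))%C).
  assert (E : seg g p y = (G y - G p)%C).
  { apply seg_FTC.
    - intros x Hx. destruct (ball_segment p y r x Y1 Hx) as [_ B].
      set (s := (p + x * (y - p))%C) in *. unfold g, G.
      replace (f1 s - f1 p - f2 p * (s - p))%C with
        (f1 s - (f1 p * 1 + f2 p / 2 * (RtoC (INR 2) * (s - p) ^ pred 2 * (1 - 0))))%C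
        by (simpl; rewrite RtoC_plus; field).
      apply C_diff_minus; [apply H, B|]. apply C_diff_plus; apply C_diff_scal; [apply C_diff_id|].
      apply (C_diff_pow (fun s => (s - p)%C)). apply C_diff_minus; [apply C_diff_id|apply C_diff_const].
    - intros x Hx. destruct (ball_segment p y r x Y1 Hx) as [_ B].
      unfold g. apply hol_at_minus; [apply hol_at_minus|].
      + eexists. apply H, B.
      + apply hol_at_const.
      + apply hol_at_mult; [apply hol_at_const|]. apply hol_at_minus; [apply hol_at_id|apply hol_at_const]. }
  assert (B : Cmod (seg g p y) <= eps * Cmod (y - p) * Cmod (y - p)).
  { apply seg_norm_le.
    - intros x Hx. destruct (ball_segment p y r x Y1 Hx) as [_ B].
      unfold g. apply hol_at_minus; [apply hol_at_minus|].
      + eexists. apply H, B.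
      + apply hol_at_const.
      + apply hol_at_mult; [apply hol_at_const|]. apply hol_at_minus; [apply hol_at_id|apply hol_at_const].
    - intros x Hx. destruct (ball_segment p y d x Y2 Hx) as [B1 B2]. unfold g.
      eapply Rle_trans; [apply H1, B2|]. apply Rmult_le_compat_l; lra. }
  rewrite E in B.
  replace ((f y - f p) / (y - p) - f1 p - f2 p / 2 * (y - p))%C with ((G y - G p) / (y - p))%C
    by (unfold G; field; exact Hn').
  rewrite Cmod_div by exact Hn'.
  assert (0 < Cmod (y - p)) by now apply Cmod_gt_0.
  apply Rle_div_l; assumption.
Qed.

(** The higher derivatives are carried as data. Two families matter: the derivatives of the Cauchy
    datum read off from the formal solution, and those of the Gaussian. *)
Definition smooth_on (K : C -> Prop) (f : nat -> C -> C) : Prop :=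
  forall n z, K z -> C_diff (f n) z (f (S n) z).

Lemma smooth_shift K f : smooth_on K f -> smooth_on K (fun n => f (S n)).
Proof. intros H n z Hz. now apply H. Qed.

Lemma hol_at_quotient_away f l p s : hol_at f s -> s <> p -> hol_at (quotient f l p) s.
Proof.
  intros Hf Hs.
  assert (H : hol_at (fun s => ((f s - f p) * / (s - p))%C) s).
  { apply hol_at_mult; [apply hol_at_minus; [exact Hf|apply hol_at_const]|].
    apply (hol_at_inv (fun s => (s - p)%C)); [|now apply minus_neq_0].
    apply hol_at_minus; [apply hol_at_id|apply hol_at_const]. }
  destruct H as [m Hm]. exists m.
  apply (C_diff_ext_loc (fun s => ((f s - f p) * / (s - p))%C) _ s m (Cmod (s - p))).
  - now apply Cmod_gt_0, minus_neq_0.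
  - intros y Hy. symmetry. apply quotient_neq. intros ->. rewrite Cmod_sub_sym in Hy. lra.
  - exact Hm.
Qed.

Lemma hol_at_inv_sub p s : s <> p -> hol_at (fun s => (/ (s - p))%C) s.
Proof.
  intros H. apply (hol_at_inv (fun s => (s - p)%C)); [|now apply minus_neq_0].
  apply hol_at_minus; [apply hol_at_id|apply hol_at_const].
Qed.

Lemma tri_ext (f g : C -> C) a b c :
  (forall x y, is_edge a b c x y ->
     forall t : R, 0 <= t <= 1 -> f (x + t * (y - x))%C = g (x + t * (y - x))%C) ->
  tri f a b c = tri g a b c.
Proof.
  intros H. unfold tri. rewrite (seg_ext f g a b), (seg_ext f g b c), (seg_ext f g c a); auto.
Qed.

Definition hol_tri (f : C -> C) (a b c : C) : Prop :=
  hol_seg f a b /\ hol_seg f b c /\ hol_seg f c a.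

Lemma hol_tri_intro f a b c :
  (forall x y, is_edge a b c x y -> hol_seg f x y) -> hol_tri f a b c.
Proof. intros H. repeat split; apply H; auto. Qed.

Lemma tri_minus f g a b c : hol_tri f a b c -> hol_tri g a b c ->
  tri (fun s => (f s - g s)%C) a b c = (tri f a b c - tri g a b c)%C.
Proof. intros (F1 & F2 & F3) (G1 & G2 & G3). unfold tri. rewrite !seg_minus by assumption. ring. Qed.

Lemma tri_plus f g a b c : hol_tri f a b c -> hol_tri g a b c ->
  tri (fun s => (f s + g s)%C) a b c = (tri f a b c + tri g a b c)%C.
Proof. intros (F1 & F2 & F3) (G1 & G2 & G3). unfold tri. rewrite !seg_plus by assumption. ring. Qed.

Lemma tri_scal f k a b c : hol_tri f a b c ->
  tri (fun s => (k * f s)%C) a b c = (k * tri f a b c)%C.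
Proof. intros (F1 & F2 & F3). unfold tri. rewrite !seg_scal by assumption. ring. Qed.

Lemma edge_in_convex (K : C -> Prop) a b c : convex K -> K a -> K b -> K c ->
  forall x y, is_edge a b c x y ->
     forall t : R, 0 <= t <= 1 -> K (x + t * (y - x))%C.
Proof. intros HK Ha Hb Hc x y [[-> ->]|[[-> ->]|[-> ->]]] t Ht; now apply HK. Qed.

(** The filled-in difference quotient has integral 0 by Goursat's theorem; along the sides it splits
    into the wanted integrand and f(p)/(s-p), which contributes the winding number. *)
Lemma cauchy_formula K f p r a b c : convex K -> closed_set K -> smooth_on K f ->
  0 < r -> (forall y, Cmod (y - p) < r -> K y) -> K a -> K b -> K c -> encloses a b c p ->
  tri (fun s => (f 0%nat s * / (s - p))%C) a b c = (2 * PI * Ci * f 0%nat p)%C.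
Proof.
  intros HK Hcl Hf Hr Hp Ha Hb Hc He.
  assert (HE := edge_in_convex K a b c HK Ha Hb Hc).
  assert (HA := encloses_avoids a b c p He).
  assert (G : tri (quotient (f 0%nat) (f 1%nat p) p) a b c = RtoC 0).
  { apply (goursat K); trivial. intros s Hs. destruct (Ceq_dec s p) as [->|Hn].
    - eexists. apply (quotient_diff _ (f 1%nat) (f 2%nat) p r Hr). intros y Hy. split; now apply Hf, Hp.
    - apply hol_at_quotient_away; trivial. eexists. now apply Hf. }
  rewrite (tri_ext _ (fun s => (f 0%nat s * / (s - p) - f 0%nat p * / (s - p))%C)) in G.
  2:{ intros x y Hxy t Ht. rewrite quotient_neq by now apply HA. ring. }
  assert (I : hol_tri (fun s => (/ (s - p))%C) a b c).
  { apply hol_tri_intro. intros x y Hxy t Ht. now apply hol_at_inv_sub, HA. }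
  rewrite tri_minus in G.
  - rewrite tri_scal, winding in G by assumption.
    set (A := tri (fun s => (f 0%nat s * / (s - p))%C) a b c) in *.
    replace A with (A - f 0%nat p * (2 * PI * Ci) + f 0%nat p * (2 * PI * Ci))%C by ring.
    rewrite G. ring.
  - apply hol_tri_intro. intros x y Hxy t Ht. apply hol_at_mult.
    + eexists. apply Hf. now apply HE.
    + now apply hol_at_inv_sub, HA.
  - apply hol_tri_intro. intros x y Hxy t Ht. apply hol_at_mult; [apply hol_at_const|].
    now apply hol_at_inv_sub, HA.
Qed.

(** The function f(s)/(s-p)^(n+1) is a primitive of the difference of the two integrands along the
    sides, which avoid [p]. *)
Lemma tri_by_parts K f p n a b c : convex K -> smooth_on K f ->
  K a -> K b -> K c -> encloses a b c p ->
  (INR (S n) * tri (fun s => (f 0%nat s * (/ (s - p)) ^ S (S n))%C) a b c)%C =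
  tri (fun s => (f 1%nat s * (/ (s - p)) ^ S n)%C) a b c.
Proof.
  intros HK Hf Ha Hb Hc He.
  assert (HE := edge_in_convex K a b c HK Ha Hb Hc).
  assert (HA := encloses_avoids a b c p He).
  assert (HT : forall k m, hol_tri (fun s => (f k s * (/ (s - p)) ^ m)%C) a b c).
  { intros k m. apply hol_tri_intro. intros x y Hxy t Ht. apply hol_at_mult.
    - eexists. apply Hf. now apply HE.
    - apply (hol_at_pow (fun s => (/ (s - p))%C)). now apply hol_at_inv_sub, HA. }
  rewrite <- tri_scal by apply HT.
  assert (E : tri (fun s => (f 1%nat s * (/ (s - p)) ^ S n
      - INR (S n) * (f 0%nat s * (/ (s - p)) ^ S (S n)))%C) a b c = RtoC 0).
  { apply (tri_primitive (fun s => (f 0%nat s * (/ (s - p)) ^ S n)%C)).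
    intros x y Hxy t Ht. specialize (HE x y Hxy t Ht). specialize (HA x y Hxy t Ht).
    set (s := (x + t * (y - x))%C) in *. split.
    - assert (Hs := minus_neq_0 s p HA).
      replace (f 1%nat s * (/ (s - p)) ^ S n - INR (S n) * (f 0%nat s * (/ (s - p)) ^ S (S n)))%C with
        (f 1%nat s * (/ (s - p)) ^ S n + f 0%nat s *
          (RtoC (INR (S n)) * (/ (s - p)) ^ pred (S n) * (- / ((s - p) * (s - p)) * (1 - 0))))%C.
      + apply C_diff_mult; [now apply Hf|].
        apply (C_diff_pow (fun s => (/ (s - p))%C)).
        apply (C_diff_comp Cinv (fun s => (s - p)%C)); [now apply C_diff_inv|].
        apply C_diff_minus; [apply C_diff_id|apply C_diff_const].
      + simpl pred. rewrite !Cpow_S. field. exact Hs.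
    - assert (HI : forall m, hol_at (fun s => ((/ (s - p)) ^ m)%C) s).
      { intro m. apply (hol_at_pow (fun s => (/ (s - p))%C)). now apply hol_at_inv_sub. }
      assert (HF : forall m, hol_at (f m) s) by (intro m; exists (f (S m) s); now apply Hf).
      apply (hol_at_minus (fun s => (f 1%nat s * (/ (s - p)) ^ S n)%C)
        (fun s => (INR (S n) * (f 0%nat s * (/ (s - p)) ^ S (S n)))%C)).
      + exact (hol_at_mult _ _ s (HF 1%nat) (HI (S n))).
      + exact (hol_at_mult _ _ s (hol_at_const _ s) (hol_at_mult _ _ s (HF 0%nat) (HI (S (S n))))). }
  rewrite tri_minus in E; [|apply HT|].
  - set (A := tri (fun s => (f 1%nat s * (/ (s - p)) ^ S n)%C) a b c) in *.
    set (B := tri (fun s => (INR (S n) * _)%C) a b c) in *.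
    replace A with (A - B + B)%C by ring. rewrite E. ring.
  - destruct (HT 0%nat (S (S n))) as (T1 & T2 & T3).
    repeat split; now apply hol_seg_const_mult.
Qed.

(** Integration by parts lowers the order of the pole by one at the cost of one derivative. The
    family [f] is therefore quantified inside the induction, which is applied to its shift. *)
Lemma residue_formula K p r a b c n : convex K -> closed_set K ->
  0 < r -> (forall y, Cmod (y - p) < r -> K y) -> K a -> K b -> K c -> encloses a b c p ->
  forall f, smooth_on K f ->
  tri (fun s => (f 0%nat s * (/ (s - p)) ^ S n)%C) a b c =
  (2 * PI * Ci * (f n p / INR (fact n)))%C.
Proof.
  intros HK Hcl Hr Hp Ha Hb Hc He. induction n as [|n IH]; intros f Hf.
  - simpl fact. simpl INR. rewrite (tri_ext _ (fun s => (f 0%nat s * / (s - p))%C)).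
    + rewrite (cauchy_formula K f p r) by assumption. field.
    + intros. simpl. ring.
  - assert (E := tri_by_parts K f p n a b c HK Hf Ha Hb Hc He).
    rewrite (IH (fun k => f (S k)) (smooth_shift K f Hf)) in E.
    set (A := tri _ a b c) in *. simpl fact.
    assert (N1 : RtoC (INR (S n)) <> RtoC 0) by apply RtoC_neq_0, not_0_INR, Nat.neq_succ_0.
    assert (N2 : RtoC (INR (fact n)) <> RtoC 0) by apply RtoC_neq_0, INR_fact_neq_0.
    replace A with (INR (S n) * A / INR (S n))%C by (field; exact N1).
    rewrite E. change (fact n + n * fact n)%nat with (S n * fact n)%nat.
    rewrite mult_INR, RtoC_mult. field. auto.
Qed.

(** * Termwise integration of series over a triangle *)

Lemma tri_sum_n (g : nat -> C -> C) a b c n :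
  (forall k, hol_tri (g k) a b c) ->
  hol_tri (fun s => Csum (fun k => g k s) n) a b c /\
  @eq C (Csum (fun k => tri (g k) a b c) n)
    (tri (fun s => Csum (fun k => g k s) n) a b c).
Proof.
  intros H. induction n as [|n [IH1 IH2]].
  - split.
    + apply hol_tri_intro. intros x y Hxy t Ht.
      destruct (H 0%nat) as (T1 & T2 & T3).
      assert (T : hol_at (g 0%nat) (x + t * (y - x))%C)
        by (destruct Hxy as [[-> ->]|[[-> ->]|[-> ->]]]; auto).
      destruct T as [l Hl]. exists l.
      apply (C_diff_ext_loc (g 0%nat) _ _ _ 1 Rlt_0_1); [|exact Hl].
      intros s _. symmetry. apply Csum_O.
    + rewrite Csum_O. apply tri_ext. intros. symmetry. apply Csum_O.
  - assert (E : forall s, Csum (fun k => g k s) (S n) =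
      (Csum (fun k => g k s) n + g (S n) s)%C) by (intro s; apply Csum_S).
    split.
    + apply hol_tri_intro. intros x y Hxy t Ht.
      destruct (H (S n)) as (T1 & T2 & T3). destruct IH1 as (I1 & I2 & I3).
      assert (T : hol_at (fun s => (Csum (fun k => g k s) n + g (S n) s)%C) (x + t * (y - x))%C).
      { apply hol_at_plus; destruct Hxy as [[-> ->]|[[-> ->]|[-> ->]]]; auto. }
      destruct T as [l Hl]. exists l.
      apply (C_diff_ext_loc (fun s => (Csum (fun k => g k s) n + g (S n) s)%C) _ _ _ 1 Rlt_0_1); [|exact Hl].
      intros s _. symmetry. apply E.
    + rewrite Csum_S, IH2, <- tri_plus by auto. apply tri_ext. intros. symmetry. apply E.
Qed.

Lemma tri_series (g : nat -> C -> C) (G : C -> C) (B : R) a b c :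
  (forall k, hol_tri (g k) a b c) -> hol_tri G a b c -> 0 <= B ->
  (forall x y, is_edge a b c x y ->
     forall t : R, 0 <= t <= 1 -> forall n,
     Cmod (Csum (fun k => g k (x + t * (y - x))%C) n - G (x + t * (y - x))%C) <= B / 2 ^ S n) ->
  Cseries (fun k => tri (g k) a b c) (tri G a b c).
Proof.
  intros Hg HG HB H. apply is_series_eps. intros eps He.
  set (d := Cmod (b - a) + Cmod (c - b) + Cmod (a - c)).
  assert (P1 := Cmod_ge_0 (b - a)). assert (P2 := Cmod_ge_0 (c - b)). assert (P3 := Cmod_ge_0 (a - c)).
  destruct (geom_eventually_small (3 * B * d) eps He) as [N HN].
  exists N. intros n Hn. specialize (HN (S n) ltac:(lia)).
  destruct (tri_sum_n g a b c n Hg) as [H1 H2]. rewrite H2, <- tri_minus by assumption.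
  assert (Q : 0 < / 2 ^ S n) by (apply Rinv_0_lt_compat, pow_lt; lra).
  eapply Rle_lt_trans; [|exact HN].
  replace (3 * B * d / 2 ^ S n) with (3 * (B / 2 ^ S n) * d) by (field; apply pow_nonzero; lra).
  apply tri_norm_le.
  - apply Rmult_le_pos; lra.
  - unfold sides_le, d. lra.
  - intros x y Hxy. split; [|intros t Ht; now apply H].
    destruct H1 as (I1 & I2 & I3). destruct HG as (T1 & T2 & T3).
    intros t Ht. apply hol_at_minus; destruct Hxy as [[-> ->]|[[-> ->]|[-> ->]]]; auto.
Qed.

Lemma geom_remainder (w h : C) (n : nat) : w <> h -> w <> RtoC 0 ->
  (Csum (fun k => (h ^ k * (/ w) ^ S k)%C) n - / (w - h))%C =
  (- ((h / w) ^ S n * / (w - h)))%C.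
Proof.
  intros Hwh Hw. assert (Hd := minus_neq_0 w h Hwh).
  induction n as [|n IH].
  - rewrite Csum_O. simpl. field. auto.
  - rewrite Csum_S.
    replace (_ + _ - _)%C with ((Csum (fun k => (h ^ k * (/ w) ^ S k)%C) n - / (w - h))
      + h ^ S n * (/ w) ^ S (S n))%C by ring.
    rewrite IH. unfold Cdiv. rewrite !Cpow_mult_l.
    rewrite !(Cpow_S _ (S n)). field. auto.
Qed.

Lemma is_series_ext_C (c d : nat -> C) (S T : C) : (forall n, c n = d n) -> S = T ->
  Cseries c S ->
  Cseries d T.
Proof. intros H -> . now apply is_series_ext. Qed.

Lemma is_series_scal_C (k : C) (c : nat -> C) (S : C) :
  Cseries c S ->
  Cseries (fun n => (k * c n)%C) (k * S)%C.
Proof. apply (is_series_scal (K := C_AbsRing) (V := C_NormedModule)). Qed.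

Lemma is_series_plus_C (c d : nat -> C) (S T : C) :
  Cseries c S ->
  Cseries d T ->
  Cseries (fun n => (c n + d n)%C) (S + T)%C.
Proof. apply (is_series_plus (K := C_AbsRing) (V := C_NormedModule)). Qed.

Lemma two_pi_i_neq_0 : (2 * PI * Ci)%C <> RtoC 0.
Proof.
  assert (P := PI_RGT_0). repeat apply Cmult_neq_0.
  - apply RtoC_neq_0; lra.
  - apply RtoC_neq_0; lra.
  - intro E. assert (E2 := f_equal snd E). simpl in E2. lra.
Qed.

(** * Balls, orientation by cross products, and bounds on the sides of a triangle *)

Definition closed_ball (p : C) (r : R) (s : C) : Prop := Cmod (s - p) <= r.

Lemma convex_closed_ball p r : convex (closed_ball p r).
Proof.
  intros a b x Ha Hb Hx. unfold closed_ball in *.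
  replace (a + x * (b - a) - p)%C with ((1 - x)%R * (a - p) + x * (b - p))%C
    by (rewrite RtoC_minus; ring).
  eapply Rle_trans; [apply Cmod_triangle|].
  rewrite !Cmod_mult, !Cmod_R, !Rabs_pos_eq by lra. nra.
Qed.

Lemma closed_closed_ball p r : closed_set (closed_ball p r).
Proof.
  intros z H. unfold closed_ball in *. apply le_epsilon. intros eps He.
  destruct (H eps He) as [w [Hw Hd]].
  replace (z - p)%C with ((w - p) + (z - w))%C by ring.
  eapply Rle_trans; [apply Cmod_triangle|]. rewrite (Cmod_sub_sym z). lra.
Qed.

Lemma Cmod_pair_le (x y m : R) : 0 <= m -> x ^ 2 + y ^ 2 <= m ^ 2 -> Cmod (x, y) <= m.
Proof.
  intros Hm H. unfold Cmod; simpl fst; simpl snd. rewrite <- (sqrt_pow2 m Hm). now apply sqrt_le_1_alt.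
Qed.

Lemma Cmod_pair_ge (x y m : R) : 0 <= m -> m ^ 2 <= x ^ 2 + y ^ 2 -> m <= Cmod (x, y).
Proof.
  intros Hm H. unfold Cmod; simpl fst; simpl snd. rewrite <- (sqrt_pow2 m Hm). now apply sqrt_le_1_alt.
Qed.

Lemma Im_div_pos (z w : C) : 0 < Re w * Im z - Im w * Re z -> 0 < Im (z / w).
Proof.
  destruct z as [x y], w as [u v]; unfold Re, Im; simpl. intros H.
  assert (N : 0 < u ^ 2 + v ^ 2).
  { destruct (Req_dec u 0) as [->|Hu].
    - destruct (Req_dec v 0) as [->|Hv]. { lra. } generalize (pow2_gt_0 v Hv). lra.
    - generalize (pow2_gt_0 u Hu), (pow2_ge_0 v). lra. }
  replace (x * (- v / (u * (u * 1) + v * (v * 1))) + y * (u / (u * (u * 1) + v * (v * 1))))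
    with ((u * y - v * x) / (u ^ 2 + v ^ 2)) by (field; simpl in N; lra).
  now apply Rdiv_lt_0_compat.
Qed.

Lemma cross_neq (z w : C) : 0 < Re w * Im z - Im w * Re z -> w <> RtoC 0 /\ z <> RtoC 0.
Proof.
  intros H. split; intros E; rewrite E in H; unfold Re, Im, RtoC in H; simpl in H; lra.
Qed.

(** Im(z/w) is the cross product of w and z divided by |w|^2. In this form enclosure is polynomial
    in the coordinates and open to real arithmetic. *)
Lemma encloses_cross (a b c p : C) :
  0 < Re (a - p) * Im (b - p) - Im (a - p) * Re (b - p) ->
  0 < Re (b - p) * Im (c - p) - Im (b - p) * Re (c - p) ->
  0 < Re (c - p) * Im (a - p) - Im (c - p) * Re (a - p) ->
  encloses a b c p.
Proof.
  intros H1 H2 H3.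
  destruct (cross_neq _ _ H1) as [N1 _]. destruct (cross_neq _ _ H2) as [N2 _].
  destruct (cross_neq _ _ H3) as [N3 _].
  assert (N : forall x, (x - p)%C <> RtoC 0 -> x <> p).
  { intros x Hx E. apply Hx. rewrite E. ring. }
  repeat split; auto using Im_div_pos.
Qed.

Lemma seg_bounded (f : C -> C) (a b : C) : hol_seg f a b ->
  exists M, 0 <= M /\ forall t : R, 0 <= t <= 1 -> Cmod (f (a + t * (b - a))%C) <= M.
Proof.
  intros H. set (g := fun t : R => Cmod (f (a + t * (b - a))%C)).
  destruct (continuity_ab_maj g 0 1 ltac:(lra)) as [m [Hm _]].
  - intros t Ht. destruct (H t Ht) as [l Hl].
    apply continuity_pt_filterlim. apply (filterlim_locally (U := R_UniformSpace)). intros eps.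
    destruct (proj1 (R_cont_eps (fun t : R => f (a + t * (b - a))%C) t)
      (R_diff_cont _ _ _ (R_diff_comp_affine f a (b - a)%C t l Hl)) eps (cond_pos eps)) as [d [Hd H1]].
    exists (mkposreal _ Hd). intros y Hy. specialize (H1 y Hy).
    change (Rabs (g y - g t) < eps). eapply Rle_lt_trans; [|exact H1].
    unfold g. assert (Q1 := Cmod_sub_ge (f (a + y * (b - a))%C) (f (a + t * (b - a))%C)).
    assert (Q2 := Cmod_sub_ge (f (a + t * (b - a))%C) (f (a + y * (b - a))%C)).
    rewrite Cmod_sub_sym in Q2. apply Rabs_le. lra.
  - exists (g m). split; [apply Cmod_ge_0|exact Hm].
Qed.

Lemma tri_bounded (f : C -> C) (a b c : C) : hol_tri f a b c ->
  exists M, 0 <= M /\ forall x y, is_edge a b c x y ->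
     forall t : R, 0 <= t <= 1 -> Cmod (f (x + t * (y - x))%C) <= M.
Proof.
  intros (H1 & H2 & H3).
  destruct (seg_bounded f a b H1) as [M1 [P1 B1]].
  destruct (seg_bounded f b c H2) as [M2 [P2 B2]].
  destruct (seg_bounded f c a H3) as [M3 [P3 B3]].
  exists (M1 + M2 + M3). split; [lra|].
  intros x y [[-> ->]|[[-> ->]|[-> ->]]] t Ht.
  - specialize (B1 t Ht). lra.
  - specialize (B2 t Ht). lra.
  - specialize (B3 t Ht). lra.
Qed.

Lemma Cplus_sub_l (z w : C) : (z + w - z)%C = w.
Proof. ring. Qed.

(** Cauchy's formula is applied on a triangle around [z], and the kernel 1/(s-(z+h)) is expanded in
    powers of h/(s-z). The coefficients are given by the residue formula. *)
Lemma taylor (f : nat -> C -> C) (z : C) (r : R) : 0 < r ->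
  smooth_on (closed_ball z (3 * r)) f -> forall h, Cmod h <= r / 4 ->
  Cseries
    (fun n => (f n z / INR (fact n) * h ^ n)%C) (f 0%nat (z + h)%C).
Proof.
  intros Hr Hf h Hh.
  set (K := closed_ball z (3 * r)).
  assert (HK : convex K) by apply convex_closed_ball.
  assert (Hcl : closed_set K) by apply closed_closed_ball.
  (* The sides of this triangle stay at distances between r and 3r from [z], and it encloses z + h
     for every |h| <= r/4. On the sides this gives |h/(s-z)| <= 1/4 and |s-z-h| >= 3r/4, more than
     the bounds 1/2 and r/2 used below. *)
  set (v1 := ((2 * r)%R, (- r)%R) : C). set (v2 := (0%R, (2 * r)%R) : C). set (v3 := ((- 2 * r)%R, (- r)%R) : C).
  set (a := (z + v1)%C). set (b := (z + v2)%C). set (c := (z + v3)%C).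
  assert (Ka : K a) by (unfold K, closed_ball, a; rewrite Cplus_sub_l; apply Cmod_pair_le; nra).
  assert (Kb : K b) by (unfold K, closed_ball, b; rewrite Cplus_sub_l; apply Cmod_pair_le; nra).
  assert (Kc : K c) by (unfold K, closed_ball, c; rewrite Cplus_sub_l; apply Cmod_pair_le; nra).
  assert (HE := edge_in_convex K a b c HK Ka Kb Kc).
  assert (ENC : forall k, Cmod k <= r / 4 -> encloses a b c (z + k)%C).
  { intros k Hk. assert (B1 := re_le_Cmod k). assert (B2 := im_le_Cmod k).
    destruct k as [x y], z as [z1 z2]. unfold Re, Im in B1, B2; simpl in B1, B2.
    assert (L1 : - (r / 4) <= x <= r / 4) by (apply Rabs_le_between; lra).
    assert (L2 : - (r / 4) <= y <= r / 4) by (apply Rabs_le_between; lra).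
    apply encloses_cross; unfold a, b, c, v1, v2, v3, Re, Im; simpl; nra. }
  assert (Z0 : Cmod 0 <= r / 4) by (rewrite Cmod_0; lra).
  assert (E0 := ENC 0%C Z0). replace (z + 0)%C with z in E0 by ring.
  assert (Eh := ENC h Hh).
  assert (LOW : forall x y, is_edge a b c x y ->
     forall t : R, 0 <= t <= 1 -> r <= Cmod (x + t * (y - x) - z)).
  { intros x y Hxy t Ht.
    assert (Q : forall v w : C, (z + v + t * (z + w - (z + v)) - z)%C =
       ((fst v + t * (fst w - fst v))%R, (snd v + t * (snd w - snd v))%R)).
    { intros [p1 p2] [q1 q2]. destruct z as [z1 z2].
      unfold Cminus, Cplus, Copp, Cmult, RtoC; simpl. f_equal; ring. }
    destruct Hxy as [[-> ->]|[[-> ->]|[-> ->]]]; unfold a, b, c; rewrite Q; apply Cmod_pair_ge;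
      simpl; try lra.
    (* On this side the squared distance is r^2 ((13t-7)^2 + 16)/13; the next side has 13t - 6
       instead, and the last one keeps the constant height -r. *)
    - generalize (Rmult_le_pos _ _ (Rlt_le _ _ (pow_lt r 2 Hr)) (pow2_ge_0 (13 * t - 7))). intro. nra.
    - generalize (Rmult_le_pos _ _ (Rlt_le _ _ (pow_lt r 2 Hr)) (pow2_ge_0 (13 * t - 6))). intro. nra.
    - generalize (pow2_ge_0 (- 2 * r + t * (2 * r - - 2 * r))). intro. nra. }
  assert (AV := encloses_avoids a b c z E0). assert (AVh := encloses_avoids a b c (z + h)%C Eh).
  assert (HF : forall n x y, is_edge a b c x y ->
     forall t : R, 0 <= t <= 1 -> hol_at (f n) (x + t * (y - x))%C).
  { intros n x y Hxy t Ht. eexists. apply Hf. now apply HE. }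
  assert (HT : forall n, hol_tri (fun s => (f 0%nat s * (/ (s - z)) ^ S n)%C) a b c).
  { intro n. apply hol_tri_intro. intros x y Hxy t Ht. apply hol_at_mult; [now apply HF|].
    apply (hol_at_pow (fun s => (/ (s - z))%C)). now apply hol_at_inv_sub, AV. }
  destruct (tri_bounded (f 0%nat) a b c) as [M [HM BD]].
  { apply hol_tri_intro. intros x y Hxy t Ht. now apply HF. }
  assert (SER := tri_series
    (fun n s => (h ^ n * (f 0%nat s * (/ (s - z)) ^ S n))%C)
    (fun s => (f 0%nat s * / (s - (z + h)))%C) (M * (2 / r)) a b c).
  assert (RB : forall y, Cmod (y - z) < r -> K y) by (intros y Hy; unfold K, closed_ball; lra).
  assert (RBh : forall y, Cmod (y - (z + h)) < r -> K y).
  { intros y Hy. unfold K, closed_ball. replace (y - z)%C with (y - (z + h) + h)%C by ring.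
    eapply Rle_trans; [apply Cmod_triangle|]. lra. }
  rewrite (cauchy_formula K f (z + h) r) in SER by assumption.
  apply is_series_ext_C with
    (c := fun n => (/ (2 * PI * Ci) * tri (fun s => (h ^ n * (f 0%nat s * (/ (s - z)) ^ S n))%C) a b c)%C)
    (S := (/ (2 * PI * Ci) * (2 * PI * Ci * f 0%nat (z + h)%C))%C).
  - intro n. rewrite tri_scal by apply HT.
    rewrite (residue_formula K z r) by assumption.
    assert (N1 := two_pi_i_neq_0).
    assert (N2 : RtoC (INR (fact n)) <> RtoC 0) by apply RtoC_neq_0, INR_fact_neq_0.
    set (w := (2 * PI * Ci)%C) in *. field. auto.
  - assert (N1 := two_pi_i_neq_0). set (w := (2 * PI * Ci)%C) in *. field. auto.
  - apply is_series_scal_C. apply SER.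
    + intro n. destruct (HT n) as (T1 & T2 & T3). repeat split; now apply hol_seg_const_mult.
    + apply hol_tri_intro. intros x y Hxy t Ht. apply hol_at_mult; [now apply HF|].
      now apply hol_at_inv_sub, AVh.
    + apply Rmult_le_pos; [lra|]. left. apply Rdiv_lt_0_compat; lra.
    + intros x y Hxy t Ht n. specialize (LOW x y Hxy t Ht). specialize (BD x y Hxy t Ht).
      specialize (AV x y Hxy t Ht). specialize (AVh x y Hxy t Ht).
      set (s := (x + t * (y - x))%C) in *.
      set (w := (s - z)%C) in *.
      assert (Hw : w <> RtoC 0) by now apply minus_neq_0.
      assert (Hwh : w <> h).
      { intro E. apply AVh. rewrite <- E. unfold w. ring. }
      replace (s - (z + h))%C with (w - h)%C by (unfold w; ring).
      assert (E : (Csum (fun k => (h ^ k * (f 0%nat s * (/ w) ^ S k))%C) n - f 0%nat s * / (w - h))%C =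
        (f 0%nat s * (- ((h / w) ^ S n * / (w - h))))%C).
      { rewrite <- geom_remainder by assumption.
        assert (E1 : @eq C (Csum (fun k => (h ^ k * (f 0%nat s * (/ w) ^ S k))%C) n)
          (f 0%nat s * Csum (fun k => (h ^ k * (/ w) ^ S k)%C) n)%C).
        { clear. induction n as [|n IH].
          - rewrite !Csum_O. ring.
          - rewrite !Csum_S, IH. ring. }
        rewrite E1. ring. }
      rewrite E, Cmod_mult, Cmod_opp, Cmod_mult, Cmod_pow, Cmod_div by exact Hw.
      rewrite Cmod_inv by now apply minus_neq_0.
      replace (M * (2 / r) / 2 ^ S n) with (M * ((/ 2) ^ S n * (2 / r))) by (rewrite pow_inv; field; split; [lra|apply pow_nonzero; lra]).
      apply Rmult_le_compat; [apply Cmod_ge_0| |exact BD|].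
      { apply Rmult_le_pos. { apply pow_le, Rdiv_le_0_compat; [apply Cmod_ge_0|lra]. }
        left. apply Rinv_0_lt_compat. apply Cmod_gt_0. now apply minus_neq_0. }
      assert (W1 := Cmod_sub_ge w h).
      apply Rmult_le_compat.
      * apply pow_le, Rdiv_le_0_compat; [apply Cmod_ge_0|lra].
      * left. apply Rinv_0_lt_compat. lra.
      * apply pow_incr. split. { apply Rdiv_le_0_compat; [apply Cmod_ge_0|lra]. }
        apply Rle_div_l; lra.
      * replace (2 / r) with (/ (r / 2)) by (field; lra). apply Rinv_le_contravar; lra.
Qed.

(** ** Even functions of a square root *)

Lemma Csqrt_ex (s : C) : exists w : C, (w ^ 2)%C = s.
Proof.
  destruct s as [x y].
  assert (B := re_le_Cmod (x, y)). unfold Re in B; simpl in B. apply Rabs_le_between in B.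
  set (m := Cmod (x, y)) in *.
  assert (Hm : m ^ 2 = x ^ 2 + y ^ 2) by exact (Cmod2_alt (x, y)).
  set (p := (m + x) / 2). set (q := (m - x) / 2).
  assert (Hp : 0 <= p) by (unfold p; lra). assert (Hq : 0 <= q) by (unfold q; lra).
  assert (E : sqrt p * sqrt q = Rabs y / 2).
  { rewrite <- sqrt_mult by assumption.
    replace (p * q) with ((Rabs y / 2) ^ 2).
    - apply sqrt_pow2. generalize (Rabs_pos y). lra.
    - replace ((Rabs y / 2) ^ 2) with (Rabs y ^ 2 / 4) by field. rewrite pow2_abs. unfold p, q. lra. }
  assert (Sp := sqrt_sqrt p Hp). assert (Sq := sqrt_sqrt q Hq).
  destruct (Rle_lt_dec 0 y) as [Hy|Hy].
  - rewrite Rabs_pos_eq in E by exact Hy. exists (sqrt p, sqrt q).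
    unfold Cmult; simpl. unfold Cmult; simpl. f_equal; [unfold p, q in *; nra|nra].
  - rewrite Rabs_left in E by exact Hy. exists (sqrt p, (- sqrt q)%R).
    unfold Cmult; simpl. unfold Cmult; simpl. f_equal; [unfold p, q in *; nra|nra].
Qed.

Definition Csqrt (s : C) : C :=
  proj1_sig (constructive_indefinite_description _ (Csqrt_ex s)).

Lemma Csqrt_sqr (s : C) : (Csqrt s ^ 2)%C = s.
Proof. unfold Csqrt. destruct constructive_indefinite_description as [w Hw]. exact Hw. Qed.

Lemma Csqr_eq (v w : C) : (v ^ 2)%C = (w ^ 2)%C -> v = w \/ v = (- w)%C.
Proof.
  intros H. assert (E : ((v - w) * (v + w))%C = RtoC 0).
  { replace ((v - w) * (v + w))%C with (v ^ 2 - w ^ 2)%C by ring. rewrite H. ring. }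
  destruct (Ceq_dec v w) as [->|Hn]; [now left|right].
  destruct (Ceq_dec (v + w)%C (RtoC 0)) as [Hz|Hz].
  - replace v with (v + w - w)%C by ring. rewrite Hz. ring.
  - exfalso. revert E. apply Cmult_neq_0; [now apply minus_neq_0|exact Hz].
Qed.

Definition even (F : C -> C) : Prop := forall w, F (- w)%C = F w.

Lemma even_Csqrt (F : C -> C) (w : C) : even F -> F (Csqrt (w ^ 2)) = F w.
Proof.
  intros HF. destruct (Csqr_eq (Csqrt (w ^ 2)) w (Csqrt_sqr _)) as [->| ->]; auto.
Qed.

Lemma Csqrt_near (w0 s : C) : exists w, (w ^ 2)%C = s /\ Cmod (w - w0) <= Cmod (w + w0).
Proof.
  destruct (Csqrt_ex s) as [w Hw].
  destruct (Rle_lt_dec (Cmod (w - w0)) (Cmod (w + w0))) as [H|H].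
  - now exists w.
  - exists (- w)%C. split.
    + rewrite <- Hw. ring.
    + replace (- w - w0)%C with (- (w + w0))%C by ring.
      replace (- w + w0)%C with (- (w - w0))%C by ring. rewrite !Cmod_opp. lra.
Qed.

(* [Csqrt] is an arbitrary, discontinuous choice of root; by evenness it may be
   replaced near [w0 ^ 2] by the root closest to [w0]. *)
Lemma even_Csqrt_hol (F : C -> C) (w0 : C) : even F -> w0 <> RtoC 0 -> hol_at F w0 ->
  hol_at (fun s => F (Csqrt s)) (w0 ^ 2)%C.
Proof.
  intros HF Hw0 [l Hl]. exists (l / (2 * w0))%C.
  apply C_diff_eps. intros eps He.
  assert (Hr : 0 < Cmod w0) by now apply Cmod_gt_0.
  set (r := Cmod w0) in *.
  assert (He1 : 0 < eps * r / 2) by nra.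
  destruct (proj1 (C_diff_eps F w0 l) Hl _ He1) as [d [Hd H]].
  assert (Hq : 0 < eps * r ^ 3 / (Cmod l + 1)).
  { assert (L := Cmod_ge_0 l). assert (0 < r ^ 3) by now apply pow_lt.
    apply Rdiv_lt_0_compat; [nra|lra]. }
  exists (Rmin (d * r) (eps * r ^ 3 / (Cmod l + 1))). split. { apply Rmin_pos; [nra|exact Hq]. }
  intros s Hs. apply Rmin_Rgt in Hs. destruct Hs as [S1 S2].
  destruct (Csqrt_near w0 s) as [w [Hw Hn]].
  rewrite <- Hw in *. rewrite !even_Csqrt by exact HF.
  (* The root nearest to w0 satisfies |w + w0| >= |w0|, so |w - w0| is at most |w^2 - w0^2| / |w0|:
     this root varies in a Lipschitz way. *)
  assert (Ge : r <= Cmod (w + w0)).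
  { assert (T := Cmod_triangle (w + w0) (- (w - w0))%C). rewrite Cmod_opp in T.
    replace (w + w0 + - (w - w0))%C with (2 * w0)%C in T by ring.
    rewrite Cmod_mult, Cmod_R, Rabs_pos_eq in T by lra. fold r in T. lra. }
  assert (E : (w ^ 2 - w0 ^ 2)%C = ((w - w0) * (w + w0))%C) by ring.
  assert (N : Cmod (w ^ 2 - w0 ^ 2) = Cmod (w - w0) * Cmod (w + w0)) by (rewrite E; apply Cmod_mult).
  set (D := Cmod (w ^ 2 - w0 ^ 2)) in *. set (n := Cmod (w - w0)) in *.
  assert (n0 : 0 <= n) by apply Cmod_ge_0.
  assert (nD : n * r <= D) by (rewrite N; apply Rmult_le_compat_l; lra).
  assert (n1 : n < d) by nra.
  specialize (H w n1). fold n in H.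
  (* Since w^2 - w0^2 = 2 w0 (w-w0) + (w-w0)^2, the error is that of [F] at w0 plus a quadratic
     term, which the second bound in the radius absorbs. *)
  replace (F w - F w0 - l / (2 * w0) * (w ^ 2 - w0 ^ 2))%C with
    ((F w - F w0 - l * (w - w0)) - l * ((w - w0) * (w - w0)) / (2 * w0))%C by (field; exact Hw0).
  eapply Rle_trans; [apply Cmod_triangle|]. rewrite Cmod_opp, Cmod_div, !Cmod_mult, Cmod_R, (Rabs_pos_eq 2)
    by (try apply Cmult_neq_0; trivial; try apply RtoC_neq_0; lra).
  fold n r.
  assert (A1 : eps * r / 2 * n <= eps / 2 * D) by nra.
  assert (A2 : Cmod l * (n * n) / (2 * r) <= eps / 2 * D).
  { assert (Z : Cmod l * (n * r) <= eps * r ^ 3).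
    { assert (L := Cmod_ge_0 l).
      assert (D * (Cmod l + 1) < eps * r ^ 3).
      { replace (eps * r ^ 3) with (eps * r ^ 3 / (Cmod l + 1) * (Cmod l + 1)) by (field; lra).
        apply Rmult_lt_compat_r; lra. }
      nra. }
    apply Rle_div_l; [lra|].
    assert (Z2 : Cmod l * n <= eps * (r * r)).
    { apply Rmult_le_reg_r with r; [exact Hr|]. simpl in Z. lra. }
    assert (Z3 : Cmod l * n * n <= eps * (r * r) * n) by (apply Rmult_le_compat_r; assumption).
    assert (Z4 : eps * r * (n * r) <= eps * r * D) by (apply Rmult_le_compat_l; [nra|assumption]).
    lra. }
  lra.
Qed.

Lemma series_terms_bounded (c : nat -> C) (S0 : C) :
  Cseries c S0 ->
  exists M, 0 < M /\ forall n, Cmod (c n) <= M.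
Proof.
  intros H. destruct (proj1 (is_series_eps c S0) H 1 Rlt_0_1) as [N HN].
  assert (F : forall m, exists M, 0 < M /\ forall n, (n <= m)%nat -> Cmod (c n) <= M).
  { induction m as [|m [M [HM IH]]].
    - exists (Cmod (c 0%nat) + 1). split. { generalize (Cmod_ge_0 (c 0%nat)). lra. }
      intros n Hn. replace n with 0%nat by lia. lra.
    - exists (M + Cmod (c (S m))). split. { generalize (Cmod_ge_0 (c (S m))). lra. }
      intros n Hn. assert (n <= m \/ n = S m)%nat as [Hl| ->] by lia.
      + specialize (IH n Hl). generalize (Cmod_ge_0 (c (S m))). lra.
      + lra. }
  destruct (F N) as [M [HM HF]]. exists (M + 2). split; [lra|].
  intros n. destruct (Nat.le_gt_cases n N) as [Hl|Hg].
  - specialize (HF n Hl). lra.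
  - destruct n as [|n]; [lia|].
    assert (H1 := HN n ltac:(lia)). assert (H2 := HN (S n) ltac:(lia)).
    rewrite Csum_S in H2. rewrite Cmod_sub_sym in H1.
    replace (c (S n)) with
      ((Csum c n + c (S n) - S0) + (S0 - Csum c n))%C by ring.
    eapply Rle_trans; [apply Cmod_triangle|]. lra.
Qed.

(** The square root branches at 0, so holomorphy of the Borel transform at that point has to come
    from its power series. *)
Lemma power_series_diff_0 (d : nat -> C) (g : C -> C) (r : R) : 0 < r ->
  (forall s, Cmod s <= r -> Cseries (fun n => (d n * s ^ n)%C) (g s)) ->
  hol_at g 0%C.
Proof.
  intros Hr H.
  destruct (series_terms_bounded _ _ (H (RtoC r) ltac:(rewrite Cmod_R, Rabs_pos_eq; lra))) as [M [HM HB]].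
  exists (d 1%nat). apply C_diff_eps. intros eps He.
  assert (Hq : 0 < eps * r ^ 2 / (2 * M)).
  { assert (0 < r ^ 2) by now apply pow_lt. apply Rdiv_lt_0_compat; nra. }
  exists (Rmin (r / 2) (eps * r ^ 2 / (2 * M))). split; [apply Rmin_pos; lra|].
  intros s Hs. replace (s - 0)%C with s in * by ring.
  apply Rmin_Rgt in Hs. destruct Hs as [S1 S2].
  assert (G0 : g 0%C = d 0%nat).
  { assert (H0 := H 0%C ltac:(rewrite Cmod_0; lra)).
    apply (filterlim_locally_unique (V := C_NormedModule) (F := eventually)
      (sum_n (fun n => (d n * 0 ^ n)%C))); [exact H0|].
    apply (filterlim_ext (fun _ : nat => d 0%nat)); [|apply filterlim_const].
    intro n. induction n as [|n IH].
    - symmetry. assert (E := Csum_O (fun n => (d n * 0 ^ n)%C)). etransitivity; [exact E|].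
      assert (E' : (d 0%nat * 0 ^ 0)%C = d 0%nat) by (simpl; ring). exact E'.
    - rewrite IH. symmetry. assert (E := Csum_S (fun n => (d n * 0 ^ n)%C) n).
      etransitivity; [exact E|].
      set (q := Csum _ n).
      assert (E' : (q + d (S n) * 0 ^ S n)%C = q) by (simpl; ring). exact E'. }
  specialize (H s ltac:(lra)).
  (* With the terms of index 0 and 1 set to zero, the sum is the remainder of first order. For |s|
     <= r/2 the terms are dominated by a geometric sequence with the factor (|s|/r)^2, hence a
     quadratic bound. *)
  set (c := fun n => match n with O | 1%nat => RtoC 0 | _ => (d n * s ^ n)%C end).
  assert (SC : forall n, @eq C (Csum c (S n))
    (Csum (fun n => (d n * s ^ n)%C) (S n) - d 0%nat - d 1%nat * s)%C).
  { induction n as [|n IH].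
    - rewrite !Csum_S, !Csum_O. unfold c. simpl. ring.
    - rewrite (Csum_S c), IH, (Csum_S _ (S n)). unfold c. ring. }
  assert (Sc : Cseries c (g s - d 0%nat - d 1%nat * s)%C).
  { apply is_series_eps. intros e Hee. destruct (proj1 (is_series_eps _ _) H e Hee) as [N HN].
    exists (S N). intros n Hn. destruct n as [|n]; [lia|]. rewrite SC.
    specialize (HN (S n) ltac:(lia)).
    replace (_ - _ - _ - _)%C with (Csum (fun n => (d n * s ^ n)%C) (S n) - g s)%C by ring.
    exact HN. }
  set (m := Cmod s) in *. assert (m0 : 0 <= m) by apply Cmod_ge_0.
  assert (BT : forall n, Cmod (c n) <= (8 * M * (m / r) ^ 2) / 2 ^ S n).
  { assert (Z : 0 <= M * (m / r) ^ 2) by (apply Rmult_le_pos; [lra|apply pow2_ge_0]).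
    assert (P : forall k, 0 < 2 ^ k) by (intro; apply pow_lt; lra).
    intros [|[|n]]; unfold c.
    - rewrite Cmod_0. apply Rdiv_le_0_compat; [lra|apply P].
    - rewrite Cmod_0. apply Rdiv_le_0_compat; [lra|apply P].
    - specialize (HB (S (S n))). rewrite Cmod_mult, Cmod_pow, Cmod_R, Rabs_pos_eq in HB by lra.
      rewrite Cmod_mult, Cmod_pow. fold m.
      replace (8 * M * (m / r) ^ 2 / 2 ^ S (S (S n))) with (M * (m / r) ^ 2 * (/ 2) ^ n)
        by (rewrite pow_inv; simpl; field; repeat split; try lra; apply pow_nonzero; lra).
      replace (Cmod (d (S (S n))) * m ^ S (S n)) with (Cmod (d (S (S n))) * r ^ S (S n) * ((m / r) ^ 2 * (m / r) ^ n)).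
      2:{ rewrite <- pow_add. replace (2 + n)%nat with (S (S n)) by lia.
          unfold Rdiv. rewrite Rpow_mult_distr, pow_inv. field. apply pow_nonzero. lra. }
      rewrite (Rmult_assoc M).
      assert (Q : 0 <= m / r <= / 2).
      { split. { apply Rdiv_le_0_compat; lra. } apply Rle_div_l; lra. }
      apply Rmult_le_compat; trivial.
      + apply Rmult_le_pos; [apply Cmod_ge_0|apply pow_le; lra].
      + apply Rmult_le_pos; apply pow_le; lra.
      + apply Rmult_le_compat_l; [apply pow_le; lra|]. now apply pow_incr. }
  assert (T := geom_tail c _ _ BT Sc 1%nat).
  rewrite SC in T. rewrite Csum_S, Csum_O in T. rewrite G0.
  replace (d 0%nat * s ^ 0 + d 1%nat * s ^ 1 - d 0%nat - d 1%nat * s - (g s - d 0%nat - d 1%nat * s))%C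
    with (- (g s - d 0%nat - d 1%nat * s))%C in T by (simpl; ring).
  rewrite Cmod_opp in T. eapply Rle_trans; [exact T|].
  replace (8 * M * (m / r) ^ 2 / 2 ^ 2) with (2 * M / r ^ 2 * m * m) by (simpl; field; lra).
  apply Rmult_le_compat_r; [exact m0|].
  assert (R2 : 0 < r ^ 2) by now apply pow_lt.
  replace eps with (2 * M / r ^ 2 * (eps * r ^ 2 / (2 * M))) by (field; split; lra).
  apply Rmult_le_compat_l; [|lra]. left. apply Rdiv_lt_0_compat; lra.
Qed.

(** The odd terms cancel in the average of the series at h and -h. *)
Lemma even_part_series (c : nat -> C) (h S0 T0 : C) :
  Cseries (fun n => (c n * h ^ n)%C) S0 ->
  Cseries (fun n => (c n * (- h) ^ n)%C) T0 ->
  Cseries (fun n => (c (2 * n)%nat * (h ^ 2) ^ n)%C) ((S0 + T0) / 2)%C.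
Proof.
  intros H1 H2.
  assert (H := is_series_scal_C (/ 2)%C _ _ (is_series_plus_C _ _ _ _ H1 H2)). simpl in H.
  apply is_series_eps. intros eps He.
  destruct (proj1 (is_series_eps _ _) H eps He) as [N HN].
  (* The partial sum over k <= n in h^2 is exactly the averaged partial sum over indices up to
     2n+1. *)
  exists N. intros n Hn. specialize (HN (S (2 * n)) ltac:(lia)).
  replace ((S0 + T0) / 2)%C with (/ 2 * (S0 + T0))%C by field.
  eapply Rle_lt_trans; [|exact HN]. right. f_equal. f_equal.
  clear. induction n as [|n IH].
  - rewrite Csum_O. simpl Nat.mul. rewrite Csum_S, Csum_O. simpl. field.
  - rewrite Csum_S, IH. replace (S (2 * S n)) with (S (S (S (2 * n)))) by lia.
    rewrite (Csum_S _ (S (S (2 * n)))), (Csum_S _ (S (2 * n))).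
    replace (2 * S n)%nat with (S (S (2 * n))) by lia.
    assert (E1 : ((- h) ^ S (S (2 * n)) = h ^ S (S (2 * n)))%C).
    { replace (S (S (2 * n))) with (2 * S n)%nat by lia. rewrite !Cpow_mult_r. replace ((- h) ^ 2)%C with (h ^ 2)%C by ring. reflexivity. }
    assert (E2 : ((- h) ^ S (S (S (2 * n))) = - h ^ S (S (S (2 * n))))%C).
    { rewrite (Cpow_S (- h)), E1, (Cpow_S h (S (S (2 * n)))). ring. }
    assert (E3 : ((h ^ 2) ^ S n = h ^ S (S (2 * n)))%C).
    { rewrite <- Cpow_mult_r. f_equal. lia. }
    rewrite E1, E2, E3. match goal with |- ?a = ?b => change (@eq C a b) end. field.
Qed.

(** ** Distances and growth *)

Lemma polar_dist (r x beta w : R) :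
  Cmod (polar r x - polar beta w) ^ 2 = (r - beta * cos (x - w)) ^ 2 + (beta * sin (x - w)) ^ 2.
Proof.
  unfold polar, cis, RtoC. rewrite Cmod2_alt. unfold Re, Im, Cminus, Cplus, Copp, Cmult; simpl.
  rewrite cos_minus, sin_minus.
  generalize (sin2_cos2 x), (sin2_cos2 w). unfold Rsqr. intros H1 H2.
  set (c := cos x) in *. set (s := sin x) in *. set (d := cos w) in *. set (t := sin w) in *.
  assert (E1 : s * s = 1 - c * c) by lra. assert (E2 : t * t = 1 - d * d) by lra.
  ring_simplify.
  replace (s ^ 2) with (1 - c ^ 2) by (simpl; lra). replace (t ^ 2) with (1 - d ^ 2) by (simpl; lra). ring.
Qed.

Lemma Rle_of_sqr (x y : R) : 0 <= y -> x ^ 2 <= y ^ 2 -> x <= y.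
Proof. intros Hy H. apply Rnot_lt_le. intro L. nra. Qed.

(** The number beta |sin(x-w)| is the distance from the point to the full line of direction x. As
    [r] may be negative, the opposite point is covered by the same estimate. *)
Lemma polar_dist_sin (r x beta w k : R) : 0 <= beta -> 0 <= k <= Rabs (sin (x - w)) ->
  beta * k <= Cmod (polar r x - polar beta w).
Proof.
  intros Hb Hk. apply Rle_of_sqr; [apply Cmod_ge_0|].
  rewrite polar_dist.
  assert (H : k ^ 2 <= sin (x - w) ^ 2) by (rewrite <- (pow2_abs (sin _)); apply pow_incr; lra).
  generalize (pow2_ge_0 (r - beta * cos (x - w))), (pow2_ge_0 beta).
  rewrite !Rpow_mult_distr. nra.
Qed.

Lemma polar_opp (r x : R) : (- polar r x)%C = polar (- r) x.
Proof. unfold polar. rewrite RtoC_opp. ring. Qed.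

Lemma polar_sum_sin (r x beta w k : R) : 0 <= beta -> 0 <= k <= Rabs (sin (x - w)) ->
  beta * k <= Cmod (polar r x + polar beta w).
Proof.
  intros Hb Hk. rewrite <- Cmod_opp.
  replace (- (polar r x + polar beta w))%C with (- polar r x - polar beta w)%C by ring.
  rewrite polar_opp. now apply polar_dist_sin.
Qed.

Lemma polar_sum_cos (r x beta w : R) : 0 <= beta -> 0 <= r -> 0 <= cos (x - w) ->
  beta <= Cmod (polar r x + polar beta w).
Proof.
  intros Hb Hr Hc. apply Rle_of_sqr; [apply Cmod_ge_0|].
  replace (polar r x + polar beta w)%C with (polar r x - polar (- beta) w)%C
    by (rewrite <- polar_opp; ring).
  rewrite polar_dist. generalize (sin2_cos2 (x - w)). unfold Rsqr. intros.
  assert (0 <= r * beta * cos (x - w)) by (repeat apply Rmult_le_pos; assumption). nra.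
Qed.

(** Angles are kept in [-1, 1], inside (-PI/2, PI/2), where the sine increases and the cosine is
    positive. *)
Lemma sin_abs_ge (k y : R) : 0 <= k -> k <= Rabs y <= 1 -> sin k <= Rabs (sin y).
Proof.
  intros Hk Hy. assert (P := PI2_1).
  assert (E : Rabs (sin y) = sin (Rabs y)).
  { destruct (Rle_lt_dec 0 y) as [H|H].
    - rewrite (Rabs_pos_eq y) in * by exact H. apply Rabs_pos_eq. apply sin_ge_0; lra.
    - rewrite (Rabs_left y) in * by exact H. rewrite sin_neg. apply Rabs_left1.
      assert (0 <= sin (- y)) by (apply sin_ge_0; lra). rewrite sin_neg in H0. lra. }
  rewrite E. apply sin_incr_1; lra.
Qed.

Lemma sin_pos_1 (k : R) : 0 < k <= 1 -> 0 < sin k.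
Proof. intros H. generalize PI2_1. intro. apply sin_gt_0; lra. Qed.

Lemma cos_pos_1 (y : R) : Rabs y <= 1 -> 0 <= cos y.
Proof.
  intros H. apply Rabs_le_between in H. generalize PI2_1. intro. apply cos_ge_0; lra.
Qed.

Lemma Cmod_polar (r x : R) : 0 <= r -> Cmod (polar r x) = r.
Proof. intros H. unfold polar. rewrite Cmod_mult, Cmod_cis, Cmod_R, Rabs_pos_eq by exact H. ring. Qed.

Lemma exp_le (x y : R) : x <= y -> exp x <= exp y.
Proof. intros [H| ->]; [left; now apply exp_increasing|lra]. Qed.

Lemma exp_bounded_plus k E f g : exp_bounded k E f -> exp_bounded k E g ->
  exp_bounded k E (fun s => (f s + g s)%C).
Proof.
  intros (A1 & A2 & P1 & P2 & HA) (B1 & B2 & Q1 & Q2 & HB).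
  exists (A1 + B1), (A2 + B2). repeat split; try lra.
  intros z Hz. specialize (HA z Hz). specialize (HB z Hz).
  assert (M : 0 <= Cmod z ^ k) by apply pow_le, Cmod_ge_0.
  eapply Rle_trans; [apply Cmod_triangle|].
  assert (E1 : exp (A2 * Cmod z ^ k) <= exp ((A2 + B2) * Cmod z ^ k)).
  { apply exp_le. nra. }
  assert (E2 : exp (B2 * Cmod z ^ k) <= exp ((A2 + B2) * Cmod z ^ k)).
  { apply exp_le. nra. }
  nra.
Qed.

Lemma exp_bounded_scal k E f c : exp_bounded k E f -> exp_bounded k E (fun s => (c * f s)%C).
Proof.
  intros (A1 & A2 & P1 & P2 & HA).
  assert (L := Cmod_ge_0 c).
  exists ((Cmod c + 1) * A1), A2. repeat split; try lra. { apply Rmult_lt_0_compat; lra. }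
  intros z Hz. specialize (HA z Hz). rewrite Cmod_mult, Rmult_assoc.
  assert (L2 := Cmod_ge_0 (f z)).
  apply Rmult_le_compat; lra.
Qed.

Lemma exp_bounded_const_bound k E f M : (forall s, E s -> Cmod (f s) <= M) -> exp_bounded k E f.
Proof.
  intros H. exists (Rabs M + 1), 1. assert (L := Rabs_pos M). repeat split; try lra.
  intros z Hz. specialize (H z Hz). assert (L2 := Rle_abs M).
  assert (E1 : 1 <= exp (1 * Cmod z ^ k)).
  { rewrite <- exp_0 at 1. apply exp_le. apply Rmult_le_pos; [lra|]. apply pow_le, Cmod_ge_0. }
  nra.
Qed.

Lemma Cmod_sqr_sum (z s : C) : Cmod (z + s) ^ 2 <= 2 * Cmod z ^ 2 + 2 * Cmod s ^ 2.
Proof.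
  assert (T := Cmod_triangle z s). assert (0 <= Cmod (z + s)) by apply Cmod_ge_0.
  assert (Cmod (z + s) ^ 2 <= (Cmod z + Cmod s) ^ 2) by (apply pow_incr; lra).
  generalize (pow2_ge_0 (Cmod z - Cmod s)). nra.
Qed.

(** Translation by [z] doubles the rate of growth, because |z+s|^2 <= 2|z|^2 + 2|s|^2. This is the
    origin of the rate [2 * A2] in all later bounds. *)
Lemma exp_shift (A1 A2 : R) (z s w : C) : 0 < A1 -> 0 < A2 -> Cmod w <= Cmod (z + s) ->
  A1 * exp (A2 * Cmod w ^ 2) <= A1 * exp (2 * A2 * Cmod z ^ 2) * exp (2 * A2 * Cmod s ^ 2).
Proof.
  intros H1 H2 Hw. rewrite Rmult_assoc, <- exp_plus. apply Rmult_le_compat_l; [lra|].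
  apply exp_le. generalize (Cmod_sqr_sum z s).
  assert (Cmod w ^ 2 <= Cmod (z + s) ^ 2) by (apply pow_incr; split; [apply Cmod_ge_0|exact Hw]).
  intro Q. apply Rle_trans with (A2 * (2 * Cmod z ^ 2 + 2 * Cmod s ^ 2)); [|lra].
  apply Rmult_le_compat_l; lra.
Qed.

Lemma exp_bounded_shift (E E' : C -> Prop) f z : exp_bounded 2 E f -> (forall s, E' s -> E (z + s)%C) ->
  exp_bounded 2 E' (fun s => f (z + s)%C).
Proof.
  intros (A1 & A2 & P1 & P2 & HA) H.
  exists (A1 * exp (2 * A2 * Cmod z ^ 2)), (2 * A2). repeat split; try lra.
  { apply Rmult_lt_0_compat; [lra|apply exp_pos]. }
  intros s Hs. eapply Rle_trans; [apply HA; auto|]. apply exp_shift; lra.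
Qed.

Lemma exp_bounded_reflect (E E' : C -> Prop) f z : exp_bounded 2 E f -> (forall s, E' s -> E (z - s)%C) ->
  exp_bounded 2 E' (fun s => f (z - s)%C).
Proof.
  intros (A1 & A2 & P1 & P2 & HA) H.
  exists (A1 * exp (2 * A2 * Cmod z ^ 2)), (2 * A2). repeat split; try lra.
  { apply Rmult_lt_0_compat; [lra|apply exp_pos]. }
  intros s Hs. eapply Rle_trans; [apply HA; auto|].
  rewrite <- (Cmod_opp s). apply exp_shift; [lra|lra|apply Rle_refl].
Qed.

(* The constant [A2] is uniform in [rho], so that the radius [r] of the theorem
   can be fixed before [z] and the two directions. *)
Lemma punctured_growth (z0 : C) (phi : C -> C) : O_punctured 2 z0 phi ->
  exists A2, 0 < A2 /\ forall rho, 0 < rho -> exists A1, 0 < A1 /\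
    forall s, rho <= Cmod (s - z0) -> Cmod (phi s) <= A1 * exp (A2 * Cmod s ^ 2).
Proof.
  intros [_ H]. destruct (H 1 Rlt_0_1) as (A1 & A2 & P1 & P2 & HA).
  exists A2. split; [exact P2|]. intros rho Hr.
  destruct (H rho Hr) as (B1 & B2 & Q1 & Q2 & HB).
  set (M := B1 * exp (B2 * (Cmod z0 + 1) ^ 2)).
  assert (HM : 0 < M) by (apply Rmult_lt_0_compat; [exact Q1|apply exp_pos]).
  exists (A1 + M). split; [lra|]. intros s Hs.
  assert (N := Cmod_ge_0 s).
  assert (E1 : 1 <= exp (A2 * Cmod s ^ 2)).
  { rewrite <- exp_0 at 1. apply exp_le. apply Rmult_le_pos; [lra|apply pow2_ge_0]. }
  destruct (Rle_lt_dec 1 (Cmod (s - z0))) as [L|L].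
  - specialize (HA s L). nra.
  - specialize (HB s Hs).
    assert (T : Cmod s <= Cmod z0 + 1) by (generalize (Cmod_sub_ge s z0); lra).
    assert (Cmod (phi s) <= M).
    { eapply Rle_trans; [exact HB|]. unfold M. apply Rmult_le_compat_l; [lra|].
      apply exp_le. apply Rmult_le_compat_l; [lra|]. apply pow_incr. lra. }
    nra.
Qed.

(** Convergence at a single point at distance k/2 from z0 bounds |a_n| (2/k)^n. At distance at least
    k the terms are then geometric with ratio 1/2, uniformly. *)
Lemma laurent_tail (z0 : C) (a : nat -> C) (P : C -> C) :
  (forall z, z <> z0 -> Cseries
     (fun n => (a (S n) / (z - z0) ^ S n)%C) (P z)) ->
  forall k, 0 < k -> exists M, 0 <= M /\ forall s, k <= Cmod (s - z0) ->
    (forall n, Cmod (a (S n) / (s - z0) ^ S n)%C <= M / 2 ^ S n) /\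
    forall n, Cmod (Csum (fun m => (a (S m) / (s - z0) ^ S m)%C) n - P s) <= M / 2 ^ S n.
Proof.
  intros H k Hk.
  set (w := (z0 + RtoC (k / 2))%C).
  assert (Ew : (w - z0)%C = RtoC (k / 2)) by (unfold w; ring).
  assert (Nw : w <> z0).
  { intro E. apply (RtoC_neq_0 (k / 2)); [lra|]. rewrite <- Ew, E. ring. }
  destruct (series_terms_bounded _ _ (H w Nw)) as [M [HM HB]].
  exists M. split; [lra|]. intros s Hs.
  assert (Ns : (s - z0)%C <> RtoC 0) by (apply Cmod_gt_0; lra).
  assert (T : forall n, Cmod (a (S n) / (s - z0) ^ S n)%C <= M / 2 ^ S n).
  { intro n. specialize (HB n). rewrite Ew in HB.
    rewrite Cmod_div in HB by (apply Cpow_nz, RtoC_neq_0; lra).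
    rewrite Cmod_div by now apply Cpow_nz.
    rewrite Cmod_pow, Cmod_R, Rabs_pos_eq in HB by lra. rewrite Cmod_pow.
    assert (P1 : 0 < (k / 2) ^ S n) by (apply pow_lt; lra).
    assert (P2 : 0 < 2 ^ S n) by (apply pow_lt; lra).
    assert (P3 : k ^ S n <= Cmod (s - z0) ^ S n) by (apply pow_incr; lra).
    assert (P4 : 0 < k ^ S n) by (apply pow_lt; lra).
    apply Rle_div_l in HB; [|exact P1].
    apply Rle_div_l; [lra|].
    eapply Rle_trans; [exact HB|].
    replace (M * (k / 2) ^ S n) with (M / 2 ^ S n * k ^ S n).
    - apply Rmult_le_compat_l; [|exact P3]. left. apply Rdiv_lt_0_compat; lra.
    - unfold Rdiv. rewrite Rpow_mult_distr, pow_inv. ring. }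
  split; [exact T|]. apply geom_tail; [exact T|]. apply H.
  intros E. apply Ns. rewrite E. ring.
Qed.

Lemma polar_away (r x beta w k : R) : 0 <= beta -> 0 <= k <= Rabs (x - w) -> Rabs (x - w) <= 1 ->
  beta * sin k <= Cmod (polar r x - polar beta w) /\ beta * sin k <= Cmod (polar r x + polar beta w).
Proof.
  intros Hb Hk H1.
  assert (S : sin k <= Rabs (sin (x - w))) by (apply sin_abs_ge; lra).
  assert (S0 : 0 <= sin k) by (generalize PI2_1; intro; apply sin_ge_0; lra).
  split; [apply polar_dist_sin|apply polar_sum_sin]; lra.
Qed.

Lemma disc_away (s b : C) (beta : R) : Cmod b = beta -> Cmod s < beta / 2 ->
  beta / 2 <= Cmod (s - b) /\ beta / 2 <= Cmod (s + b).
Proof.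
  intros Hb Hs. split.
  - rewrite Cmod_sub_sym. generalize (Cmod_sub_ge b s). lra.
  - generalize (Cmod_sub_ge b (- s)%C). rewrite Cmod_opp.
    replace (b - - s)%C with (s + b)%C by ring. lra.
Qed.

(** * Distance of the slit sector from b and -b, the two singularities of F *)

Section Slit.

Variables (theta alpha w beta : R).
Hypothesis Hbeta : 0 < beta.
Hypothesis Halpha : 2 * Rabs (w - theta) < alpha < 1.

Let b : C := polar beta w.

Lemma opening_near (x : R) : opening theta alpha x -> Rabs (x - w) <= 1.
Proof.
  unfold opening. intros H. replace (x - w) with ((x - theta) - (w - theta)) by ring.
  eapply Rle_trans; [apply Rabs_triang|]. rewrite Rabs_Ropp. lra.
Qed.

Lemma slit_away (s : C) : disc_rays (slit_opening theta alpha w) (beta / 2) s ->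
  0 < Cmod (s - b) /\ 0 < Cmod (s + b).
Proof.
  assert (Hb : Cmod b = beta) by (apply Cmod_polar; lra).
  intros [H|(r & x & Hr & [Hx Hn] & ->)].
  - destruct (disc_away s b beta Hb H). lra.
  - assert (K : 0 < Rabs (x - w)) by (apply Rabs_pos_lt; lra).
    assert (K1 := opening_near x Hx).
    destruct (polar_away r x beta w (Rabs (x - w))) as [A B]; try lra.
    assert (0 < beta * sin (Rabs (x - w))) by (apply Rmult_lt_0_compat; [lra|apply sin_pos_1; lra]).
    fold b in A, B. lra.
Qed.

Lemma slit_away_uniform (l u rho : R) : 0 < rho < beta / 2 ->
  (forall x, closed_itv l u x -> slit_opening theta alpha w x) ->
  exists k, 0 < k /\ forall s, disc_rays (closed_itv l u) rho s ->
    k <= Cmod (s - b) /\ k <= Cmod (s + b).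
Proof.
  intros Hrho HI.
  assert (Hb : Cmod b = beta) by (apply Cmod_polar; lra).
  assert (D : forall s, Cmod s < rho -> beta / 2 <= Cmod (s - b) /\ beta / 2 <= Cmod (s + b)).
  { intros s Hs. apply disc_away; lra. }
  (* For u < l there are no rays and the disc alone remains. Otherwise the interval avoids [w], so
     it lies on one side of it, at a distance attained at an endpoint. *)
  destruct (Rlt_le_dec u l) as [Hul|Hlu].
  - exists (beta / 2). split; [lra|]. intros s [Hs|(r & x & _ & Hx & _)]; [auto|].
    unfold closed_itv in Hx. lra.
  - assert (Hw : w < l \/ u < w).
    { destruct (Rlt_le_dec w l) as [|H1]; [now left|]. destruct (Rlt_le_dec u w) as [|H2]; [now right|].
      destruct (HI w (conj H1 H2)) as [_ Hn]. now elim Hn. }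
    assert (K : exists k, 0 < k <= 1 /\ forall x, closed_itv l u x -> k <= Rabs (x - w)).
    { destruct (HI l (conj (Rle_refl l) Hlu)) as [Ol _]. destruct (HI u (conj Hlu (Rle_refl u))) as [Ou _].
      apply opening_near in Ol. apply opening_near in Ou. destruct Hw as [Hw|Hw].
      - exists (l - w). rewrite Rabs_pos_eq in Ol by lra. split; [lra|].
        unfold closed_itv. intros x Hx. rewrite Rabs_pos_eq; lra.
      - exists (w - u). rewrite Rabs_left in Ou by lra. split; [lra|].
        unfold closed_itv. intros x Hx. rewrite Rabs_left; lra. }
    destruct K as [k [Hk HK]]. assert (S := sin_pos_1 k Hk).
    exists (Rmin (beta / 2) (beta * sin k)). split. { apply Rmin_pos; [lra|now apply Rmult_lt_0_compat]. }
    intros s [Hs|(r & x & Hr & Hx & ->)].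
    + destruct (D s Hs). split; (eapply Rle_trans; [apply Rmin_l|assumption]).
    + destruct (polar_away r x beta w k) as [A B]; [lra|split; [lra|now apply HK]| |].
      { apply opening_near. now apply HI. }
      split; (eapply Rle_trans; [apply Rmin_r|assumption]).
Qed.

(** The point -b lies opposite to the sector, so phi(z-s) stays regular across the slit. *)
Lemma opening_away (s : C) : disc_rays (opening theta alpha) (beta / 2) s -> beta / 2 <= Cmod (s + b).
Proof.
  assert (Hb : Cmod b = beta) by (apply Cmod_polar; lra).
  intros [H|(r & x & Hr & Hx & ->)].
  - now destruct (disc_away s b beta Hb H).
  - apply Rle_trans with beta; [lra|]. apply polar_sum_cos; try lra.
    apply cos_pos_1. now apply opening_near.
Qed.

End Slit.

Lemma hol_at_shift f z s : hol_at f (z + s)%C -> hol_at (fun s => f (z + s)%C) s.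
Proof.
  intros H. apply (hol_at_comp f (fun s => (z + s)%C)); [exact H|].
  apply hol_at_plus; [apply hol_at_const|apply hol_at_id].
Qed.

Lemma hol_at_reflect f z s : hol_at f (z - s)%C -> hol_at (fun s => f (z - s)%C) s.
Proof.
  intros H. apply (hol_at_comp f (fun s => (z - s)%C)); [exact H|].
  apply hol_at_minus; [apply hol_at_const|apply hol_at_id].
Qed.

Lemma disc_rays_sub (I J : R -> Prop) (rho rho' : R) s : rho' <= rho -> (forall x, I x -> J x) ->
  disc_rays I rho' s -> disc_rays J rho s.
Proof.
  intros Hr HI [H|(r & x & Hr' & Hx & E)]; [left; lra|right]. exists r, x. auto.
Qed.

(** * Closed form of the derivatives of the Dirac function *)

Definition dirac_const (n : nat) : C := (- ((- (1)) ^ n * INR (fact n) / (2 * PI * Ci)))%C.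

Lemma dirac_eq (n : nat) (b : C) : forall s, s <> b ->
  dirac n b s = (dirac_const n * (/ (s - b)) ^ S n)%C.
Proof.
  assert (N := two_pi_i_neq_0). unfold dirac, dirac_const. set (w := (2 * PI * Ci)%C) in *.
  induction n as [|n IH]; intros s Hs; assert (Hs' := minus_neq_0 s b Hs).
  - simpl. field. auto.
  - change (C_derive (C_derive_n (fun s => (- (1 / (w * (s - b))))%C) n) s =
      (- ((- (1)) ^ S n * INR (fact (S n)) / w) * (/ (s - b)) ^ S (S n))%C).
    apply is_C_derive_unique.
    apply (C_diff_ext_loc (fun s => (- ((- (1)) ^ n * INR (fact n) / w) * (/ (s - b)) ^ S n)%C) _ _ _ (Cmod (s - b))).
    + now apply Cmod_gt_0.
    + intros y Hy. symmetry. apply IH. intros ->. rewrite Cmod_sub_sym in Hy. lra.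
    + replace (- ((- (1)) ^ S n * INR (fact (S n)) / w) * (/ (s - b)) ^ S (S n))%C with
        (- ((- (1)) ^ n * INR (fact n) / w) *
          (RtoC (INR (S n)) * (/ (s - b)) ^ pred (S n) * (- / ((s - b) * (s - b)) * (1 - 0))))%C.
      * apply C_diff_scal. apply (C_diff_pow (fun s => (/ (s - b))%C)).
        apply (C_diff_comp Cinv (fun s => (s - b)%C)); [now apply C_diff_inv|].
        apply C_diff_minus; [apply C_diff_id|apply C_diff_const].
      * rewrite fact_simpl, mult_INR, RtoC_mult. simpl pred. rewrite !Cpow_S. field. auto.
Qed.

(** ** The hyperfunction *)

Lemma hyper_part (z0 z : C) (phi phi0 : C -> C) (a : nat -> C) (theta alpha w beta : R) :
  O_punctured 2 z0 phi -> O_entire 2 phi0 ->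
  (forall z : C, z <> z0 -> Cseries
        (fun n => (a (S n) / (z - z0) ^ (S n))%C) (phi z - phi0 z)%C) ->
  0 < beta -> 2 * Rabs (w - theta) < alpha < 1 -> (z0 - z)%C = polar beta w ->
  let F := fun s : C => (phi (z + s) + phi (z - s))%C in
  (exists P : C -> C,
    (forall s : C, s <> (z0 - z)%C ->
      Cseries
        (fun n => (a (S n) / (z + s - z0) ^ (S n))%C) (P s)) /\
    hyper_eq 2 theta alpha w F P) /\
  (exists Q : C -> C,
    hyper_series 2 theta alpha w
      (fun n s => (jump_coef a n * dirac n (z0 - z) s)%C) Q /\
    hyper_eq 2 theta alpha w F
      (fun s => (- (2 * PI * Ci) * Q s)%C)).
Proof.
  intros [Hol Hgr] [Hol0 Hgr0] Hform Hbeta Ha Eb F.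
  set (b := (z0 - z)%C) in *.
  assert (Sm : forall s, (z + s - z0)%C = (s - b)%C) by (intro; unfold b; ring).
  assert (Sp : forall s, Cmod (z - s - z0) = Cmod (s + b)).
  { intro s. rewrite <- Cmod_opp. f_equal. unfold b. ring. }
  (* The sum of the Laurent series is represented by this difference, so that its holomorphy and
     growth are inherited from phi and phi0. *)
  set (P := fun s => (phi (z + s) - phi0 (z + s))%C).
  assert (HP : forall s, s <> b -> Cseries
        (fun n => (a (S n) / (z + s - z0) ^ (S n))%C) (P s)).
  { intros s Hs. apply Hform. intro E. apply (minus_neq_0 s b Hs). rewrite <- Sm, E. ring. }
  assert (Away : forall s, disc_rays (slit_opening theta alpha w) (beta / 2) s ->
    0 < Cmod (s - b) /\ 0 < Cmod (s + b)) by (rewrite Eb; intros s Hs; now apply (slit_away theta alpha)).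
  assert (Unif : forall l u rho, 0 < rho < beta / 2 ->
    (forall x, closed_itv l u x -> slit_opening theta alpha w x) ->
    exists k, 0 < k /\ forall s, disc_rays (closed_itv l u) rho s ->
      k <= Cmod (s - b) /\ k <= Cmod (s + b))
    by (rewrite Eb; intros; now apply (slit_away_uniform theta alpha)).
  assert (Op : forall s, disc_rays (opening theta alpha) (beta / 2) s -> beta / 2 <= Cmod (s + b))
    by (rewrite Eb; intros; now apply (opening_away theta alpha)).
  assert (Hp : forall s, 0 < Cmod (s - b) -> hol_at (fun s => phi (z + s)%C) s).
  { intros s Hs. apply hol_at_shift. apply Hol. intros E. rewrite <- Sm, E in Hs.
    replace (z0 - z0)%C with (RtoC 0) in Hs by ring. rewrite Cmod_0 in Hs. lra. }
  assert (Hm : forall s, 0 < Cmod (s + b) -> hol_at (fun s => phi (z - s)%C) s).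
  { intros s Hs. apply hol_at_reflect. apply Hol. intros E. rewrite <- Sp, E in Hs.
    replace (z0 - z0)%C with (RtoC 0) in Hs by ring. rewrite Cmod_0 in Hs. lra. }
  assert (H0 : forall s, hol_at (fun s => phi0 (z + s)%C) s).
  { intros s. apply hol_at_shift. now apply Hol0. }
  assert (B0 : forall E, exp_bounded 2 E (fun s => phi0 (z + s)%C)).
  { intro E. now apply (exp_bounded_shift (fun _ => True)). }
  assert (Bp : forall k (E : C -> Prop), 0 < k -> (forall s, E s -> k <= Cmod (s - b)) ->
     exp_bounded 2 E (fun s => phi (z + s)%C)).
  { intros k E Hk HE. apply (exp_bounded_shift (fun s => k <= Cmod (s - z0)) E phi z (Hgr k Hk)).
    intros s Hs. rewrite Sm. auto. }
  assert (Bm : forall k (E : C -> Prop), 0 < k -> (forall s, E s -> k <= Cmod (s + b)) ->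
     exp_bounded 2 E (fun s => phi (z - s)%C)).
  { intros k E Hk HE. apply (exp_bounded_reflect (fun s => k <= Cmod (s - z0)) E phi z (Hgr k Hk)).
    intros s Hs. rewrite Sp. auto. }
  assert (OF : O_rays 2 (slit_opening theta alpha w) (beta / 2) F).
  { split.
    - intros s Hs. destruct (Away s Hs). apply hol_at_plus; auto.
    - intros l u rho Hrho HI. destruct (Unif l u rho Hrho HI) as [k [Hk HK]].
      apply exp_bounded_plus; [apply (Bp k)|apply (Bm k)]; trivial; intros s Hs; now apply HK. }
  assert (OP : O_rays 2 (slit_opening theta alpha w) (beta / 2) P).
  { split.
    - intros s Hs. destruct (Away s Hs). apply hol_at_minus; auto.
    - intros l u rho Hrho HI. destruct (Unif l u rho Hrho HI) as [k [Hk HK]].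
      replace P with (fun s => (phi (z + s) + (- (1)) * phi0 (z + s))%C).
      + apply exp_bounded_plus; [apply (Bp k); trivial; intros s Hs; now apply HK|].
        apply exp_bounded_scal, B0.
      + apply functional_extensionality. intro s. unfold P. ring. }
  assert (HE : hyper_eq 2 theta alpha w F P).
  { exists (beta / 2). split; [lra|]. split; [exact OF|]. split; [exact OP|].
    exists (fun s => (phi0 (z + s) + phi (z - s))%C). split.
    - split.
      + intros s Hs. apply hol_at_plus; auto. apply Hm. specialize (Op s Hs). lra.
      + intros l u rho Hrho HI. apply exp_bounded_plus; [apply B0|].
        apply (Bm (beta / 2)); [lra|]. intros s Hs. apply Op.
        apply (disc_rays_sub (closed_itv l u) (opening theta alpha) (beta / 2) rho); trivial. lra.
    - intros s _. unfold F, P. ring. }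
  split; [now exists P|].
  assert (N := two_pi_i_neq_0).
  (* In [jump_coef a n * dirac n b] the factorials and the two signs (-1)^n cancel, leaving -1/(2 PI
     i) times the Laurent term; [Q] is the corresponding multiple of [P]. *)
  set (Q := fun s => (- / (2 * PI * Ci) * P s)%C).
  exists Q. split.
  2:{ replace (fun s => (- (2 * PI * Ci) * Q s)%C) with P; [exact HE|].
      apply functional_extensionality. intro s. unfold Q. set (v := (2 * PI * Ci)%C) in *. field. exact N. }
  assert (ET : forall n s, s <> b -> (jump_coef a n * dirac n b s)%C =
    (- / (2 * PI * Ci) * (a (S n) / (z + s - z0) ^ S n))%C).
  { intros n s Hs. rewrite dirac_eq by exact Hs. rewrite Sm. assert (Hs' := minus_neq_0 s b Hs).
    unfold jump_coef, dirac_const.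
    assert (N2 : RtoC (INR (fact n)) <> RtoC 0) by apply RtoC_neq_0, INR_fact_neq_0.
    assert (N3 : ((- (1)) ^ n * (- (1)) ^ n = 1)%C).
    { rewrite <- Cpow_mult_l. replace (- (1) * - (1))%C with (RtoC 1) by ring. apply Cpow_1_l. }
    set (v := (2 * PI * Ci)%C) in *. set (f := RtoC (INR (fact n))) in *. set (e := ((- (1)) ^ n)%C) in *.
    assert (N4 := Cpow_nz (s - b) (S n) Hs').
    rewrite Cpow_inv by exact Hs'. set (y := ((s - b) ^ S n)%C) in *.
    replace (a (S n) * e / f * (- (e * f / v) * / y))%C with (- (e * e) * a (S n) / v / y)%C by (field; auto).
    rewrite N3. field. auto. }
  assert (Nb : forall s, 0 < Cmod (s - b) -> s <> b).
  { intros s Hs ->. replace (b - b)%C with (RtoC 0) in Hs by ring. rewrite Cmod_0 in Hs. lra. }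
  exists (beta / 2). split; [lra|]. split; [|split].
  - intros n. split.
    + intros s Hs. destruct (Away s Hs) as [A _]. assert (Hs' := Nb s A).
      assert (HH : hol_at (fun s => (jump_coef a n * (dirac_const n * (/ (s - b)) ^ S n))%C) s).
      { apply hol_at_mult; [apply hol_at_const|]. apply hol_at_mult; [apply hol_at_const|].
        apply (hol_at_pow (fun s => (/ (s - b))%C)). now apply hol_at_inv_sub. }
      destruct HH as [l Hl]. exists l.
      apply (C_diff_ext_loc (fun s => (jump_coef a n * (dirac_const n * (/ (s - b)) ^ S n))%C) _ s l (Cmod (s - b))); [exact A| |exact Hl].
      intros y Hy. rewrite dirac_eq; [reflexivity|]. intros ->. rewrite Cmod_sub_sym in Hy. lra.
    + intros l u rho Hrho HI. destruct (Unif l u rho Hrho HI) as [k [Hk HK]].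
      apply (exp_bounded_const_bound 2 _ _ (Cmod (jump_coef a n) * (Cmod (dirac_const n) * (/ k) ^ S n))).
      intros s Hs. destruct (HK s Hs) as [A _].
      assert (Hs' : s <> b) by (apply Nb; lra).
      rewrite dirac_eq by exact Hs'.
      rewrite !Cmod_mult, Cmod_pow, Cmod_inv by now apply minus_neq_0.
      apply Rmult_le_compat_l; [apply Cmod_ge_0|]. apply Rmult_le_compat_l; [apply Cmod_ge_0|].
      apply pow_incr. split; [left; apply Rinv_0_lt_compat; lra|]. apply Rinv_le_contravar; lra.
  - split.
    + intros s Hs. apply hol_at_mult; [apply hol_at_const|]. now apply OP.
    + intros l u rho Hrho HI. apply exp_bounded_scal. now apply OP.
  - intros l u rho Hrho HI. destruct (Unif l u rho Hrho HI) as [k [Hk HK]].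
    (* Convergence is uniform on the set considered, and the weight exp(|s|^2) is at least 1, so c =
       1 does. *)
    exists 1. split; [lra|]. intros eps He.
    destruct (laurent_tail z0 a _ Hform k Hk) as [M [HM HT]].
    set (c := Cmod (- / (2 * PI * Ci))). assert (Hc : 0 <= c) by apply Cmod_ge_0.
    destruct (geom_eventually_small (c * M) eps He) as [n0 Hn0].
    exists n0. intros n Hn s Hs. destruct (HK s Hs) as [A _].
    rewrite <- Sm in A. destruct (HT _ A) as [_ T]. specialize (T n).
    assert (Hs' : s <> b).
    { apply Nb. rewrite <- Sm. lra. }
    assert (E : @eq C (Csum (fun m => (jump_coef a m * dirac m b s)%C) n)
      (- / (2 * PI * Ci) * Csum (fun m => (a (S m) / (z + s - z0) ^ S m)%C) n)%C).
    { clear T Hn. induction n as [|n IH].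
      - rewrite !Csum_O. now apply ET.
      - rewrite !Csum_S, IH, ET by exact Hs'. ring. }
    match goal with |- Cmod ?x <= _ => replace x with
      (- / (2 * PI * Ci) * (Csum (fun m => (a (S m) / (z + s - z0) ^ S m)%C) n - P s))%C end.
    2:{ unfold Q. etransitivity; [|apply (f_equal (fun x => (x - _)%C) (eq_sym E))]. ring. }
    rewrite Cmod_mult. fold c.
    apply Rle_trans with (c * (M / 2 ^ S n)). { apply Rmult_le_compat_l; [exact Hc|]. exact T. }
    specialize (Hn0 (S n) ltac:(lia)).
    assert (E1 : 1 <= exp (1 * Cmod s ^ 2)).
    { rewrite <- exp_0 at 1. apply exp_le. apply Rmult_le_pos; [lra|apply pow2_ge_0]. }
    replace (c * (M / 2 ^ S n)) with (c * M / 2 ^ S n) by (unfold Rdiv; ring). nra.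
Qed.

(** ** The Borel transform *)

(** The heat equation makes n! u_n the 2n-th derivative of phi near 0. Interleaving these with n!
    u_n' gives all derivatives, where the factor n+1 of the recursion turns n! into (n+1)!. *)
Lemma heat_family (phi : C -> C) (u : nat -> C -> C) (rho : R) :
  (forall z, Cmod z < rho -> u O z = phi z) ->
  (forall n, exists u', forall z, Cmod z < rho ->
      C_diff (u n) z (u' z) /\ C_diff u' z (RtoC (INR (S n)) * u (S n) z)%C) ->
  exists f : nat -> C -> C, smooth_on (fun z => Cmod z < rho) f /\
    (forall z, Cmod z < rho -> f 0%nat z = phi z) /\
    forall n z, f (2 * n)%nat z = (INR (fact n) * u n z)%C.
Proof.
  intros H0 Hu.
  (* The derivative of each [u n] is only known to exist, so a sequence of them has to be chosen. *)
  set (v := fun n => proj1_sig (constructive_indefinite_description _ (Hu n))).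
  assert (Hv : forall n z, Cmod z < rho ->
    C_diff (u n) z (v n z) /\ C_diff (v n) z (RtoC (INR (S n)) * u (S n) z)%C).
  { intro n. unfold v. destruct constructive_indefinite_description as [v' Hv']. exact Hv'. }
  set (f := fun (n : nat) (z : C) => (INR (fact (Nat.div2 n)) * if Nat.even n then u (Nat.div2 n) z else v (Nat.div2 n) z)%C).
  assert (Fe : forall n z, f (2 * n)%nat z = (INR (fact n) * u n z)%C).
  { intros n z. unfold f. rewrite Nat.div2_double, Nat.even_mul. reflexivity. }
  assert (Fo : forall n z, f (S (2 * n))%nat z = (INR (fact n) * v n z)%C).
  { intros n z. unfold f. rewrite Nat.div2_succ_double, Nat.even_succ, <- Nat.negb_even, Nat.even_mul. reflexivity. }
  assert (Fe' : forall n, f (2 * n)%nat = fun z => (INR (fact n) * u n z)%C).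
  { intro n. apply functional_extensionality. apply Fe. }
  assert (Fo' : forall n, f (S (2 * n))%nat = fun z => (INR (fact n) * v n z)%C).
  { intro n. apply functional_extensionality. apply Fo. }
  exists f. split; [|split].
  - intros n z Hz. destruct (Nat.Even_or_Odd n) as [[k ->]|[k ->]].
    + rewrite Fe', Fo'. apply C_diff_scal. now apply Hv.
    + replace (2 * k + 1)%nat with (S (2 * k)) by lia.
      replace (S (S (2 * k))) with (2 * S k)%nat by lia. rewrite Fo', Fe'.
      replace (INR (fact (S k)) * u (S k) z)%C with (INR (fact k) * (INR (S k) * u (S k) z))%C.
      * apply C_diff_scal. now apply Hv.
      * rewrite fact_simpl, mult_INR, RtoC_mult. ring.
  - intros z Hz. change 0%nat with (2 * 0)%nat. rewrite Fe. simpl. rewrite H0 by exact Hz. ring.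
  - exact Fe.
Qed.

Lemma polar_sqr (r x : R) : (polar r x ^ 2)%C = polar (r ^ 2) (2 * x).
Proof.
  unfold polar. replace (2 * x) with (x + x) by ring. rewrite cis_plus, RtoC_pow. ring.
Qed.

Definition sym (phi : C -> C) (z s : C) : C := (phi (z + s) + phi (z - s))%C.

Lemma even_sym phi z : even (sym phi z).
Proof.
  intro s. unfold sym. replace (z - - s)%C with (z + s)%C by ring.
  replace (z + - s)%C with (z - s)%C by ring. ring.
Qed.

Lemma sym_dist (z0 z s : C) :
  Cmod (z + s - z0) = Cmod (s - (z0 - z)) /\ Cmod (z - s - z0) = Cmod (s + (z0 - z)).
Proof.
  split.
  - f_equal. ring.
  - rewrite <- Cmod_opp. f_equal. ring.
Qed.

Lemma hol_at_sym phi z0 z s : holomorphic_on (fun z => z <> z0) phi ->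
  0 < Cmod (s - (z0 - z)) -> 0 < Cmod (s + (z0 - z)) -> hol_at (sym phi z) s.
Proof.
  intros H H1 H2. destruct (sym_dist z0 z s) as [E1 E2]. rewrite <- E1 in H1. rewrite <- E2 in H2.
  assert (N : forall y, 0 < Cmod (y - z0) -> y <> z0).
  { intros y Hy ->. replace (z0 - z0)%C with (RtoC 0) in Hy by ring. rewrite Cmod_0 in Hy. lra. }
  unfold sym. apply hol_at_plus; [apply hol_at_shift|apply hol_at_reflect]; apply H; now apply N.
Qed.

(** Only the factor [B] depends on [z] and on the distance [k]; the rate does not, as the radius of
    the sector is fixed before them. *)
Lemma sym_growth phi z0 (A2 : R) : 0 < A2 ->
  (forall rho, 0 < rho -> exists A1, 0 < A1 /\
    forall s, rho <= Cmod (s - z0) -> Cmod (phi s) <= A1 * exp (A2 * Cmod s ^ 2)) ->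
  forall z k, 0 < k -> exists B, 0 < B /\ forall s, k <= Cmod (s - (z0 - z)) -> k <= Cmod (s + (z0 - z)) ->
    Cmod (sym phi z s) <= B * exp (2 * A2 * Cmod s ^ 2).
Proof.
  intros H2 H z k Hk. destruct (H k Hk) as [A1 [H1 HA]].
  exists (2 * (A1 * exp (2 * A2 * Cmod z ^ 2))). split.
  { assert (0 < A1 * exp (2 * A2 * Cmod z ^ 2)) by (apply Rmult_lt_0_compat; [lra|apply exp_pos]). lra. }
  intros s K1 K2. destruct (sym_dist z0 z s) as [E1 E2]. rewrite <- E1 in K1. rewrite <- E2 in K2.
  unfold sym. eapply Rle_trans; [apply Cmod_triangle|].
  assert (T1 := HA _ K1). assert (T2 := HA _ K2).
  assert (S1 := exp_shift A1 A2 z s (z + s)%C H1 H2 (Rle_refl _)).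
  assert (S2 := exp_shift A1 A2 z (- s)%C (z - s)%C H1 H2 (Rle_refl _)). rewrite Cmod_opp in S2.
  lra.
Qed.

(** Here [r] is an argument. If it is within k of d, then its half is within k/2 of d/2, which is 2k
    away from w; a margin of k remains. The estimate covers both roots [v], because the root chosen
    by [Csqrt] is unknown. *)
Lemma sqrt_away (d w beta k : R) : 0 < beta -> 0 < k -> 2 * k = Rabs (d / 2 - w) -> 2 * k <= 1 / 2 ->
  forall v r, Cmod v < beta / 2 \/ opening d (2 * k) r /\ (exists q, 0 < q /\ (v ^ 2)%C = polar q r) ->
  Rmin (beta / 2) (beta * sin k) <= Cmod (v - polar beta w) /\
  Rmin (beta / 2) (beta * sin k) <= Cmod (v + polar beta w).
Proof.
  intros Hb Hk E Hk1 v r H.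
  assert (Hbm : Cmod (polar beta w) = beta) by (apply Cmod_polar; lra).
  destruct H as [H|[Hr [q [Hq Hv]]]].
  - destruct (disc_away v _ beta Hbm H). split; (eapply Rle_trans; [apply Rmin_l|assumption]).
  - assert (A : beta * sin k <= Cmod (polar (sqrt q) (r / 2) - polar beta w) /\
      beta * sin k <= Cmod (polar (sqrt q) (r / 2) + polar beta w)).
    { unfold opening in Hr.
      assert (T1 : Rabs (r / 2 - d / 2) <= k / 2).
      { replace (r / 2 - d / 2) with ((r - d) / 2) by field.
        unfold Rdiv at 1. rewrite Rabs_mult, (Rabs_pos_eq (/ 2)) by lra. lra. }
      apply polar_away; [lra|split; [lra|]|].
      - assert (T := Rabs_triang (r / 2 - w) (- (r / 2 - d / 2))).
        replace (r / 2 - w + - (r / 2 - d / 2)) with (d / 2 - w) in T by ring. rewrite Rabs_Ropp in T. lra.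
      - assert (T := Rabs_triang (r / 2 - d / 2) (d / 2 - w)).
        replace (r / 2 - d / 2 + (d / 2 - w)) with (r / 2 - w) in T by ring. lra. }
    assert (Hs : (v ^ 2 = polar (sqrt q) (r / 2) ^ 2)%C).
    { rewrite Hv, polar_sqr, pow2_sqrt by lra. f_equal. field. }
    destruct A as [A1 A2].
    destruct (Csqr_eq _ _ Hs) as [->| ->].
    + split; (eapply Rle_trans; [apply Rmin_r|assumption]).
    + replace (- polar (sqrt q) (r / 2) - polar beta w)%C with (- (polar (sqrt q) (r / 2) + polar beta w))%C by ring.
      replace (- polar (sqrt q) (r / 2) + polar beta w)%C with (- (polar (sqrt q) (r / 2) - polar beta w))%C by ring.
      rewrite !Cmod_opp. split; (eapply Rle_trans; [apply Rmin_r|assumption]).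
Qed.

Definition borel (phi : C -> C) (z s : C) : C := (/ 2 * sym phi z (Csqrt s))%C.

Lemma borel_sqr phi z w : borel phi z (w ^ 2) = (/ 2 * sym phi z w)%C.
Proof. unfold borel. now rewrite (even_Csqrt (sym phi z) w (even_sym phi z)). Qed.

Lemma borel_part (phi : C -> C) (u : nat -> C -> C) (z0 z : C) (rho beta w d k : R) :
  O_punctured 2 z0 phi ->
  0 < rho ->
  (forall z, Cmod z < rho -> u O z = phi z) ->
  (forall n, exists u', forall z, Cmod z < rho ->
      C_diff (u n) z (u' z) /\ C_diff u' z (RtoC (INR (S n)) * u (S n) z)%C) ->
  Cmod z < rho / 2 -> (z0 - z)%C = polar beta w -> 0 < beta ->
  0 < k -> 2 * k = Rabs (d / 2 - w) -> 2 * k <= 1 / 2 ->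
  borel_continuation d (2 * k) (fun n => u n z) (borel phi z).
Proof.
  intros Hp Hrho H0 Hu Hz Eb Hbeta Hk Ek Hk1.
  destruct (heat_family phi u rho H0 Hu) as (f & Hf & Hf0 & Hfe).
  set (r := Rmin (rho / 12) beta). assert (Hr : 0 < r) by (apply Rmin_pos; lra).
  assert (r1 : r <= rho / 12) by apply Rmin_l. assert (r2 : r <= beta) by apply Rmin_r.
  assert (Hball : smooth_on (closed_ball z (3 * r)) f).
  { intros n y Hy. apply Hf. unfold closed_ball in Hy.
    assert (T := Cmod_triangle (y - z) z). replace (y - z + z)%C with y in T by ring. lra. }
  assert (SER : forall s, Cmod s <= (r / 4) ^ 2 -> Cseries
        (fun n => (u n z * RtoC (INR (fact n) / INR (fact (2 * n))) * s ^ n)%C) (borel phi z s)).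
  { intros s Hs. assert (Hsq := Csqrt_sqr s). set (h := Csqrt s) in *.
    assert (Hh : Cmod h <= r / 4).
    { apply Rle_of_sqr; [lra|]. now rewrite <- Cmod_pow, Hsq. }
    assert (T1 := taylor f z r Hr Hball h Hh).
    assert (T2 := taylor f z r Hr Hball (- h)%C ltac:(now rewrite Cmod_opp)).
    assert (D : forall y, Cmod y <= r / 4 -> f 0%nat (z + y)%C = phi (z + y)%C).
    { intros y Hy. apply Hf0. eapply Rle_lt_trans; [apply Cmod_triangle|]. lra. }
    rewrite D in T1 by exact Hh. rewrite D in T2 by now rewrite Cmod_opp.
    assert (T := even_part_series (fun n => (f n z / INR (fact n))%C) h _ _ T1 T2).
    rewrite Hsq in T. refine (is_series_ext_C _ _ _ _ _ _ T).
    - intro n. rewrite Hfe, RtoC_div by apply INR_fact_neq_0. field. apply RtoC_neq_0, INR_fact_neq_0.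
    - unfold borel, sym. fold h. replace (z - h)%C with (z + - h)%C by ring. field. }
  assert (Q0 : 0 < (r / 4) ^ 2) by (apply pow_lt; lra).
  assert (Away : forall s v, disc_rays (opening d (2 * k)) ((r / 4) ^ 2) s -> (v ^ 2)%C = s ->
    Rmin (beta / 2) (beta * sin k) <= Cmod (v - (z0 - z)) /\ Rmin (beta / 2) (beta * sin k) <= Cmod (v + (z0 - z))).
  { intros s v Hs Hv. rewrite Eb. destruct Hs as [Hs|(q & x & Hq & Hx & Es)].
    - apply (sqrt_away d w beta k Hbeta Hk Ek Hk1 v 0). left.
      apply Rle_lt_trans with (r / 4); [|lra]. apply Rle_of_sqr; [lra|]. rewrite <- Cmod_pow, Hv. lra.
    - apply (sqrt_away d w beta k Hbeta Hk Ek Hk1 v x). right. split; [exact Hx|].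
      exists q. split; [exact Hq|]. now rewrite Hv. }
  assert (Hm : 0 < Rmin (beta / 2) (beta * sin k)).
  { apply Rmin_pos; [lra|]. apply Rmult_lt_0_compat; [lra|]. apply sin_pos_1. lra. }
  destruct Hp as [Hol Hgr].
  exists ((r / 4) ^ 2). split; [exact Q0|]. split; [split|].
  - intros s Hs. destruct (Ceq_dec s (RtoC 0)) as [->|Hn].
    + exact (power_series_diff_0 _ _ _ Q0 SER).
    + apply hol_at_mult; [apply hol_at_const|].
      rewrite <- (Csqrt_sqr s). destruct (Away s (Csqrt s) Hs (Csqrt_sqr s)).
      apply even_Csqrt_hol; [apply even_sym| |].
      * intro E. apply Hn. rewrite <- (Csqrt_sqr s), E. ring.
      * apply (hol_at_sym phi z0); trivial; lra.
  - intros l q rho' Hrho' HI.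
    destruct (punctured_growth z0 phi (conj Hol Hgr)) as (A2 & HA2 & HA).
    destruct (sym_growth phi z0 A2 HA2 HA z _ Hm) as (B & HB & HS).
    exists B, (2 * A2). split; [exact HB|]. split; [lra|]. intros s Hs.
    assert (Hs' : disc_rays (opening d (2 * k)) ((r / 4) ^ 2) s).
    { apply (disc_rays_sub (closed_itv l q) _ _ rho'); trivial. lra. }
    destruct (Away s (Csqrt s) Hs' (Csqrt_sqr s)) as [K1 K2].
    (* Growth of order 2 in the square root is growth of order 1 in [s]. *)
    specialize (HS _ K1 K2). unfold borel. rewrite <- Cmod_pow, Csqrt_sqr in HS.
    rewrite Cmod_mult, pow_1.
    assert (I2 : Cmod (/ 2) <= 1).
    { rewrite Cmod_inv by (apply RtoC_neq_0; lra). rewrite Cmod_R, Rabs_pos_eq by lra. lra. }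
    generalize (Cmod_ge_0 (/ 2)), (Cmod_ge_0 (sym phi z (Csqrt s))). intros. nra.
  - intros s Hs. apply SER. lra.
Qed.

(** ** Improper integrals against a Gaussian *)

Lemma is_RInt_exp_neg (c x y : R) : 0 < c ->
  is_RInt (V := R_NormedModule) (fun t => exp (- c * t)) x y (exp (- c * x) / c - exp (- c * y) / c).
Proof.
  intros Hc.
  replace (exp (- c * x) / c - exp (- c * y) / c) with
    (minus (G := R_NormedModule) ((fun t => - exp (- c * t) / c) y) ((fun t => - exp (- c * t) / c) x)).
  - apply (is_RInt_derive (V := R_CompleteNormedModule) (fun t => - exp (- c * t) / c)).
    + intros t _. auto_derive; [lra|]. field. lra.
    + intros t _. apply (ex_derive_continuous (K := R_AbsRing) (V := R_NormedModule)). auto_derive. trivial.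
  - unfold minus, plus, opp; simpl. field. lra.
Qed.

(** The Cauchy criterion with the tail bound (B/c) exp(-cx) gives the limit. It is returned in two
    forms: the generalised integral that defines the 1-sum, and truncations, to be compared with
    triangles. *)
Lemma improper_integral (h : R -> C) (B c : R) : 0 < c -> 0 <= B ->
  (forall x, 0 <= x -> continuous (U := C_R_NormedModule) h x) ->
  (forall x, 0 <= x -> Cmod (h x) <= B * exp (- c * x)) ->
  exists W : C,
    is_RInt_gen (V := C_R_NormedModule) h (at_point 0) (Rbar_locally p_infty) W /\
    forall eps, 0 < eps -> exists R0, forall T, R0 <= T -> Cmod (CInt h 0 T - W) < eps.
Proof.
  intros Hc HB Hcont Hbd.
  assert (Ex : forall x y, 0 <= x <= y -> ex_CInt h x y).
  { intros x y Hxy. apply (ex_RInt_continuous (V := C_R_CompleteNormedModule)).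
    intros t Ht. rewrite Rmin_left in Ht by lra. apply Hcont. lra. }
  assert (Tail : forall x y, 0 <= x <= y -> Cmod (CInt h 0 y - CInt h 0 x) <= B / c * exp (- c * x)).
  { intros x y Hxy.
    assert (E : (CInt h 0 y - CInt h 0 x)%C = CInt h x y).
    { assert (E := RInt_Chasles (V := C_R_CompleteNormedModule) h 0 x y (Ex 0 x ltac:(lra)) (Ex x y Hxy)).
      change ((CInt h 0 x + CInt h x y)%C = CInt h 0 y) in E. rewrite <- E. ring. }
    rewrite E, <- norm_C_R.
    assert (N := norm_RInt_le (V := C_R_NormedModule) h (fun t => B * exp (- c * t)) x y (CInt h x y)
      (B * (exp (- c * x) / c - exp (- c * y) / c)) ltac:(lra)).
    eapply Rle_trans; [apply N|].
    - intros t Ht. rewrite norm_C_R. apply Hbd. lra.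
    - apply (RInt_correct (V := C_R_CompleteNormedModule)). now apply Ex.
    - apply (is_RInt_scal (V := R_NormedModule) (fun t => exp (- c * t))). now apply is_RInt_exp_neg.
    - replace (B / c * exp (- c * x)) with (B * (exp (- c * x) / c)) by (field; lra).
      apply Rmult_le_compat_l; [exact HB|].
      assert (0 < exp (- c * y) / c) by (apply Rdiv_lt_0_compat; [apply exp_pos|exact Hc]). lra. }
  assert (Small : forall eps, 0 < eps -> exists R0, 0 <= R0 /\ forall x, R0 <= x -> B / c * exp (- c * x) < eps).
  { intros eps He. exists (B / (c * c * eps)).
    split. { apply Rdiv_le_0_compat; [exact HB|]. repeat apply Rmult_lt_0_compat; assumption. }
    intros x Hx.
    assert (X : 0 <= x). { eapply Rle_trans; [|exact Hx]. apply Rdiv_le_0_compat; [exact HB|]. repeat apply Rmult_lt_0_compat; assumption. }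
    assert (E1 : c * x < exp (c * x)) by (generalize (exp_ineq1_le (c * x)); lra).
    assert (E2 : exp (- c * x) * exp (c * x) = 1) by (rewrite <- exp_plus; replace (- c * x + c * x) with 0 by ring; apply exp_0).
    assert (P := exp_pos (- c * x)). assert (P2 := exp_pos (c * x)).
    apply Rmult_lt_reg_r with (c * exp (c * x)); [now apply Rmult_lt_0_compat|].
    replace (B / c * exp (- c * x) * (c * exp (c * x))) with (B * (exp (- c * x) * exp (c * x))) by (field; lra).
    rewrite E2, Rmult_1_r.
    apply Rle_lt_trans with (eps * (c * (c * x))).
    - apply Rle_div_l in Hx; [lra|]. repeat apply Rmult_lt_0_compat; assumption.
    - apply Rmult_lt_compat_l; [exact He|]. now apply Rmult_lt_compat_l. }
  destruct (proj1 (filterlim_locally_cauchy (U := C_R_CompleteNormedModule) (F := Rbar_locally p_infty) (CInt h 0))) as [W HW].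
  { intros eps. destruct (Small (eps / 2)) as [R0 [HR0 HS]]. { generalize (cond_pos eps). lra. }
    exists (fun T => R0 < T). split. { now exists R0. }
    intros x y Hx Hy.
    apply (norm_compat1 (V := C_R_NormedModule)). rewrite norm_C_R.
    change (Cmod (CInt h 0 y - CInt h 0 x) < eps). assert (Pe := cond_pos eps).
    destruct (Rle_lt_dec x y) as [L|L].
    - eapply Rle_lt_trans; [apply Tail; lra|]. specialize (HS x ltac:(lra)). lra.
    - rewrite Cmod_sub_sym. eapply Rle_lt_trans; [apply Tail; lra|]. specialize (HS y ltac:(lra)). lra. }
  exists W. split.
  - intros P HP. specialize (HW P HP). destruct HW as [M HM].
    exists (fun x => x = 0) (fun y => Rmax M 0 < y).
    + reflexivity.
    + now exists (Rmax M 0).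
    + intros x y -> Hy. exists (CInt h 0 y). simpl. split.
      * apply (RInt_correct (V := C_R_CompleteNormedModule)). apply Ex.
        generalize (Rmax_r M 0). lra.
      * apply HM. generalize (Rmax_l M 0). lra.
  - intros eps He.
    destruct (proj1 (filterlim_locally_ball_norm (U := C_R_NormedModule) _ W) HW (mkposreal _ He)) as [M HM].
    exists (M + 1). intros T HT. specialize (HM T ltac:(lra)).
    unfold ball_norm in HM. rewrite norm_C_R in HM. exact HM.
Qed.

Lemma CInt_ray (f : C -> C) (c : C) (T : R) : 0 <= T ->
  (forall x : R, 0 <= x -> hol_at f (x * c)%C) ->
  CInt (fun x => (c * f (x * c))%C) 0 T = seg f 0 (T * c)%C.
Proof.
  intros HT Hf.
  assert (Ex : ex_CInt (fun x => (c * f (x * c))%C) 0 T).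
  { apply (ex_RInt_ext (V := C_R_NormedModule) (fun x : R => (c * f (0 + x * c))%C)).
    { intros x _. replace (0 + x * c)%C with (x * c)%C by ring. reflexivity. }
    apply (ex_CInt_affine (fun s => (c * f s)%C) 0 c 0 T HT).
    intros x Hx. replace (0 + x * c)%C with (x * c)%C by ring.
    apply hol_at_mult; [apply hol_at_const|]. apply Hf. lra. }
  symmetry. apply seg_unique.
  apply (is_RInt_ext (V := C_R_NormedModule) (fun x => scal T (c * f ((T * x + 0)%R * c))%C)).
  { intros x _. rewrite scal_C_R.
    replace (0 + x * (T * c - 0))%C with ((T * x + 0)%R * c)%C by (rewrite RtoC_plus, RtoC_mult; ring).
    assert (E : forall w : C, (T * (c * w) = (T * c - 0) * w)%C) by (intro; ring). apply E. }
  apply (is_RInt_comp_lin (V := C_R_NormedModule) (fun x => (c * f (x * c))%C) T 0 0 1).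
  replace (T * 0 + 0) with 0 by ring. replace (T * 1 + 0) with T by ring.
  apply (RInt_correct (V := C_R_CompleteNormedModule)). exact Ex.
Qed.

(* g_(n+1) = 2 al (s g_n + n g_(n-1)) is the [n]-th derivative of
   g_1 = 2 al s g_0. *)
Fixpoint gauss_deriv (al : C) (n : nat) (s : C) : C :=
  match n with
  | O => Cexp (al * s ^ 2)
  | S m => (2 * al * (s * gauss_deriv al m s +
      match m with O => 0 | S p => INR m * gauss_deriv al p s end))%C
  end.

Lemma gauss_smooth (al : C) : smooth_on (fun _ => True) (gauss_deriv al).
Proof.
  (* The recursion reaches back two steps, so the induction carries two consecutive derivatives. *)
  assert (H : forall n z, C_diff (gauss_deriv al n) z (gauss_deriv al (S n) z) /\
    C_diff (gauss_deriv al (S n)) z (gauss_deriv al (S (S n)) z)).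
  { induction n as [|n IH]; intro z.
    - assert (H0 : forall z, C_diff (gauss_deriv al 0) z (gauss_deriv al 1 z)).
      { clear z. intro z. replace (gauss_deriv al 1 z) with (Cexp (al * z ^ 2) * (al * (RtoC (INR 2) * z ^ pred 2 * 1)))%C
          by (simpl; rewrite RtoC_plus; ring).
        apply (C_diff_comp Cexp (fun s => (al * s ^ 2)%C)); [apply C_diff_Cexp|].
        apply C_diff_scal. apply (C_diff_pow (fun s => s)). apply C_diff_id. }
      split; [apply H0|].
      replace (gauss_deriv al 2 z) with
        (2 * al * ((1 * gauss_deriv al 0 z + z * gauss_deriv al 1 z) + 0))%C by (simpl; ring).
      apply (C_diff_scal (fun s => (s * gauss_deriv al 0 s + 0)%C)).
      apply C_diff_plus; [|apply C_diff_const].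
      apply C_diff_mult; [apply C_diff_id|apply H0].
    - destruct (IH z) as [IH1 IH2]. split; [exact IH2|].
      replace (gauss_deriv al (S (S (S n))) z) with
        (2 * al * ((1 * gauss_deriv al (S n) z + z * gauss_deriv al (S (S n)) z) +
          INR (S n) * gauss_deriv al (S n) z))%C.
      + apply (C_diff_scal (fun s => (s * gauss_deriv al (S n) s + INR (S n) * gauss_deriv al n s)%C)).
        apply C_diff_plus.
        * apply C_diff_mult; [apply C_diff_id|exact IH2].
        * apply C_diff_scal. exact IH1.
      + change (gauss_deriv al (S (S (S n))) z) with
          (2 * al * (z * gauss_deriv al (S (S n)) z + INR (S (S n)) * gauss_deriv al (S n) z))%C.
        rewrite (S_INR (S n)), RtoC_plus. ring. }
  intros n z _. exact (proj1 (H n z)).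
Qed.

Lemma smooth_derive_n (f : nat -> C -> C) (g : C -> C) : smooth_on (fun _ => True) f ->
  (forall s, g s = f 0%nat s) -> forall n s, C_derive_n g n s = f n s.
Proof.
  intros Hf Hg. induction n as [|n IH]; intro s; [apply Hg|].
  simpl. apply is_C_derive_unique.
  apply (C_diff_ext_loc (f n) _ s _ 1 Rlt_0_1); [|now apply Hf].
  intros y _. symmetry. apply IH.
Qed.

(** * Polar arithmetic and decay of the Gaussian on the far side of the triangle *)

Lemma polar_mult (r x q y : R) : (polar r x * polar q y)%C = polar (r * q) (x + y).
Proof. unfold polar. rewrite RtoC_mult, cis_plus. ring. Qed.

Lemma polar_neq_0 (r x : R) : 0 < r -> polar r x <> RtoC 0.
Proof. intros H. apply Cmod_gt_0. rewrite Cmod_polar; lra. Qed.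

Lemma polar_inv (r x : R) : 0 < r -> (/ polar r x)%C = polar (/ r) (- x).
Proof.
  intros H. assert (N := polar_neq_0 r x H).
  assert (E : (polar r x * polar (/ r) (- x))%C = RtoC 1).
  { rewrite polar_mult, Rinv_r, Rplus_opp_r by lra. unfold polar. rewrite cis_0. ring. }
  replace (/ polar r x)%C with (/ polar r x * 1)%C by ring. rewrite <- E. field. exact N.
Qed.

Lemma heat_gauss_eq (r tau : R) (s : C) : 0 < r ->
  heat_gauss r tau s = gauss_deriv (- / (4 * polar r tau))%C 0 s.
Proof.
  intros Hr. unfold heat_gauss. simpl gauss_deriv. f_equal.
  assert (N := polar_neq_0 r tau Hr). field. exact N.
Qed.

(** Here [p] and [q] are directions in the t-plane, so their halves are the arguments of the
    endpoints. For p = q the chord degenerates to a point of a ray, which lets the same estimates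
    serve the rays. *)
Definition chord (T p q x : R) : C :=
  (polar T (p / 2) + x * (polar T (q / 2) - polar T (p / 2)))%C.

Lemma Re_polar (r x : R) : Re (polar r x) = r * cos x.
Proof. unfold polar, cis, Re, RtoC, Cmult; simpl. ring. Qed.

Lemma Re_plus (z w : C) : Re (z + w) = Re z + Re w.
Proof. reflexivity. Qed.

Lemma Re_scal (k : R) (z : C) : Re (k * z) = k * Re z.
Proof. unfold Re, RtoC, Cmult; simpl. ring. Qed.

(** The square of (1-x)A + xB has three terms, of arguments p, (p+q)/2 and q, with nonnegative
    weights that sum to T^2. A lower bound for the three cosines is thus a lower bound for the real
    part. *)
Lemma chord_sqr (T p q x tau k : R) : 0 <= T -> 0 <= x <= 1 ->
  k <= cos (p - tau) -> k <= cos ((p + q) / 2 - tau) -> k <= cos (q - tau) ->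
  k * T ^ 2 <= Re (chord T p q x ^ 2 * cis (- tau)).
Proof.
  intros HT Hx Hp Hm Hq.
  assert (E : (chord T p q x ^ 2 * cis (- tau))%C =
    (((1 - x) ^ 2 * T ^ 2)%R * cis (p - tau) + (2 * x * (1 - x) * T ^ 2)%R * cis ((p + q) / 2 - tau)
      + (x ^ 2 * T ^ 2)%R * cis (q - tau))%C).
  { unfold chord, polar.
    replace (p - tau) with (p / 2 + p / 2 + - tau) by field.
    replace ((p + q) / 2 - tau) with (p / 2 + q / 2 + - tau) by field.
    replace (q - tau) with (q / 2 + q / 2 + - tau) by field.
    rewrite !cis_plus, !RtoC_mult, !RtoC_pow, !RtoC_minus. ring. }
  rewrite E, !Re_plus, !Re_scal.
  change (Re (cis (p - tau))) with (cos (p - tau)). change (Re (cis (q - tau))) with (cos (q - tau)).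
  change (Re (cis ((p + q) / 2 - tau))) with (cos ((p + q) / 2 - tau)).
  assert (T2 := pow2_ge_0 T).
  assert (A1 : 0 <= (1 - x) ^ 2 * T ^ 2) by (apply Rmult_le_pos; [apply pow2_ge_0|exact T2]).
  assert (A2 : 0 <= 2 * x * (1 - x) * T ^ 2) by (apply Rmult_le_pos; [nra|exact T2]).
  assert (A3 : 0 <= x ^ 2 * T ^ 2) by (apply Rmult_le_pos; [apply pow2_ge_0|exact T2]).
  assert (B1 := Rmult_le_compat_l _ _ _ A1 Hp). assert (B2 := Rmult_le_compat_l _ _ _ A2 Hm).
  assert (B3 := Rmult_le_compat_l _ _ _ A3 Hq).
  replace (k * T ^ 2) with ((1 - x) ^ 2 * T ^ 2 * k + 2 * x * (1 - x) * T ^ 2 * k + x ^ 2 * T ^ 2 * k) by ring.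
  lra.
Qed.

Lemma chord_norm_le (T p q x : R) : 0 <= T -> 0 <= x <= 1 -> Cmod (chord T p q x) <= T.
Proof.
  intros HT Hx. unfold chord.
  replace (polar T (p / 2) + x * (polar T (q / 2) - polar T (p / 2)))%C with
    ((1 - x)%R * polar T (p / 2) + x * polar T (q / 2))%C by (rewrite RtoC_minus; ring).
  eapply Rle_trans; [apply Cmod_triangle|].
  rewrite !Cmod_mult, !Cmod_R, !Rabs_pos_eq, !Cmod_polar by lra. lra.
Qed.

Lemma chord_norm_ge (T p q x tau k : R) : 0 <= T -> 0 <= x <= 1 -> 0 <= k ->
  k <= cos (p - tau) -> k <= cos ((p + q) / 2 - tau) -> k <= cos (q - tau) ->
  sqrt k * T <= Cmod (chord T p q x).
Proof.
  intros HT Hx Hk Hp Hm Hq. apply Rle_of_sqr; [apply Cmod_ge_0|].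
  rewrite Rpow_mult_distr, pow2_sqrt by exact Hk.
  eapply Rle_trans; [now apply (chord_sqr T p q x tau k)|].
  eapply Rle_trans; [apply Rle_abs|]. eapply Rle_trans; [apply re_le_Cmod|].
  rewrite Cmod_mult, Cmod_cis, Cmod_pow. lra.
Qed.

Lemma heat_gauss_decay (r tau T p q x k : R) : 0 < r -> 0 <= T -> 0 <= x <= 1 ->
  k <= cos (p - tau) -> k <= cos ((p + q) / 2 - tau) -> k <= cos (q - tau) ->
  Cmod (heat_gauss r tau (chord T p q x)) <= exp (- (k * T ^ 2 / (4 * r))).
Proof.
  intros Hr HT Hx Hp Hm Hq. unfold heat_gauss. rewrite Cmod_Cexp. apply exp_le.
  set (s := chord T p q x) in *.
  assert (N := polar_neq_0 r tau Hr).
  assert (E : (- (s ^ 2) / (4 * polar r tau))%C = ((- / (4 * r))%R * (s ^ 2 * cis (- tau)))%C).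
  { replace (- s ^ 2 / (4 * polar r tau))%C with (- / 4 * s ^ 2 * / polar r tau)%C by (field; exact N).
    rewrite polar_inv by exact Hr. unfold polar.
    rewrite RtoC_opp, !RtoC_inv, RtoC_mult by lra. field. apply RtoC_neq_0. lra. }
  rewrite E, Re_scal.
  assert (C0 := chord_sqr T p q x tau k HT Hx Hp Hm Hq). fold s in C0.
  replace (- (k * T ^ 2 / (4 * r))) with (- / (4 * r) * (k * T ^ 2)) by (field; lra).
  rewrite <- !Ropp_mult_distr_l. apply Ropp_le_contravar. apply Rmult_le_compat_l; [|exact C0].
  left. apply Rinv_0_lt_compat. lra.
Qed.

(** ** The jump *)

Lemma heat_gauss_hol (r tau : R) (s : C) : 0 < r -> hol_at (heat_gauss r tau) s.
Proof.
  intros Hr. exists (gauss_deriv (- / (4 * polar r tau))%C 1 s).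
  apply (C_diff_ext_loc (gauss_deriv (- / (4 * polar r tau))%C 0) _ _ _ 1 Rlt_0_1).
  - intros y _. symmetry. now apply heat_gauss_eq.
  - now apply gauss_smooth.
Qed.

(** The condition makes the Gaussian rate k/(4r) exceed the growth rate 2A by at least 1, which
    leaves exp(-T^2). *)
Lemma gauss_absorbs (A k r T : R) : 0 < r -> 4 * r * (2 * A + 1) <= k ->
  exp (2 * A * T ^ 2) * exp (- (k * T ^ 2 / (4 * r))) <= exp (- T ^ 2).
Proof.
  intros Hr Hk. rewrite <- exp_plus. apply exp_le.
  assert (H : (2 * A + 1) <= k / (4 * r)) by (apply Rle_div_r; lra).
  replace (k * T ^ 2 / (4 * r)) with (k / (4 * r) * T ^ 2) by (field; lra).
  generalize (pow2_ge_0 T). intro. nra.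
Qed.

Section Jump.

Variables (z0 z : C) (phi phi0 : C -> C) (a : nat -> C) (beta w : R).
Hypothesis Hphi : holomorphic_on (fun s => s <> z0) phi.
Hypothesis Hbeta : 0 < beta.
Hypothesis Hb : (z0 - z)%C = polar beta w.

Variable A2 : R.
Hypothesis HA2 : 0 < A2.
Hypothesis Hgrowth : forall k, 0 < k -> exists B, 0 < B /\ forall s,
  k <= Cmod (s - (z0 - z)) -> k <= Cmod (s + (z0 - z)) ->
  Cmod (sym phi z s) <= B * exp (2 * A2 * Cmod s ^ 2).

Variables (r tau k : R).
Hypothesis Hr : 0 < r.
Hypothesis Hk : 0 < k.
Hypothesis Hrk : 4 * r * (2 * A2 + 1) <= k.

Let G := heat_gauss r tau.
Let FG := fun s => (sym phi z s * G s)%C.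

Lemma FG_bound (c : R) : 0 < c -> exists B, 0 < B /\ forall T p q x,
  0 <= T -> 0 <= x <= 1 ->
  k <= cos (p - tau) -> k <= cos ((p + q) / 2 - tau) -> k <= cos (q - tau) ->
  c <= Cmod (chord T p q x - (z0 - z)) -> c <= Cmod (chord T p q x + (z0 - z)) ->
  Cmod (FG (chord T p q x)) <= B * exp (- T ^ 2).
Proof.
  intros Hc. destruct (Hgrowth c Hc) as [B [HB HF]]. exists B. split; [exact HB|].
  intros T p q x HT Hx Hp Hm Hq C1 C2. specialize (HF _ C1 C2).
  assert (HG := heat_gauss_decay r tau T p q x k Hr HT Hx Hp Hm Hq).
  unfold FG. rewrite Cmod_mult.
  assert (HL := chord_norm_le T p q x HT Hx).
  assert (E : exp (2 * A2 * Cmod (chord T p q x) ^ 2) <= exp (2 * A2 * T ^ 2)).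
  { apply exp_le. apply Rmult_le_compat_l; [lra|]. apply pow_incr. split; [apply Cmod_ge_0|exact HL]. }
  eapply Rle_trans.
  { apply Rmult_le_compat; [apply Cmod_ge_0|apply Cmod_ge_0|exact HF|exact HG]. }
  rewrite Rmult_assoc. apply Rmult_le_compat_l; [lra|].
  eapply Rle_trans; [|apply (gauss_absorbs A2 k r T Hr Hrk)].
  apply Rmult_le_compat_r; [left; apply exp_pos|exact E].
Qed.

Lemma ray_away (d : R) : 0 < Rabs (d / 2 - w) <= 1 ->
  exists c, 0 < c /\ forall x, c <= Cmod (polar x (d / 2) - (z0 - z)) /\ c <= Cmod (polar x (d / 2) + (z0 - z)).
Proof.
  intros Hd. exists (beta * sin (Rabs (d / 2 - w))). split.
  - apply Rmult_lt_0_compat; [exact Hbeta|]. now apply sin_pos_1.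
  - intro y. rewrite Hb. apply polar_away; lra.
Qed.

Lemma FG_hol (s : C) : 0 < Cmod (s - (z0 - z)) -> 0 < Cmod (s + (z0 - z)) -> hol_at FG s.
Proof.
  intros H1 H2. apply hol_at_mult; [now apply (hol_at_sym phi z0)|now apply heat_gauss_hol].
Qed.

Lemma laplace_limit (d : R) : 0 < Rabs (d / 2 - w) <= 1 -> k <= cos (d - tau) ->
  exists W : C,
    is_RInt_gen (V := C_R_NormedModule) (fun x => (cis (d / 2) * FG (polar x (d / 2)))%C)
      (at_point 0) (Rbar_locally p_infty) W /\
    forall eps, 0 < eps -> exists R0, forall T, R0 <= T -> Cmod (seg FG 0 (polar T (d / 2)) - W) < eps.
Proof.
  intros Hd Hcos. destruct (ray_away d Hd) as [c [Hc HC]].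
  destruct (FG_bound c Hc) as [B [HB HF]].
  assert (Hhol : forall x, hol_at FG (polar x (d / 2))).
  { intro x. destruct (HC x). apply FG_hol; lra. }
  (* The bound B exp(-x^2) is weakened to B e exp(-x), the form that the convergence criterion
     takes. *)
  destruct (improper_integral (fun x => (cis (d / 2) * FG (polar x (d / 2)))%C) (B * exp 1) 1) as [W [HW HL]].
  - lra.
  - apply Rmult_le_pos; [lra|left; apply exp_pos].
  - intros x Hx.
    assert (HH : hol_at (fun s => (cis (d / 2) * FG s)%C) (0 + x * cis (d / 2))%C).
    { replace (0 + x * cis (d / 2))%C with (polar x (d / 2)) by (unfold polar; ring).
      apply hol_at_mult; [apply hol_at_const|apply Hhol]. }
    destruct HH as [l Hl].
    assert (HR := R_diff_cont _ _ _ (R_diff_comp_affine _ 0 (cis (d / 2)) x l Hl)).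
    apply (continuous_ext (U := C_R_NormedModule) (fun t : R => (cis (d / 2) * FG (0 + t * cis (d / 2)))%C)); [|exact HR].
    intro t. unfold polar. replace (0 + t * cis (d / 2))%C with (t * cis (d / 2))%C by ring. reflexivity.
  - intros x Hx. rewrite Cmod_mult, Cmod_cis, Rmult_1_l.
    assert (E : polar x (d / 2) = chord x d d 0) by (unfold chord; ring).
    destruct (HC x) as [C1 C2]. rewrite E in *.
    eapply Rle_trans; [apply HF; trivial; try lra|].
    { replace ((d + d) / 2) with d by field. exact Hcos. }
    rewrite Rmult_assoc, <- exp_plus. apply Rmult_le_compat_l; [lra|]. apply exp_le.
    generalize (pow2_ge_0 (x - 1)). nra.
  - exists W. split; [exact HW|]. intros eps He. destruct (HL eps He) as [R0 HR0].
    exists (Rmax R0 0). intros T HT.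
    assert (T0 : 0 <= T) by (eapply Rle_trans; [apply Rmax_r|exact HT]).
    specialize (HR0 T (Rle_trans _ _ _ (Rmax_l _ _) HT)).
    unfold polar. rewrite <- (CInt_ray FG (cis (d / 2)) T T0); [exact HR0|].
    intros x Hx. apply Hhol.
Qed.

Variables (p q : R).
Hypothesis Hp : p / 2 < w.
Hypothesis Hq : w < q / 2.
Hypothesis Hpq : q / 2 - p / 2 <= 1.
Hypothesis Cp : k <= cos (p - tau).
Hypothesis Cm : k <= cos ((p + q) / 2 - tau).
Hypothesis Cq : k <= cos (q - tau).

Lemma sqrt_k_pos : 0 < sqrt k.
Proof. now apply sqrt_lt_R0. Qed.

(** From the threshold on, the points of the chord have modulus at least beta + 1, whereas b and -b
    have modulus beta. *)
Lemma chord_away (T x : R) : (beta + 1) / sqrt k <= T -> 0 <= x <= 1 ->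
  1 <= Cmod (chord T p q x - (z0 - z)) /\ 1 <= Cmod (chord T p q x + (z0 - z)).
Proof.
  intros HT Hx. assert (S := sqrt_k_pos).
  assert (T0 : 0 <= T). { eapply Rle_trans; [|exact HT]. apply Rdiv_le_0_compat; lra. }
  assert (H := chord_norm_ge T p q x tau k T0 Hx (Rlt_le _ _ Hk) Cp Cm Cq).
  assert (HT' : beta + 1 <= sqrt k * T).
  { apply Rle_div_l in HT; [lra|exact S]. }
  assert (Nb : Cmod (z0 - z) = beta) by (rewrite Hb; apply Cmod_polar; lra).
  split.
  - generalize (Cmod_sub_ge (chord T p q x) (z0 - z)%C). lra.
  - generalize (Cmod_sub_ge (chord T p q x) (- (z0 - z))%C). rewrite Cmod_opp.
    replace (chord T p q x - - (z0 - z))%C with (chord T p q x + (z0 - z))%C by ring. lra.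
Qed.

Lemma chord_limit : forall eps, 0 < eps -> exists R0, forall T, R0 <= T ->
  Cmod (seg FG (polar T (p / 2)) (polar T (q / 2))) < eps.
Proof.
  intros eps He. destruct (FG_bound 1 Rlt_0_1) as [B [HB HF]].
  assert (S := sqrt_k_pos).
  (* The chord has length at most 2T, and T^2 exp(-T^2) <= 1, so the integral is at most 2B/T; the
     +1 makes the inequality strict. *)
  exists (Rmax ((beta + 1) / sqrt k) (2 * B / eps + 1)). intros T HT.
  assert (T1 : (beta + 1) / sqrt k <= T) by (eapply Rle_trans; [apply Rmax_l|exact HT]).
  assert (T2 : 2 * B / eps + 1 <= T) by (eapply Rle_trans; [apply Rmax_r|exact HT]).
  assert (P : 0 < 2 * B / eps) by (apply Rdiv_lt_0_compat; lra).
  assert (Bd : Cmod (seg FG (polar T (p / 2)) (polar T (q / 2))) <=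
    B * exp (- T ^ 2) * Cmod (polar T (q / 2) - polar T (p / 2))).
  { apply seg_norm_le.
    - intros x Hx. destruct (chord_away T x T1 Hx) as [C1 C2]. unfold chord in C1, C2. apply FG_hol; lra.
    - intros x Hx. destruct (chord_away T x T1 Hx) as [C1 C2]. apply HF; trivial. lra. }
  assert (L : Cmod (polar T (q / 2) - polar T (p / 2)) <= 2 * T).
  { eapply Rle_trans; [apply Cmod_triangle|]. rewrite Cmod_opp, !Cmod_polar by lra. lra. }
  assert (E : exp (- T ^ 2) * T ^ 2 <= 1).
  { rewrite <- (Rmult_1_r (exp _)) at 1.
    assert (E1 : T ^ 2 <= exp (T ^ 2)) by (generalize (exp_ineq1_le (T ^ 2)); lra).
    assert (E2 : exp (- T ^ 2) * exp (T ^ 2) = 1) by (rewrite <- exp_plus, Rplus_opp_l; apply exp_0).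
    assert (E3 := exp_pos (- T ^ 2)). nra. }
  assert (E3 := exp_pos (- T ^ 2)).
  eapply Rle_lt_trans; [exact Bd|].
  apply Rle_lt_trans with (B * exp (- T ^ 2) * (2 * T)). { apply Rmult_le_compat_l; [nra|exact L]. }
  assert (T3 : 2 * B < eps * T).
  { assert (Z : 2 * B / eps < T) by lra. apply Rlt_div_l in Z; [lra|exact He]. }
  apply Rmult_lt_reg_r with T; [lra|].
  apply Rle_lt_trans with (2 * B); [|exact T3].
  replace (B * exp (- T ^ 2) * (2 * T) * T) with (2 * B * (exp (- T ^ 2) * T ^ 2)) by ring.
  rewrite <- (Rmult_1_r (2 * B)) at 2. apply Rmult_le_compat_l; lra.
Qed.

(** Along the two rays the cross products are T beta times positive sines. For the far side one
    needs T^2 sin((q-p)/2) > T beta (sin(w-p/2) + sin(q/2-w)), and the last bracket is at most 2. *)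
Lemma triangle_encloses (T : R) : 2 * beta / sin (q / 2 - p / 2) < T ->
  encloses 0 (polar T (p / 2)) (polar T (q / 2)) (z0 - z).
Proof.
  intros HT. rewrite Hb.
  assert (S1 : 0 < sin (q / 2 - p / 2)) by (apply sin_pos_1; lra).
  assert (S2 : 0 < sin (w - p / 2)) by (apply sin_pos_1; lra).
  assert (S3 : 0 < sin (q / 2 - w)) by (apply sin_pos_1; lra).
  assert (T1 : 2 * beta < T * sin (q / 2 - p / 2)) by (now apply Rlt_div_l in HT).
  assert (T0 : 0 < T).
  { eapply Rlt_trans; [|exact HT]. apply Rdiv_lt_0_compat; lra. }
  assert (P1 : 0 < T * beta * sin (w - p / 2)) by (repeat apply Rmult_lt_0_compat; assumption).
  assert (P2 : 0 < T * beta * sin (q / 2 - w)) by (repeat apply Rmult_lt_0_compat; assumption).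
  assert (P3 : T * beta * (sin (w - p / 2) + sin (q / 2 - w)) <= T * beta * 2).
  { apply Rmult_le_compat_l; [nra|]. generalize (SIN_bound (w - p / 2)), (SIN_bound (q / 2 - w)). lra. }
  assert (P4 : T * (2 * beta) < T * (T * sin (q / 2 - p / 2))) by (apply Rmult_lt_compat_l; assumption).
  rewrite !sin_minus in *.
  apply encloses_cross; unfold polar, cis, Re, Im; simpl; lra.
Qed.

Hypothesis Hphi0 : holomorphic_on (fun _ => True) phi0.
Hypothesis Hform : forall s : C, s <> z0 -> Cseries
        (fun n => (a (S n) / (s - z0) ^ (S n))%C) (phi s - phi0 s)%C.

(** On the sides, which keep a positive distance from b, the Laurent series converges geometrically
    and may be integrated term by term. The value of the series does not involve [T]. *)
Lemma principal_part (T : R) : 2 * beta / sin (q / 2 - p / 2) < T ->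
  Cseries
    (fun n => (jump_coef a n * dirac_value n (z0 - z) G)%C)
    (/ (2 * PI * Ci) * tri (fun s => ((phi (z + s) - phi0 (z + s)) * G s)%C)
       0 (polar T (p / 2)) (polar T (q / 2)))%C.
Proof.
  intros HT. assert (ENC := triangle_encloses T HT).
  set (b := (z0 - z)%C) in *. set (A := polar T (p / 2)) in *. set (B := polar T (q / 2)) in *.
  set (al := (- / (4 * polar r tau))%C).
  assert (AV := encloses_avoids 0 A B b ENC).
  assert (GE : forall s, G s = gauss_deriv al 0 s) by (intro s; now apply heat_gauss_eq).
  assert (Sm : forall s, (z + s - z0)%C = (s - b)%C) by (intro; unfold b; ring).
  assert (HT0 : forall n, hol_tri (fun s => (gauss_deriv al 0 s * (/ (s - b)) ^ S n)%C) 0 A B).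
  { intro n. apply hol_tri_intro. intros x y Hxy t Ht.
    apply (hol_at_mult (gauss_deriv al 0) (fun s => ((/ (s - b)) ^ S n)%C)).
    - eexists. now apply gauss_smooth.
    - apply (hol_at_pow (fun s => (/ (s - b))%C)). now apply hol_at_inv_sub, AV. }
  destruct (tri_bounded (fun s => (/ (s - b))%C) 0 A B) as [M1 [HM1 B1]].
  { apply hol_tri_intro. intros x y Hxy t Ht. now apply hol_at_inv_sub, AV. }
  destruct (tri_bounded G 0 A B) as [M2 [HM2 B2]].
  { apply hol_tri_intro. intros x y Hxy t Ht. now apply heat_gauss_hol. }
  (* As |1/(s-b)| is bounded by M1 on the sides, they keep at least the distance 1/(M1+1) from b. *)
  destruct (laurent_tail z0 a _ Hform (/ (M1 + 1))) as [M [HM HTl]].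
  { apply Rinv_0_lt_compat. lra. }
  assert (SER := tri_series
    (fun n s => (a (S n) * (gauss_deriv al 0 s * (/ (s - b)) ^ S n))%C)
    (fun s => ((phi (z + s) - phi0 (z + s)) * G s)%C) (M * M2) 0 A B).
  refine (is_series_ext_C _ _ _ _ _ eq_refl (is_series_scal_C (/ (2 * PI * Ci)) _ _ (SER _ _ _ _))).
  - intro n. rewrite tri_scal by apply HT0.
    rewrite (residue_formula (fun _ => True) b 1) with (f := gauss_deriv al); trivial; try lra.
    2:{ intros x y t _ _ _. exact I. }
    2:{ intros x _. exact I. }
    2:{ apply gauss_smooth. }
    unfold dirac_value, jump_coef. rewrite (smooth_derive_n (gauss_deriv al) G (gauss_smooth al) GE).
    assert (N := two_pi_i_neq_0). set (v := (2 * PI * Ci)%C) in *.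
    assert (N2 : RtoC (INR (fact n)) <> RtoC 0) by apply RtoC_neq_0, INR_fact_neq_0.
    (* The sign in the action of the Dirac derivative cancels the one in [jump_coef], so the bare
       residue remains. *)
    assert (N3 : ((- (1)) ^ n * (- (1)) ^ n = 1)%C).
    { rewrite <- Cpow_mult_l. replace (- (1) * - (1))%C with (RtoC 1) by ring. apply Cpow_1_l. }
    set (e := ((- (1)) ^ n)%C) in *. set (g := gauss_deriv al n b).
    replace (a (S n) * e / INR (fact n) * (e * g))%C with (e * e * (a (S n) * g / INR (fact n)))%C by (field; exact N2).
    rewrite N3. field. auto.
  - intro n. destruct (HT0 n) as (T1 & T2 & T3). repeat split; now apply hol_seg_const_mult.
  - apply hol_tri_intro. intros x y Hxy t Ht. apply hol_at_mult; [|now apply heat_gauss_hol].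
    apply hol_at_minus; apply hol_at_shift; [|now apply Hphi0]. apply Hphi.
    intro E. apply (minus_neq_0 _ _ (AV x y Hxy t Ht)). rewrite <- Sm, E. ring.
  - nra.
  - intros x y Hxy t Ht n. specialize (AV x y Hxy t Ht). specialize (B1 x y Hxy t Ht). specialize (B2 x y Hxy t Ht).
    set (s := (x + t * (y - x))%C) in *.
    assert (Hs := minus_neq_0 s b AV). assert (Hs' : 0 < Cmod (s - b)) by now apply Cmod_gt_0.
    assert (K : / (M1 + 1) <= Cmod (z + s - z0)).
    { rewrite Sm. rewrite Cmod_inv in B1 by exact Hs.
      rewrite <- (Rinv_inv (Cmod (s - b))). apply Rinv_le_contravar; [|lra].
      now apply Rinv_0_lt_compat. }
    destruct (HTl _ K) as [_ TT]. specialize (TT n).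
    assert (E : @eq C (Csum (fun m => (a (S m) * (gauss_deriv al 0 s * (/ (s - b)) ^ S m))%C) n)
      (Csum (fun m => (a (S m) / (z + s - z0) ^ S m)%C) n * G s)%C).
    { assert (E0 : forall m, (a (S m) * (gauss_deriv al 0 s * (/ (s - b)) ^ S m))%C = (a (S m) / (z + s - z0) ^ S m * G s)%C).
      { intro m. rewrite Sm, GE, Cpow_inv by exact Hs. unfold Cdiv. ring. }
      clear TT. induction n as [|n IH].
      - rewrite !Csum_O. apply E0.
      - rewrite !Csum_S, IH, E0. ring. }
    match goal with |- Cmod ?x <= _ => replace x with
      ((Csum (fun m => (a (S m) / (z + s - z0) ^ S m)%C) n - (phi (z + s) - phi0 (z + s))) * G s)%C end.
    2:{ etransitivity; [|apply (f_equal (fun x => (x - _)%C) (eq_sym E))]. ring. }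
    rewrite Cmod_mult. replace (M * M2 / 2 ^ S n) with (M / 2 ^ S n * M2) by (unfold Rdiv; ring).
    apply Rmult_le_compat; trivial; apply Cmod_ge_0.
Qed.

(** * The integral of the part that is regular at b *)

Definition half_plane (v : R) (s : C) : Prop := 0 <= Re (s * cis (- v)).

Lemma half_plane_convex v : convex (half_plane v).
Proof.
  intros x y t Hx Hy Ht. unfold half_plane in *.
  replace ((x + t * (y - x)) * cis (- v))%C with ((1 - t)%R * (x * cis (- v)) + t * (y * cis (- v)))%C
    by (rewrite RtoC_minus; ring).
  rewrite Re_plus, !Re_scal. nra.
Qed.

Lemma half_plane_closed v : closed_set (half_plane v).
Proof.
  intros s H. unfold half_plane in *. apply Rnot_lt_le. intro L.
  destruct (H (- Re (s * cis (- v))) ltac:(lra)) as [y [Hy D]].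
  assert (E : (y * cis (- v))%C = (s * cis (- v) + (y - s) * cis (- v))%C) by ring.
  rewrite E, Re_plus in Hy.
  assert (B : Rabs (Re ((y - s) * cis (- v))) <= Cmod (y - s)).
  { eapply Rle_trans; [apply re_le_Cmod|]. rewrite Cmod_mult, Cmod_cis. lra. }
  apply Rabs_le_between in B. lra.
Qed.

Lemma half_plane_polar v T y : 0 <= T -> Rabs (y - v) <= 1 -> half_plane v (polar T y).
Proof.
  intros HT Hy. unfold half_plane.
  replace (polar T y * cis (- v))%C with (polar T (y - v)).
  - rewrite Re_polar. apply Rmult_le_pos; [exact HT|now apply cos_pos_1].
  - unfold polar, Rminus. rewrite cis_plus. ring.
Qed.

(** The half-plane bounded by the perpendicular to b at 0 contains the triangle, whose rays are
    within an angle 1 of b, and leaves out -b, the only singularity of phi(z-s). *)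
Lemma regular_part (T : R) : 0 <= T ->
  tri (fun s => ((phi0 (z + s) + phi (z - s)) * G s)%C) 0 (polar T (p / 2)) (polar T (q / 2)) = RtoC 0.
Proof.
  intros HT. apply (goursat (half_plane w)).
  - apply half_plane_convex.
  - apply half_plane_closed.
  - intros s Hs. apply hol_at_mult; [|now apply heat_gauss_hol].
    apply hol_at_plus; [apply hol_at_shift; now apply Hphi0|].
    apply hol_at_reflect. apply Hphi. intro E.
    assert (Es : s = polar (- beta) w).
    { rewrite <- polar_opp, <- Hb, <- E. ring. }
    unfold half_plane in Hs. rewrite Es in Hs.
    replace (polar (- beta) w * cis (- w))%C with (RtoC (- beta)) in Hs.
    + unfold Re, RtoC in Hs; simpl in Hs. lra.
    + unfold polar. replace (- beta * cis w * cis (- w))%C with (- beta * (cis w * cis (- w)))%C by ring.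
      rewrite <- Cmult_assoc, <- cis_plus, Rplus_opp_r, cis_0. ring.
  - unfold half_plane. replace (0 * cis (- w))%C with (RtoC 0) by ring. unfold Re, RtoC; simpl. lra.
  - apply half_plane_polar; [exact HT|]. rewrite Rabs_left; lra.
  - apply half_plane_polar; [exact HT|]. rewrite Rabs_pos_eq; lra.
Qed.

Lemma jump_formula (Wp Wm : C) :
  (forall eps, 0 < eps -> exists R0, forall T, R0 <= T -> Cmod (seg FG 0 (polar T (q / 2)) - Wp) < eps) ->
  (forall eps, 0 < eps -> exists R0, forall T, R0 <= T -> Cmod (seg FG 0 (polar T (p / 2)) - Wm) < eps) ->
  exists J, Cseries
      (fun n => (jump_coef a n * dirac_value n (z0 - z) G)%C) J /\
    (Wp - Wm)%C = (- (2 * PI * Ci) * J)%C.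
Proof.
  intros HWp HWm. assert (S := sqrt_k_pos).
  assert (S1 : 0 < sin (q / 2 - p / 2)) by (apply sin_pos_1; lra).
  assert (N := two_pi_i_neq_0). set (v := (2 * PI * Ci)%C) in *.
  set (R1 := Rmax ((beta + 1) / sqrt k) (2 * beta / sin (q / 2 - p / 2) + 1)).
  assert (L1 : (beta + 1) / sqrt k <= R1) by apply Rmax_l.
  assert (L2 : 2 * beta / sin (q / 2 - p / 2) + 1 <= R1) by apply Rmax_r.
  assert (R1p : 0 < R1).
  { assert (0 < (beta + 1) / sqrt k) by (apply Rdiv_lt_0_compat; lra). lra. }
  set (PG := fun s => ((phi (z + s) - phi0 (z + s)) * G s)%C).
  (* The sum is defined by one fixed triangle; uniqueness of sums of series identifies it below with
     the value of every larger triangle. *)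
  set (J := (/ v * tri PG 0 (polar R1 (p / 2)) (polar R1 (q / 2)))%C).
  assert (HJ := principal_part R1 ltac:(lra)). fold v PG in HJ. fold J in HJ.
  exists J. split; [exact HJ|].
  (* The positive orientation runs out along p/2 and back along q/2, so the difference of the ray
     integrals in the order q minus p carries a minus sign. *)
  assert (E : forall T, R1 <= T ->
    (seg FG 0 (polar T (q / 2)) - seg FG 0 (polar T (p / 2)) - seg FG (polar T (p / 2)) (polar T (q / 2)))%C
      = (- v * J)%C).
  { intros T HT.
    assert (HJT := principal_part T ltac:(lra)). fold v PG in HJT.
    assert (EJ : J = (/ v * tri PG 0 (polar T (p / 2)) (polar T (q / 2)))%C).
    { exact (filterlim_locally_unique (V := C_NormedModule) _ _ _ HJ HJT). }
    assert (ENC := triangle_encloses T ltac:(lra)).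
    assert (AV := encloses_avoids _ _ _ _ ENC).
    set (A := polar T (p / 2)) in *. set (B := polar T (q / 2)) in *.
    assert (HPG : hol_tri PG 0 A B).
    { apply hol_tri_intro. intros x y Hxy t Ht. apply hol_at_mult; [|now apply heat_gauss_hol].
      apply hol_at_minus; apply hol_at_shift; [|now apply Hphi0]. apply Hphi.
      intro E. apply (minus_neq_0 _ _ (AV x y Hxy t Ht)).
      set (s := (x + t * (y - x))%C) in *. replace (s - (z0 - z))%C with (z + s - z0)%C by ring. rewrite E. ring. }
    assert (HFG : hol_tri FG 0 A B).
    { assert (Hray : forall y : R, Rabs (y - w) <= 1 -> 0 < Rabs (y - w) -> hol_seg FG 0 (polar T y)).
      { intros y Y1 Y2 x Hx. replace (0 + x * (polar T y - 0))%C with (polar (x * T) y)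
          by (unfold polar; rewrite RtoC_mult; ring).
        destruct (ray_away (2 * y)) as [c [Hc HC]].
        { replace (2 * y / 2) with y by field. lra. }
        replace (2 * y / 2) with y in HC by field. destruct (HC (x * T)). apply FG_hol; lra. }
      assert (HpA : hol_seg FG 0 A) by (apply Hray; [rewrite Rabs_left; lra|apply Rabs_pos_lt; lra]).
      assert (HqB : hol_seg FG 0 B) by (apply Hray; [rewrite Rabs_pos_eq; lra|apply Rabs_pos_lt; lra]).
      split; [exact HpA|]. split.
      - intros x Hx. destruct (chord_away T x ltac:(lra) Hx) as [C1 C2].
        apply FG_hol; (eapply Rlt_le_trans; [apply Rlt_0_1|]); [exact C1|exact C2].
      - intros x Hx. replace (B + x * (0 - B))%C with (0 + (1 - x)%R * (B - 0))%C by (rewrite RtoC_minus; ring).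
        apply HqB. lra. }
    assert (ET : tri FG 0 A B = (v * J)%C).
    { assert (HH := regular_part T ltac:(lra)). fold A B in HH.
      assert (D : tri (fun s => (FG s - PG s)%C) 0 A B = RtoC 0).
      { etransitivity; [|exact HH]. apply tri_ext. intros. unfold FG, PG, sym. ring. }
      rewrite tri_minus in D by assumption.
      rewrite EJ. set (t1 := tri FG 0 A B) in *. set (t2 := tri PG 0 A B) in *.
      replace t1 with (t1 - t2 + t2)%C by ring. rewrite D. field. exact N. }
    destruct HFG as (F1 & F2 & F3).
    assert (SW := seg_swap FG B 0 F3). unfold tri in ET. rewrite SW.
    replace (- v * J)%C with (- (v * J))%C by ring. rewrite <- ET. ring. }
  (* This number is independent of [T] and bounded by the two truncation errors and the chord
     integral, each below eps/3 for large [T]. *)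
  set (D := (Wp - Wm - - v * J)%C).
  assert (HD : D = RtoC 0).
  { apply Cmod_eq_0. apply Rle_antisym; [|apply Cmod_ge_0]. apply le_epsilon. intros eps He.
    rewrite Rplus_0_l.
    destruct (HWp (eps / 3) ltac:(lra)) as [Ra Ha]. destruct (HWm (eps / 3) ltac:(lra)) as [Rb Hb'].
    destruct (chord_limit (eps / 3) ltac:(lra)) as [Rc Hc].
    set (T := Rmax R1 (Rmax Ra (Rmax Rb Rc))).
    assert (Q1 : R1 <= T) by apply Rmax_l.
    assert (Q2 : Ra <= T) by (eapply Rle_trans; [apply Rmax_l|apply Rmax_r]).
    assert (Q3 : Rb <= T) by (eapply Rle_trans; [apply Rmax_l|eapply Rle_trans; [apply Rmax_r|apply Rmax_r]]).
    assert (Q4 : Rc <= T) by (eapply Rle_trans; [apply Rmax_r|eapply Rle_trans; [apply Rmax_r|apply Rmax_r]]).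
    specialize (Ha T Q2). specialize (Hb' T Q3). specialize (Hc T Q4). specialize (E T Q1).
    unfold D. rewrite <- E.
    set (sp := seg FG 0 (polar T (q / 2))) in *. set (sm := seg FG 0 (polar T (p / 2))) in *.
    set (sc := seg FG (polar T (p / 2)) (polar T (q / 2))) in *.
    replace (Wp - Wm - (sp - sm - sc))%C with (- (sp - Wp) + (sm - Wm) + sc)%C by ring.
    eapply Rle_trans; [apply Cmod_triangle|].
    eapply Rle_trans; [apply Rplus_le_compat_r, Cmod_triangle|]. rewrite Cmod_opp. lra. }
  replace (Wp - Wm)%C with (D + - v * J)%C by (unfold D; ring). rewrite HD. ring.
Qed.

End Jump.

(** ** One-sums *)

Lemma sqrt_polar_sqr (r tau : R) : 0 < r -> (sqrt_polar r tau ^ 2)%C = polar r tau.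
Proof.
  intros Hr. unfold sqrt_polar. rewrite polar_sqr, pow2_sqrt by lra. f_equal. field.
Qed.

Lemma sqrt_polar_neq_0 (r tau : R) : 0 < r -> sqrt_polar r tau <> RtoC 0.
Proof. intros Hr. apply polar_neq_0. now apply sqrt_lt_R0. Qed.

(** After s -> s^2 the kernel becomes the heat kernel. The constant collects 1/2 from the Borel
    transform and 1/sqrt(PI) from [kernel2]. *)
Lemma laplace_integrand (phi : C -> C) (z : C) (d r tau x : R) : 0 < r ->
  (borel phi z (polar (x ^ 2) d) * kernel2 (polar x (d / 2) / sqrt_polar r tau) * cis (d / 2))%C =
  (RtoC (/ (2 * sqrt PI)) *
    (cis (d / 2) * (sym phi z (polar x (d / 2)) * heat_gauss r tau (polar x (d / 2)))))%C.
Proof.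
  intros Hr. set (s := polar x (d / 2)).
  assert (P : 0 < sqrt PI) by apply sqrt_lt_R0, PI_RGT_0.
  assert (Es : polar (x ^ 2) d = (s ^ 2)%C).
  { unfold s. rewrite polar_sqr. f_equal. field. }
  rewrite Es, borel_sqr. unfold kernel2, heat_gauss.
  assert (N := sqrt_polar_neq_0 r tau Hr). rewrite <- (sqrt_polar_sqr r tau Hr).
  set (q := sqrt_polar r tau) in *.
  replace (- (s / q) ^ 2 / 4)%C with (- s ^ 2 / (4 * q ^ 2))%C by (field; exact N).
  rewrite !RtoC_inv, RtoC_mult by lra. field. apply RtoC_neq_0. lra.
Qed.

(** The integral is total, so this is a function on all points of the covering; [one_sum_laplace]
    gives it its meaning where the integral converges. *)
Definition one_sum (phi : C -> C) (z : C) (d r tau : R) : C :=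
  (RInt_gen (V := C_R_CompleteNormedModule)
     (fun x => (borel phi z (polar (x ^ 2) d) * kernel2 (polar x (d / 2) / sqrt_polar r tau) * cis (d / 2))%C)
     (at_point 0) (Rbar_locally p_infty) / sqrt_polar r tau)%C.

Lemma one_sum_laplace (phi : C -> C) (z W : C) (d r tau : R) : 0 < r ->
  is_RInt_gen (V := C_R_NormedModule)
    (fun x => (cis (d / 2) * (sym phi z (polar x (d / 2)) * heat_gauss r tau (polar x (d / 2))))%C)
    (at_point 0) (Rbar_locally p_infty) W ->
  is_laplace (borel phi z) d r tau (one_sum phi z d r tau) /\
  one_sum phi z d r tau = (RtoC (/ (2 * sqrt PI)) * W / sqrt_polar r tau)%C.
Proof.
  intros Hr HW.
  set (h := fun x => (borel phi z (polar (x ^ 2) d) * kernel2 (polar x (d / 2) / sqrt_polar r tau) * cis (d / 2))%C).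
  assert (H : is_RInt_gen (V := C_R_NormedModule) h (at_point 0) (Rbar_locally p_infty)
    (RtoC (/ (2 * sqrt PI)) * W)%C).
  { rewrite <- scal_C_R.
    apply (is_RInt_gen_ext (V := C_R_NormedModule) (fun x => scal (/ (2 * sqrt PI))
      (cis (d / 2) * (sym phi z (polar x (d / 2)) * heat_gauss r tau (polar x (d / 2))))%C)).
    - apply filter_forall. intros [y1 y2] x _. rewrite scal_C_R. symmetry. exact (laplace_integrand phi z d r tau x Hr).
    - now apply (is_RInt_gen_scal (V := C_R_NormedModule)). }
  assert (E : RInt_gen (V := C_R_CompleteNormedModule) h (at_point 0) (Rbar_locally p_infty) =
    (RtoC (/ (2 * sqrt PI)) * W)%C).
  { now apply (is_RInt_gen_unique (V := C_R_CompleteNormedModule)). }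
  unfold one_sum. fold h. rewrite E. split; [|reflexivity].
  exists (RtoC (/ (2 * sqrt PI)) * W)%C. split; [exact H|reflexivity].
Qed.

Lemma cos_ge_sin (x e : R) : 0 <= e -> Rabs x <= PI / 2 - e -> sin e <= cos x.
Proof.
  intros He Hx. assert (P := PI_RGT_0). assert (P0 := Rabs_pos x).
  assert (E : cos x = cos (Rabs x)).
  { destruct (Rle_lt_dec 0 x) as [H|H].
    - now rewrite Rabs_pos_eq.
    - rewrite Rabs_left by exact H. now rewrite cos_neg. }
  rewrite E, <- cos_shift. apply cos_decr_1; lra.
Qed.

Lemma arg_branch_near (z0 : C) (th : R) (thz : C -> R) (e : R) : arg_branch z0 th thz -> 0 < e ->
  exists r, 0 < r /\ forall z, Cmod z < r ->
    (z0 - z)%C = polar (Cmod (z0 - z)) (thz z) /\ Rabs (thz z - th) < e.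
Proof.
  intros (H0 & rho & Hrho & H) He.
  destruct (H 0%C ltac:(rewrite Cmod_0; exact Hrho)) as [_ Hc].
  destruct (proj1 (filterlim_locally (U := R_UniformSpace) thz (thz 0%C)) Hc (mkposreal _ He)) as [d Hd].
  exists (Rmin rho d). split; [apply Rmin_pos; [exact Hrho|apply cond_pos]|].
  intros z Hz. apply Rmin_Rgt in Hz. destruct Hz as [Z1 Z2]. split.
  - now apply H.
  - rewrite <- H0. apply Hd. apply C_NormedModule_mixin_compat1.
    change (Cmod (z - 0) < d). replace (z - 0)%C with z by ring. exact Z2.
Qed.

Theorem theorem1
  (z0 : C) (hz0 : z0 <> RtoC 0)
  (phi phi0 : C -> C) (a : nat -> C)
  (hphi : O_punctured 2 z0 phi)
  (hphi0 : O_entire 2 phi0)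
  (ha : exists l : R,
      is_lim_seq (fun n => nth_root (S n) (Cmod (a (S n)))) l /\ l < 1)
  (hform : forall z : C, z <> z0 ->
      is_series (K := C_AbsRing) (V := C_NormedModule)
        (fun n => (a (S n) / (z - z0) ^ (S n))%C) (phi z - phi0 z)%C)
  (theta : R) (htheta : z0 = polar (Cmod z0) theta)
  (thz : C -> R) (hthz : arg_branch z0 theta thz)
  (delta : R) (hdelta : delta = 2 * theta)
  (u : nat -> C -> C) (hu : formal_heat_solution phi u) :
  exists eps0 : R, 0 < eps0 /\
  forall eps : R, 0 < eps < eps0 ->
  exists r alpha0 eta : R, 0 < r /\ 0 < alpha0 /\ 0 < eta /\
  forall z : C, Cmod z < r ->
    2 * Rabs (thz z - theta) < alpha0 /\
    2 * Rabs (thz z - theta) < eta /\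
    (forall alpha : R, 2 * Rabs (thz z - theta) < alpha < alpha0 ->
      let F := fun s : C => (phi (z + s) + phi (z - s))%C in
      (exists P : C -> C,
        (forall s : C, s <> (z0 - z)%C ->
          is_series (K := C_AbsRing) (V := C_NormedModule)
            (fun n => (a (S n) / (z + s - z0) ^ (S n))%C) (P s)) /\
        hyper_eq 2 theta alpha (thz z) F P) /\
      (exists Q : C -> C,
        hyper_series 2 theta alpha (thz z)
          (fun n s => (jump_coef a n * dirac n (z0 - z) s)%C) Q /\
        hyper_eq 2 theta alpha (thz z) F
          (fun s => (- (2 * PI * Ci) * Q s)%C))) /\
    (forall dplus dminus : R,
      delta < dplus < delta + eta ->
      delta - eta < dminus < delta ->
      dminus / 2 < thz z < dplus / 2 ->
      exists uplus uminus : R -> R -> C,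
        is_one_sum dplus (fun n => u n z) (sector delta (PI - eps) r) uplus /\
        is_one_sum dminus (fun n => u n z) (sector delta (PI - eps) r) uminus /\
        forall rt tau : R, sector delta (PI - eps) r rt tau ->
          exists J : C,
            is_series (K := C_AbsRing) (V := C_NormedModule)
              (fun n => (jump_coef a n
                         * dirac_value n (z0 - z) (heat_gauss rt tau))%C) J /\
            (uplus rt tau - uminus rt tau)%C
              = (- Ci * (RtoC (sqrt PI) / sqrt_polar rt tau) * J)%C).
Proof.
  destruct (punctured_growth z0 phi hphi) as (A2 & HA2 & Hgr).
  destruct hu as (rho & Hrho & Hu0 & Hu).
  assert (Hz0 : 0 < Cmod z0) by now apply Cmod_gt_0.
  exists 1. split; [lra|]. intros eps Heps.
  (* The bound eps/8 gives 2|thz z - theta| < eps/4 = eta, so admissible directions on both sides of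
     2 thz z exist within eta of delta. *)
  destruct (arg_branch_near z0 theta thz (eps / 8) hthz ltac:(lra)) as (r0 & Hr0 & Harg).
  (* It bounds cos(d - tau) from below, since |d - delta| <= eps/4 and |tau - delta| < (PI -
     eps)/2. *)
  set (k := sin (eps / 4)). assert (Hk : 0 < k) by (apply sin_pos_1; lra).
  set (r1 := k / (4 * (2 * A2 + 1))). assert (Hr1 : 0 < r1) by (apply Rdiv_lt_0_compat; lra).
  (* In turn: the branch of the argument, absorption of the growth by the Gaussian, the domain of
     the formal solution, and z <> z0. *)
  set (r := Rmin (Rmin r0 r1) (Rmin (rho / 2) (Cmod z0))).
  exists r, 1, (eps / 4). split; [repeat apply Rmin_pos; lra|]. split; [lra|]. split; [lra|].
  intros z Hz.
  assert (Lr0 : r <= r0) by (eapply Rle_trans; [apply Rmin_l|apply Rmin_l]).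
  assert (Lr1 : r <= r1) by (eapply Rle_trans; [apply Rmin_l|apply Rmin_r]).
  assert (Lr2 : r <= rho / 2) by (eapply Rle_trans; [apply Rmin_r|apply Rmin_l]).
  assert (Lr3 : r <= Cmod z0) by (eapply Rle_trans; [apply Rmin_r|apply Rmin_r]).
  destruct (Harg z ltac:(lra)) as [Eb Hth].
  set (beta := Cmod (z0 - z)) in *. set (w := thz z) in *.
  assert (Hbeta : 0 < beta).
  { generalize (Cmod_sub_ge z0 z). fold beta. lra. }
  split; [lra|]. split; [lra|]. split.
  - intros alpha Halpha. apply (hyper_part z0 z phi phi0 a theta alpha w beta); assumption.
  - intros dp dm Hdp Hdm Hw.
    assert (Hth' : - (eps / 8) < w - theta < eps / 8) by (apply Rabs_lt_between; exact Hth).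
    assert (Hsym := sym_growth phi z0 A2 HA2 Hgr z).
    assert (Hcos : forall d tau, Rabs (d - delta) <= eps / 4 -> opening delta (PI - eps) tau -> k <= cos (d - tau)).
    { intros d tau Hd Ht. apply cos_ge_sin; [lra|]. unfold opening in Ht.
      replace (d - tau) with ((d - delta) + - (tau - delta)) by ring.
      eapply Rle_trans; [apply Rabs_triang|]. rewrite Rabs_Ropp. lra. }
    assert (Hrk : forall rt, rt < r -> 4 * rt * (2 * A2 + 1) <= k).
    { intros rt Hrt. replace k with (4 * r1 * (2 * A2 + 1)) by (unfold r1; field; lra).
      apply Rmult_le_compat_r; lra. }
    assert (Hsum : forall d, Rabs (d - delta) <= eps / 4 -> 0 < Rabs (d / 2 - w) ->
      is_one_sum d (fun n => u n z) (sector delta (PI - eps) r) (one_sum phi z d) /\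
      forall rt tau, sector delta (PI - eps) r rt tau -> exists W,
        one_sum phi z d rt tau = (RtoC (/ (2 * sqrt PI)) * W / sqrt_polar rt tau)%C /\
        forall e, 0 < e -> exists R0, forall T, R0 <= T ->
          Cmod (seg (fun s => (sym phi z s * heat_gauss rt tau s)%C) 0 (polar T (d / 2)) - W) < e).
    { intros d Hd Hdw.
      assert (Hd2 : Rabs (d / 2 - w) <= 1 / 2).
      { apply Rabs_le_between in Hd. apply Rabs_le. lra. }
      assert (HL : forall rt tau, sector delta (PI - eps) r rt tau -> exists W,
        is_RInt_gen (V := C_R_NormedModule)
          (fun x => (cis (d / 2) * (sym phi z (polar x (d / 2)) * heat_gauss rt tau (polar x (d / 2))))%C)
          (at_point 0) (Rbar_locally p_infty) W /\
        forall e, 0 < e -> exists R0, forall T, R0 <= T ->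
          Cmod (seg (fun s => (sym phi z s * heat_gauss rt tau s)%C) 0 (polar T (d / 2)) - W) < e).
      { intros rt tau [Hrt Htau].
        apply (laplace_limit z0 z phi beta w (proj1 hphi) Hbeta Eb A2 HA2 Hsym rt tau k); try lra.
        - apply Hrk. lra.
        - now apply Hcos. }
      split.
      (* The opening is written as 2k with k = |d/2 - w|/2, the margin for which [borel_part] keeps
         both square roots away from b and -b. *)
      - exists (2 * (Rabs (d / 2 - w) / 2)), (borel phi z). split; [lra|]. split.
        + apply (borel_part phi u z0 z rho beta w d); try assumption; lra.
        + (* [d] itself serves as psi, as |tau - d| <= PI/2 - eps/4. *)
          intros rt tau Hs. exists d. split; [|split].
          * unfold opening. replace (d - d) with 0 by ring. rewrite Rabs_R0. lra.
          * destruct Hs as [_ Ht]. unfold opening in Ht.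
            replace (tau - d) with ((tau - delta) + - (d - delta)) by ring.
            eapply Rle_lt_trans; [apply Rabs_triang|]. rewrite Rabs_Ropp. lra.
          * destruct (HL rt tau Hs) as [W [HW _]].
            apply (one_sum_laplace phi z W); [apply Hs|exact HW].
      - intros rt tau Hs. destruct (HL rt tau Hs) as [W [HW HLim]].
        exists W. split; [|exact HLim].
        apply (one_sum_laplace phi z W); [apply Hs|exact HW]. }
    assert (Dp : Rabs (dp - delta) <= eps / 4) by (apply Rabs_le; lra).
    assert (Dm : Rabs (dm - delta) <= eps / 4) by (apply Rabs_le; lra).
    destruct (Hsum dp Dp) as [Sp Lp]. { apply Rabs_pos_lt. lra. }
    destruct (Hsum dm Dm) as [Sm Lm]. { apply Rabs_pos_lt. lra. }
    exists (one_sum phi z dp), (one_sum phi z dm). split; [exact Sp|]. split; [exact Sm|].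
    intros rt tau Hs.
    destruct (Lp rt tau Hs) as [Wp [Ep HWp]]. destruct (Lm rt tau Hs) as [Wm [Em HWm]].
    destruct Hs as [Hrt Htau].
    destruct (jump_formula z0 z phi phi0 a beta w (proj1 hphi) Hbeta Eb A2 HA2 Hsym rt tau k
      ltac:(lra) Hk (Hrk rt ltac:(lra)) dm dp) with (Wp := Wp) (Wm := Wm) as [J [HJ EJ]]; try assumption; try lra.
    + now apply Hcos.
    + apply Hcos; [apply Rabs_le; lra|exact Htau].
    + now apply Hcos.
    + apply (proj1 hphi0).
    + exists J. split; [exact HJ|]. rewrite Ep, Em.
      assert (N := sqrt_polar_neq_0 rt tau (proj1 Hrt)). set (q := sqrt_polar rt tau) in *.
      replace (RtoC (/ (2 * sqrt PI)) * Wp / q - RtoC (/ (2 * sqrt PI)) * Wm / q)%C with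
        (RtoC (/ (2 * sqrt PI)) * (Wp - Wm) / q)%C by (field; exact N).
      rewrite EJ. assert (P : 0 < sqrt PI) by apply sqrt_lt_R0, PI_RGT_0.
      (* The constant is -2 PI i / (2 sqrt(PI)) = -i sqrt(PI). *)
      rewrite <- (sqrt_sqrt PI) at 2 by (left; apply PI_RGT_0).
      rewrite RtoC_inv, !RtoC_mult by lra. field. split; [exact N|]. apply RtoC_neq_0. lra.
Qed.
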